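(* Let $d,K,N\ge1$ and $f_k:\mathbb{R}^{kd}\to\mathbb{R}$, $k=1,\dots,K$, with $\hat F(\bar{\boldsymbol x}_K)=\sum_{k=1}^Kf_k(\bar{\boldsymbol x}_k)$, $\bar{\boldsymbol x}_k=[\boldsymbol x_1^\top,\dots,\boldsymbol x_k^\top]^\top$. Assume (A1) all $f_k$ convex; (A2) each $f_i$ is $L_i$-Lipschitz w.r.t. the Euclidean norm; (A3) with $\bar{\boldsymbol\mu}_K^*=[\boldsymbol\mu_1^{*\top},\dots,\boldsymbol\mu_K^{*\top}]^\top$ a minimizer of $\hat F$: $\sum_k\|\boldsymbol\mu_k^1-\boldsymbol\mu_k^*\|^2_{(\boldsymbol\Sigma_k^1)^{-1}}\le R$, $\underline\nu\boldsymbol I\preceq\bar{\boldsymbol\Sigma}_K^1\preceq\bar\nu\boldsymbol I$ with $\bar\nu\ge\underline\nu>0$, $\sum_k\|\boldsymbol\mu_k^*\|_2^2\le B$. Take $\beta_t=t\beta$ ($\beta>0$), $\alpha_t=\sqrt{t+1}\,\alpha$ ($\alpha>0$), $\nu>0$, $\gamma_t=\frac{\alpha\nu}{\beta\sqrt{t+1}}$, $\omega_t=1$, initial covariances with $\|\boldsymbol\Sigma_k^1\|_2^{-1}\ge\frac53\alpha\nu$ for all $k$, and suppose that at every iteration the constraints (C1) and (C2) on $\boldsymbol H_k^t$ always have feasible solutions (so the matrices $\boldsymbol H_k^t$ used satisfy them). Then running the CASBO algorithm for $T$ steps gives $$\frac1T\sum_{t=1}^T\sum_{k=1}^K\mathbb{E}\,f_k(\bar{\boldsymbol\mu}_k^t)-\sum_{k=1}^Kf_k(\bar{\boldsymbol\mu}_k^*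 )\le\frac{\sum_{k=1}^K\|\boldsymbol\mu_k^1-\boldsymbol\mu_k^*\|^2_{(\boldsymbol\Sigma_k^1)^{-1}}}{2\beta T}+\frac{2\sqrt{T+1}\,C_1}{T}+\frac{4(T+1)^{1/4}C_2}{T}+\frac{\sqrt{T+2}\,C_3}{T}\le O\Big(\frac{d^2K^4}{\sqrt T}\Big),$$ with $C_1=\frac{3\beta\sum_{i=1}^KKL_i^2(id+1)^2}{2\alpha\nu}$, $C_2=\frac{\sum_{i=1}^K\sqrt3\,idL_i}{\sqrt{\alpha\nu}}$, $C_3=\frac{\alpha\nu B}{\beta}$, $\bar{\boldsymbol\mu}_k^t=[\boldsymbol\mu_1^{t\top},\dots,\boldsymbol\mu_k^{t\top}]^\top$, $\bar{\boldsymbol\mu}_k^*=[\boldsymbol\mu_1^{*\top},\dots,\boldsymbol\mu_k^{*\top}]^\top$.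
   Context: Notation: $\|\boldsymbol{x}\|_C^2=\langle \boldsymbol{x},C\boldsymbol{x}\rangle$; $\Sigma^{1/2}$ symmetric PSD square root; $\preceq$ Loewner order; $\bar{\boldsymbol\mu}_i^t=[\boldsymbol\mu_1^{t\top},\dots,\boldsymbol\mu_i^{t\top}]^\top$, $\bar{\boldsymbol\Sigma}_i^t=\mathrm{diag}(\boldsymbol\Sigma_1^t,\dots,\boldsymbol\Sigma_i^t)$. CASBO algorithm: start from $\boldsymbol\mu_k^1\in\mathbb{R}^d$ and symmetric positive definite $\boldsymbol\Sigma_k^1$. At iteration $t$: for each $k$ and $j=1,\dots,N$ draw independent $\boldsymbol z_k^j\sim\mathcal N(\boldsymbol0,\boldsymbol I_d)$, set $\boldsymbol x_k^j=\boldsymbol\mu_k^t+(\boldsymbol\Sigma_k^t)^{1/2}\boldsymbol z_k^j$, $\bar{\boldsymbol z}_i^j=[\boldsymbol z_1^{j\top},\dots,\boldsymbol z_i^{j\top}]^\top$; for $i\ge k$, $\hat g_{ik}^t=\frac1N\sum_j(\boldsymbol\Sigma_k^t)^{-1/2}\boldsymbol z_k^j\big(f_i(\bar{\boldsymbol\mu}_i^t+(\bar{\boldsymbol\Sigma}_i^t)^{1/2}\bar{\boldsymbol z}_i^j)-f_i(\bar{\boldsymbol\mu}_i^t)\big)$; $s_k^j=\sum_{i=k}^Kf_i(\bar{\boldsymbol x}_i^j)$ with max/min $s_k^{\max},s_k^{\min}$ over $j$; $\boldsymbol H_k^t=c_1\frac1N\sum_j\boldsymbol z_k^j\boldsymbol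 z_k^{j\top}\frac{s_k^j-s_k^{\min}}{s_k^{\max}-s_k^{\min}}+c_2\boldsymbol I$ with $c_1,c_2>0$ such that (C1) $\boldsymbol H_k^t\preceq\frac1{\alpha_t}(\frac{\beta_{t+1}}{\beta_t}-\omega_t)\boldsymbol I+\frac{\beta_{t+1}\gamma_t}{\alpha_t}\boldsymbol\Sigma_k^t$ and (C2) $\nu\boldsymbol I\preceq\hat G_k^t:=(\boldsymbol\Sigma_k^t)^{-1/2}\boldsymbol H_k^t(\boldsymbol\Sigma_k^t)^{-1/2}$; then $\boldsymbol\mu_k^{t+1}=\boldsymbol\mu_k^t-\beta_t\boldsymbol\Sigma_k^t(\gamma_t\boldsymbol\mu_k^t+\sum_{i=k}^K\hat g_{ik}^t)$ and $(\boldsymbol\Sigma_k^{t+1})^{-1}=\omega_t(\boldsymbol\Sigma_k^t)^{-1}+\alpha_t\hat G_k^t$. *)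

(* Defs.v *)
From HB Require Import structures.
From mathcomp Require Import all_boot all_order all_algebra.
From mathcomp Require Import all_classical all_reals all_analysis.
From mathcomp Require Import normal_distribution.

Set Implicit Arguments.
Unset Strict Implicit.
Unset Printing Implicit Defensive.

Import Order.TTheory GRing.Theory Num.Theory.
Local Open Scope classical_set_scope.
Local Open Scope ring_scope.

Definition pre K (A : Type) (k : 'I_K) (x : 'I_K -> A) : 'I_k.+1 -> A :=
  fun l => x (widen_ord (ltn_ord k) l).
Arguments pre {K A} k x _.

Section CasboDefs.
Variable R : realType.

Definition enorm n (x : 'cV[R]_n) : R := Num.sqrt (\sum_(i < n) x i 0 ^+ 2).

Definition qform n (C : 'M[R]_n) (x : 'cV[R]_n) : R := (x^T *m C *m x) 0 0.

Definition psd n (A : 'M[R]_n) : Prop := forall x : 'cV[R]_n, 0 <= qform A x.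

Definition posdef n (A : 'M[R]_n) : Prop :=
  forall x : 'cV[R]_n, x != 0 -> 0 < qform A x.

Definition loewner n (A B : 'M[R]_n) : Prop := psd (B - A).

(* symmetric PSD square root (unique when A is symmetric PSD) *)
Definition sqrtmx n (A : 'M[R]_n) : 'M[R]_n :=
  xget 0 [set S : 'M[R]_n | S^T = S /\ psd S /\ S *m S = A].

Definition opnorm n (A : 'M[R]_n) : R :=
  sup [set enorm (A *m x) | x in [set x : 'cV[R]_n | enorm x <= 1]].

(* concatenation [x_0^T, ..., x_{n-1}^T]^T of n vectors of R^d *)
Definition catv n d (x : 'I_n -> 'cV[R]_d) : 'cV[R]_(n * d) :=
  (mxvec (\matrix_(i < n, l < d) x i l 0))^T.

(* block-diagonal matrix diag(S_0, ..., S_{n-1}), consistent with catv *)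
Definition bdiag n d (S : 'I_n -> 'M[R]_d) : 'M[R]_(n * d) :=
  \matrix_(a, b)
    let: (i, l) := enum_val (cast_ord (esym (mxvec_cast n d)) a) in
    let: (j, m) := enum_val (cast_ord (esym (mxvec_cast n d)) b) in
    if i == j then S i l m else 0.

Definition fmax N (s : 'I_N -> R) : R :=
  let v := [seq s j | j <- enum 'I_N] in \big[Num.max/head 0 v]_(y <- v) y.
Definition fmin N (s : 'I_N -> R) : R :=
  let v := [seq s j | j <- enum 'I_N] in \big[Num.min/head 0 v]_(y <- v) y.

Variables (d K N : nat).
(* objective pieces f_k : R^{kd} -> R (k is 0-based here: f k acts on k+1 blocks) *)
Variable f : forall k : 'I_K, 'cV[R]_(k.+1 * d) -> R.

Section Step.
Variables (mu : 'I_K -> 'cV[R]_d) (Sig : 'I_K -> 'M[R]_d)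
          (z : 'I_K -> 'I_N -> 'cV[R]_d) (c1 c2 : 'I_K -> R).

Definition casbo_x (k : 'I_K) (j : 'I_N) : 'cV[R]_d := mu k + sqrtmx (Sig k) *m z k j.

Definition casbo_ghat (i k : 'I_K) : 'cV[R]_d :=
  N%:R^-1 *: \sum_(j < N)
    ((f (catv (pre i mu) + sqrtmx (bdiag (pre i Sig)) *m catv (pre i (fun l => z l j)))
      - f (catv (pre i mu))) *: (invmx (sqrtmx (Sig k)) *m z k j)).

Definition casbo_s (k : 'I_K) (j : 'I_N) : R :=
  \sum_(i < K | (k <= i)%N) f (catv (pre i (fun l => casbo_x l j))).

Definition casbo_H (k : 'I_K) : 'M[R]_d :=
  c1 k *: (N%:R^-1 *: \sum_(j < N)
     ((casbo_s k j - fmin (casbo_s k)) / (fmax (casbo_s k) - fmin (casbo_s k)))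
       *: (z k j *m (z k j)^T))
  + c2 k *: 1%:M.

Definition casbo_G (k : 'I_K) : 'M[R]_d :=
  invmx (sqrtmx (Sig k)) *m casbo_H k *m invmx (sqrtmx (Sig k)).

Variables (beta_t alpha_t gamma_t omega_t : R).

Definition casbo_mu_next (k : 'I_K) : 'cV[R]_d :=
  mu k - beta_t *: (Sig k *m (gamma_t *: mu k + \sum_(i < K | (k <= i)%N) casbo_ghat i k)).

Definition casbo_Sig_next (k : 'I_K) : 'M[R]_d :=
  invmx (omega_t *: invmx (Sig k) + alpha_t *: casbo_G k).
End Step.

Variables (alpha beta nu : R).
Definition beta_t (t : nat) : R := t%:R * beta.
Definition alpha_t (t : nat) : R := Num.sqrt (t.+1%:R) * alpha.
Definition gamma_t (t : nat) : R := alpha * nu / (beta * Num.sqrt (t.+1%:R)).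
Definition omega_t (t : nat) : R := 1.

Definition constr_C1 (t : nat) (Sig : 'M[R]_d) (H : 'M[R]_d) : Prop :=
  loewner H ((alpha_t t)^-1 *: ((beta_t t.+1 / beta_t t - omega_t t) *: 1%:M)
             + (beta_t t.+1 * gamma_t t / alpha_t t) *: Sig).
Definition constr_C2 (G : 'M[R]_d) : Prop := loewner (nu *: 1%:M) G.

(* Sampled run: z t k j and c1 t k, c2 t k are the samples and constants used at
   iteration t (t >= 1).  casbo_run n = (mu^{n+1}, Sigma^{n+1}). *)
Variables (mu1 : 'I_K -> 'cV[R]_d) (Sig1 : 'I_K -> 'M[R]_d).
Variables (z : nat -> 'I_K -> 'I_N -> 'cV[R]_d) (c1 c2 : nat -> 'I_K -> R).

Fixpoint casbo_run (n : nat) : ('I_K -> 'cV[R]_d) * ('I_K -> 'M[R]_d) :=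
  match n with
  | 0 => (mu1, Sig1)
  | n'.+1 =>
    let: (mu, Sig) := casbo_run n' in
    let t := n'.+1 in
    (casbo_mu_next mu Sig (z t) (beta_t t) (gamma_t t),
     casbo_Sig_next mu Sig (z t) (c1 t) (c2 t) (alpha_t t) (omega_t t))
  end.

Definition casbo_mu (t : nat) := (casbo_run t.-1).1.
Definition casbo_Sig (t : nat) := (casbo_run t.-1).2.

End CasboDefs.

Definition mutually_independent {disp} {T : measurableType disp} {R : realType}
    (P : probability T R) (I : eqType) (X : I -> T -> R) : Prop :=
  forall (s : seq I) (B : I -> set R), uniq s -> (forall i, measurable (B i)) ->
    P (\big[setI/setT]_(i <- s) (X i @^-1` B i)) =
    (\prod_(i <- s) P (X i @^-1` B i))%E.

Definition std_normal {disp} {T : measurableType disp} {R : realType}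
    (P : probability T R) (X : T -> R) : Prop :=
  measurable_fun setT X /\
  forall B : set R, measurable B -> P (X @^-1` B) = normal_prob 0 1 B.

Definition measurable_wrt {disp} {T : measurableType disp} {R : realType}
    (I : Type) (X : I -> T -> R) (Y : T -> R) : Prop :=
  forall B : set R, measurable B ->
    <<s [set A | exists i (C : set R), measurable C /\ A = X i @^-1` C] >> (Y @^-1` B).

Section RandomRun.
Variables (R : realType) (Om : Type) (d K N : nat).
Variable f : forall k : 'I_K, 'cV[R]_(k.+1 * d) -> R.
Variables (alpha beta nu : R) (mu1 : 'I_K -> 'cV[R]_d) (Sig1 : 'I_K -> 'M[R]_d).
Variables (zc : nat -> 'I_K -> 'I_N -> 'I_d -> Om -> R) (c1 c2 : nat -> 'I_K -> Om -> R).

Definition zvec (t : nat) (w : Om) : 'I_K -> 'I_N -> 'cV[R]_d :=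
  fun k j => \col_(l < d) zc t k j l w.

Definition rmu (t : nat) (w : Om) : 'I_K -> 'cV[R]_d :=
  casbo_mu f alpha beta nu mu1 Sig1 (zvec ^~ w) (fun t k => c1 t k w) (fun t k => c2 t k w) t.
Definition rSig (t : nat) (w : Om) : 'I_K -> 'M[R]_d :=
  casbo_Sig f alpha beta nu mu1 Sig1 (zvec ^~ w) (fun t k => c1 t k w) (fun t k => c2 t k w) t.
Definition rH (t : nat) (w : Om) : 'I_K -> 'M[R]_d :=
  casbo_H f (rmu t w) (rSig t w) (zvec t w) (c1 t ^~ w) (c2 t ^~ w).
Definition rG (t : nat) (w : Om) : 'I_K -> 'M[R]_d :=
  casbo_G f (rmu t w) (rSig t w) (zvec t w) (c1 t ^~ w) (c2 t ^~ w).
End RandomRun.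

(* Main.v *)
(** Pathwise, the potential [U_t = |mu_{t+1} - mu^*|^2 / beta_t], measured in the metric
    [Sigma_t^-1], satisfies a descent inequality: (C1) controls the change of metric from
    [t] to [t+1] up to the term [gamma_t |mu_{t+1} - mu^*|^2], which is absorbed by the
    regularization [gamma_t mu_t] of the mean update.  (C2) forces
    [Sigma_t <= (alpha nu (1 + 2/3 t^(3/2)))^-1], so the quadratic noise terms, whose
    expectation is a fourth Gaussian moment [E |z|^4 = n (n + 2)], sum up to [O(sqrt T)].

    In expectation, the samples of iteration [t] are independent of [mu_t, Sigma_t].
    Conditionally on the past, with [phi z = f (mu_t + Sigma_t^(1/2) z)] and
    [a = Sigma_t^(-1/2) (mu^* - mu_t)], the Cameron-Martin formula and convexity give
    [E <a, Z> phi Z <= E phi (Z + a) - E phi Z], while [E phi Z >= f mu_t] by symmetry and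
    [E phi (Z + a)] exceeds [f mu^*] by at most [L E |Sigma_t^(1/2) Z|]. *)

Require Import Defs.
From HB Require Import structures.
From mathcomp Require Import all_boot all_order all_algebra.
From mathcomp Require Import all_classical all_reals all_analysis.
From mathcomp Require Import measurable_realfun normal_distribution.
From mathcomp Require Import ring lra.

Set Implicit Arguments.
Unset Strict Implicit.
Unset Printing Implicit Defensive.

Import Order.TTheory GRing.Theory Num.Theory.
Import numFieldNormedType.Exports.
Local Open Scope classical_set_scope.
Local Open Scope ring_scope.

(** * Quadratic forms and the Loewner order *)

Section QuadraticForms.
Context {R : realType}.

Definition dotv {n} (x y : 'cV[R]_n) : R := \sum_(i < n) x i 0 * y i 0.

Lemma dotvE n (x y : 'cV[R]_n) : dotv x y = (x^T *m y) 0 0.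
Proof. by rewrite mxE; apply: eq_bigr => i _; rewrite mxE. Qed.

Lemma qformE n (A : 'M[R]_n) x : qform A x = dotv x (A *m x).
Proof. by rewrite dotvE mulmxA. Qed.

Lemma dotvC n (x y : 'cV[R]_n) : dotv x y = dotv y x.
Proof. by apply: eq_bigr => i _; rewrite mulrC. Qed.

Lemma dotvDl n (x y z : 'cV[R]_n) : dotv (x + y) z = dotv x z + dotv y z.
Proof. by rewrite -big_split; apply: eq_bigr => i _; rewrite mxE mulrDl. Qed.

Lemma dotvDr n (x y z : 'cV[R]_n) : dotv z (x + y) = dotv z x + dotv z y.
Proof. by rewrite !(dotvC z) dotvDl. Qed.

Lemma dotvZl n a (x z : 'cV[R]_n) : dotv (a *: x) z = a * dotv x z.
Proof. by rewrite mulr_sumr; apply: eq_bigr => i _; rewrite mxE mulrA. Qed.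

Lemma dotvZr n a (x z : 'cV[R]_n) : dotv z (a *: x) = a * dotv z x.
Proof. by rewrite !(dotvC z) dotvZl. Qed.

Lemma dotvNl n (x z : 'cV[R]_n) : dotv (- x) z = - dotv x z.
Proof. by rewrite -scaleN1r dotvZl mulN1r. Qed.

Lemma dotvNr n (x z : 'cV[R]_n) : dotv z (- x) = - dotv z x.
Proof. by rewrite !(dotvC z) dotvNl. Qed.

Lemma dotv0 n (x : 'cV[R]_n) : dotv x 0 = 0.
Proof. by rewrite -(scale0r 0) dotvZr mul0r. Qed.

Definition dotv_lin := (dotvDl, dotvDr, dotvZl, dotvZr, dotvNl, dotvNr).

Lemma dotv_sumr n (I : Type) (r : seq I) (P : pred I) (F : I -> 'cV[R]_n) z :
  dotv z (\sum_(i <- r | P i) F i) = \sum_(i <- r | P i) dotv z (F i).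
Proof. by apply: (big_morph (dotv z)) => [u v|]; rewrite ?dotvDr ?dotv0. Qed.

Lemma dotv_mulr n (A : 'M[R]_n) x y : dotv x (A *m y) = dotv (A^T *m x) y.
Proof. by rewrite !dotvE trmx_mul trmxK mulmxA. Qed.

Lemma dotv_sym n (A : 'M[R]_n) x y : A^T = A ->
  dotv x (A *m y) = dotv (A *m x) y.
Proof. by rewrite dotv_mulr => ->. Qed.

Lemma dotvv_ge0 n (x : 'cV[R]_n) : 0 <= dotv x x.
Proof. by apply: sumr_ge0 => i _; rewrite -expr2 sqr_ge0. Qed.

Lemma dotvv_eq0 n (x : 'cV[R]_n) : dotv x x = 0 -> x = 0.
Proof.
move=> /eqP; rewrite psumr_eq0 => [/allP h|i _]; last by rewrite -expr2 sqr_ge0.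
apply/matrixP => i j; rewrite ord1 mxE; apply/eqP.
have := h i (mem_index_enum i).
by rewrite -expr2 sqrf_eq0.
Qed.

Lemma dotvv_gt0 n (x : 'cV[R]_n) : x != 0 -> 0 < dotv x x.
Proof.
move=> x0; rewrite lt_def dotvv_ge0 andbT.
by apply: contra_neq x0; exact: dotvv_eq0.
Qed.

Lemma enorm_sqr n (x : 'cV[R]_n) : enorm x ^+ 2 = dotv x x.
Proof.
rewrite sqr_sqrtr; first by apply: eq_bigr => i _; rewrite expr2.
by apply: sumr_ge0 => i _; rewrite sqr_ge0.
Qed.

Lemma enorm_ge0 n (x : 'cV[R]_n) : 0 <= enorm x.
Proof. exact: sqrtr_ge0. Qed.

Lemma enormE n (x : 'cV[R]_n) : enorm x = Num.sqrt (dotv x x).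
Proof. by rewrite -enorm_sqr sqrtr_sqr ger0_norm// enorm_ge0. Qed.

Lemma qform_sym_expand n (A : 'M[R]_n) (x y : 'cV[R]_n) (a b : R) : A^T = A ->
  qform A (a *: x + b *: y) =
  a ^+ 2 * qform A x + 2 * (a * b) * dotv x (A *m y) + b ^+ 2 * qform A y.
Proof.
move=> sA; rewrite !qformE mulmxDr -!scalemxAr !dotv_lin.
rewrite (dotv_sym y x)// (dotvC (A *m y) x); ring.
Qed.

Lemma psd_cauchy_schwarz n (A : 'M[R]_n) (x y : 'cV[R]_n) : A^T = A -> psd A ->
  dotv x (A *m y) ^+ 2 <= qform A x * qform A y.
Proof.
move=> sA pA; set b := dotv x _; set a := qform A x; set c := qform A y.
have Q s t := pA (s *: x + t *: y).
have E s t := qform_sym_expand x y s t sA.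
have a0 : 0 <= a := pA x.
have : 0 <= c := pA y; rewrite le_eqVlt => /orP[/eqP c0|c0].
  have [->|b0] := eqVneq b 0; first by rewrite expr0n mulr_ge0// -c0.
  have := Q 1 (- (a + 1) / (2 * b)); rewrite E -/a -/b -/c -c0.
  have -> : 1 ^+ 2 * a + 2 * (1 * (- (a + 1) / (2 * b))) * b +
    (- (a + 1) / (2 * b)) ^+ 2 * 0 = -1 by field.
  by rewrite oppr_ge0 ler10.
have := Q c (- b); rewrite E -/a -/b -/c.
have -> : c ^+ 2 * a + 2 * (c * - b) * b + (- b) ^+ 2 * c =
          c * (a * c - b ^+ 2) by ring.
by rewrite pmulr_rge0// subr_ge0.
Qed.

Lemma psd1 n : psd (1%:M : 'M[R]_n).
Proof. by move=> x; rewrite qformE mul1mx dotvv_ge0. Qed.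

Lemma dotv_cauchy_schwarz n (x y : 'cV[R]_n) :
  dotv x y ^+ 2 <= dotv x x * dotv y y.
Proof.
have := @psd_cauchy_schwarz n 1%:M x y (trmx1 _ n) (@psd1 n).
by rewrite !qformE !mul1mx.
Qed.

Lemma dotv_le_enorm n (x y : 'cV[R]_n) : `|dotv x y| <= enorm x * enorm y.
Proof.
rewrite -(@ler_pXn2r _ 2%N) ?nnegrE ?mulr_ge0 ?enorm_ge0//.
by rewrite real_normK ?num_real// exprMn !enorm_sqr dotv_cauchy_schwarz.
Qed.

Lemma enormD n (x y : 'cV[R]_n) : enorm (x + y) <= enorm x + enorm y.
Proof.
rewrite -(@ler_pXn2r _ 2%N) ?nnegrE ?addr_ge0 ?enorm_ge0//.
rewrite sqrrD !enorm_sqr !dotv_lin (dotvC y x).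
have := le_trans (ler_norm _) (dotv_le_enorm x y); lra.
Qed.

Lemma enormZ n a (x : 'cV[R]_n) : enorm (a *: x) = `|a| * enorm x.
Proof.
apply/eqP; rewrite -(@eqrXn2 _ 2%N) ?mulr_ge0 ?enorm_ge0//.
by rewrite exprMn real_normK ?num_real// !enorm_sqr !dotv_lin mulrA expr2.
Qed.

Lemma enorm0 n : enorm (0 : 'cV[R]_n) = 0.
Proof. by rewrite enormE dotv0 sqrtr0. Qed.

Lemma entry_le_enorm n (x : 'cV[R]_n) i : `|x i 0| <= enorm x.
Proof.
rewrite -(@ler_pXn2r _ 2%N) ?nnegrE ?enorm_ge0//.
rewrite real_normK ?num_real// enorm_sqr /dotv (bigD1 i)//= -expr2 lerDl.
by apply: sumr_ge0 => j _; rewrite -expr2 sqr_ge0.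
Qed.

Lemma enorm_le_sum n (x : 'cV[R]_n) : enorm x <= \sum_i `|x i 0|.
Proof.
rewrite -(@ler_pXn2r _ 2%N) ?nnegrE ?enorm_ge0 ?sumr_ge0//.
rewrite enorm_sqr expr2 mulr_suml; apply: ler_sum => i _.
rewrite (le_trans (ler_norm _))// normrM ler_wpM2l//.
by rewrite (bigD1 i)//= lerDl sumr_ge0.
Qed.

Lemma psd_norm_le n (A : 'M[R]_n) c : A^T = A -> psd A -> 0 <= c ->
  (forall x, qform A x <= c * dotv x x) ->
  forall x, enorm (A *m x) <= c * enorm x.
Proof.
move=> sA pA c0 bA x; set u := dotv (A *m x) (A *m x).
have CS := @psd_cauchy_schwarz _ A x (A *m x) sA pA.
rewrite dotv_sym// -/u in CS.
have u0 : 0 <= u := dotvv_ge0 _.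
have {CS} : u ^+ 2 <= (c * dotv x x) * (c * u).
  by apply: le_trans CS _; rewrite ler_pM.
move=> ub; rewrite -(@ler_pXn2r _ 2%N) ?nnegrE ?mulr_ge0 ?enorm_ge0// exprMn !enorm_sqr -/u.
move: u0; rewrite le_eqVlt => /orP[/eqP <-|u0].
  by rewrite mulr_ge0 ?sqr_ge0 ?dotvv_ge0.
rewrite -(ler_pM2r u0) -expr2.
by rewrite -[leRHS](_ : c * dotv x x * (c * u) = _)//; ring.
Qed.

Lemma posdef_unit n (A : 'M[R]_n) : posdef A -> A \in unitmx.
Proof.
move=> pA; rewrite -unitmx_tr -row_free_unit -kermx_eq0; apply/eqP.
apply/row_matrixP => i; rewrite row0; set v := row i _.
have vA : v *m A^T = 0.
  by apply/sub_kermxP; rewrite row_sub.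
apply/eqP; apply/negPn/negP => v0.
have vT0 : v^T != 0 by apply: contra_neq v0 => /(congr1 trmx); rewrite trmxK trmx0.
have := pA _ vT0; rewrite qformE.
have -> : A *m v^T = 0 by rewrite -[A]trmxK -trmx_mul vA trmx0.
by rewrite dotv0 ltxx.
Qed.

Lemma posdef_psd n (A : 'M[R]_n) : posdef A -> psd A.
Proof.
move=> pA x; have [->|/pA/ltW//] := eqVneq x 0.
by rewrite qformE mulmx0 dotv0.
Qed.

Lemma invmx_sym n (A : 'M[R]_n) : A^T = A -> (invmx A)^T = invmx A.
Proof. by rewrite trmx_inv => ->. Qed.

Lemma unitmx_eq n (A : 'M[R]_n) x : A \in unitmx -> A *m x = 0 :> 'cV_n -> x = 0.
Proof. by move=> uA h; rewrite -(mulKmx uA x) h mulmx0. Qed.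

Lemma posdef_inv n (A : 'M[R]_n) : A^T = A -> posdef A -> posdef (invmx A).
Proof.
move=> sA pA x x0; have uA := posdef_unit pA.
have y0 : invmx A *m x != 0.
  by apply: contra_neq x0; apply: unitmx_eq; rewrite unitmx_inv.
have := pA _ y0; rewrite !qformE mulKVmx//.
by rewrite dotvC.
Qed.

Lemma loewnerP n (A B : 'M[R]_n) :
  loewner A B <-> forall x, qform A x <= qform B x.
Proof.
split => h x; have := h x; rewrite !qformE mulmxBl !dotv_lin.
  by rewrite subr_ge0.
by rewrite subr_ge0.
Qed.

Lemma qformD n (A B : 'M[R]_n) x : qform (A + B) x = qform A x + qform B x.
Proof. by rewrite !qformE mulmxDl dotvDr. Qed.

Lemma qformZ n a (A : 'M[R]_n) x : qform (a *: A) x = a * qform A x.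
Proof. by rewrite !qformE -scalemxAl dotvZr. Qed.

Lemma qform1 n (x : 'cV[R]_n) : qform 1%:M x = dotv x x.
Proof. by rewrite qformE mul1mx. Qed.

Lemma qform_inv_le n (P : 'M[R]_n) c : P \in unitmx -> 0 < c ->
  (forall x, c * dotv x x <= qform P x) ->
  forall x, qform (invmx P) x <= c^-1 * dotv x x.
Proof.
move=> uP c0 h x; rewrite qformE; set y := invmx P *m x.
have Ey : x = P *m y by rewrite mulKVmx.
have h1 : c * dotv y y <= dotv y x by have := h y; rewrite qformE -Ey.
have CS := dotv_cauchy_schwarz x y.
rewrite (dotvC y x) in h1.
rewrite -(ler_pM2l c0) mulrA divff ?gt_eqF// mul1r.
have X0 := dotvv_ge0 x; have Y0 := dotvv_ge0 y.
have b0 : 0 <= dotv x y by apply: le_trans h1; rewrite mulr_ge0// ltW.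
move: b0; rewrite le_eqVlt => /orP[/eqP <-|b0]; first by rewrite mulr0.
rewrite -(ler_pM2r b0) -mulrA -expr2.
apply: le_trans (_ : c * (dotv x x * dotv y y) <= _); first by rewrite ler_pM2l.
by rewrite mulrCA ler_wpM2l.
Qed.

End QuadraticForms.

Section LoewnerBounds.
Context {R : realType}.

Lemma qform_ub n (A : 'M[R]_n) x :
  qform A x <= (\sum_i \sum_j `|A i j|) * dotv x x.
Proof.
rewrite qformE -enorm_sqr {1}/dotv mulr_suml; apply: ler_sum => i _.
rewrite mxE mulr_sumr mulr_suml; apply: ler_sum => j _.
rewrite (le_trans (ler_norm _))// !normrM mulrCA ler_wpM2l//.
by rewrite expr2 ler_pM// entry_le_enorm.
Qed.

Lemma qform_inv_ge n (P : 'M[R]_n) C : P^T = P -> posdef P ->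
  (forall x, qform P x <= C * dotv x x) ->
  forall x, dotv x x <= C * qform (invmx P) x.
Proof.
move=> sP pP h x; have uP := posdef_unit pP.
have [->|x0] := eqVneq x 0; first by rewrite !qformE !mulmx0 !dotv0 mulr0.
have := psd_cauchy_schwarz x (invmx P *m x) sP (posdef_psd pP).
rewrite [in X in _ <= X](qformE P (_ *m x)) mulKVmx//.
have -> : dotv (invmx P *m x) x = qform (invmx P) x by rewrite qformE dotvC.
have q0 := ltW (posdef_inv sP pP x0).
have d0 := dotvv_gt0 x0.
move=> /le_trans/(_ (ler_wpM2r q0 (h x))).
by rewrite expr2 mulrAC ler_pM2r.
Qed.

Lemma posdef_lower n (A : 'M[R]_n) : A^T = A -> posdef A ->
  exists2 c, 0 < c & forall x, c * dotv x x <= qform A x.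
Proof.
move=> sA pA; set C := \sum_i \sum_j `|invmx A i j|.
have C0 : 0 <= C by apply: sumr_ge0 => i _; apply: sumr_ge0.
have uA := posdef_unit pA.
exists (C + 1)^-1; first by rewrite invr_gt0 ltr_wpDl.
move=> x; rewrite -ler_pdivlMl ?invr_gt0 ?ltr_wpDl// invrK.
have := qform_inv_ge (invmx_sym sA) (posdef_inv sA pA) (qform_ub (invmx A)) x.
rewrite invmxK => /le_trans; apply.
by rewrite ler_wpM2r ?lerDl// posdef_psd.
Qed.

End LoewnerBounds.

(** * The square root of a positive definite matrix *)

Section MatrixLimits.
Context {R : realType}.

Definition mxlim m n (u : nat -> 'M[R]_(m, n)) (M : 'M[R]_(m, n)) :=
  forall i j, (fun k => u k i j) @ \oo --> M i j.

Lemma mxlim_cst m n (M : 'M[R]_(m, n)) : mxlim (fun=> M) M.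
Proof. by move=> i j; exact: cvg_cst. Qed.
Arguments mxlim_cst : clear implicits.

Lemma mxlimD m n u v (M N : 'M[R]_(m, n)) : mxlim u M -> mxlim v N ->
  mxlim (fun k => u k + v k) (M + N).
Proof.
move=> hu hv i j; under eq_fun do rewrite mxE.
by rewrite mxE; exact: cvgD.
Qed.

Lemma mxlimZ m n u (M : 'M[R]_(m, n)) a : mxlim u M ->
  mxlim (fun k => a *: u k) (a *: M).
Proof.
move=> hu i j; under eq_fun do rewrite mxE.
by rewrite mxE; exact: cvgMl_tmp.
Qed.

Lemma mxlimM m n p u v (M : 'M[R]_(m, n)) (N : 'M[R]_(n, p)) :
  mxlim u M -> mxlim v N -> mxlim (fun k => u k *m v k) (M *m N).
Proof.
move=> hu hv i j; under eq_fun do rewrite mxE.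
rewrite mxE; apply: cvg_big => [|l _]; first exact: add_continuous.
by apply: cvgM; [exact: hu|exact: hv].
Qed.

Lemma mxlim_tr m n u (M : 'M[R]_(m, n)) : mxlim u M ->
  mxlim (fun k => (u k)^T) M^T.
Proof.
by move=> hu i j; under eq_fun do rewrite mxE; rewrite mxE; exact: hu.
Qed.

Lemma mxlim_unique m n u (M N : 'M[R]_(m, n)) : mxlim u M -> mxlim u N -> M = N.
Proof.
move=> hM hN; apply/matrixP => i j.
exact: (cvg_unique (@Rhausdorff R) (hM i j) (hN i j)).
Qed.

Lemma mxlimS m n u (M : 'M[R]_(m, n)) : mxlim u M -> mxlim (fun k => u k.+1) M.
Proof.
by move=> hu i j; have := hu i j; rewrite -(cvg_shiftS (fun k => u k i j)).
Qed.

Lemma mxlim_qform_le n u (M : 'M[R]_n) x c : mxlim u M ->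
  (forall k, qform (u k) x <= c) -> qform M x <= c.
Proof.
move=> hu h.
have L := mxlimM (mxlimM (mxlim_cst _ _ x^T) hu) (mxlim_cst _ _ x).
by apply: (cvgr_to_le (L 0 0)); apply: nearW => k; exact: h.
Qed.

Lemma cvg_geometric_increments (u : nat -> R) q : 0 <= q < 1 ->
  (forall k, `|u k.+1 - u k| <= q ^+ k) -> cvgn u.
Proof.
move=> /andP[q0 q1] h.
have E : u = (fun n => u 0%N + series (telescope u) n).
  by apply/funext => n; rewrite -eq_sum_telescope.
rewrite E; apply: is_cvgD; first exact: is_cvg_cst.
apply: normed_cvg.
apply: (@series_le_cvg _ _ (geometric 1 q)).
- by move=> n; exact: normr_ge0.
- by move=> n; rewrite /= mul1r exprn_ge0.
- by move=> n; rewrite /= mul1r; exact: h.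
- by apply: is_cvg_geometric_series; rewrite ger0_norm.
Qed.

End MatrixLimits.

Section SquareRoot.
Context {R : realType} {n : nat}.
Implicit Types A B M N S : 'M[R]_n.

Fixpoint sqrt_iter B (k : nat) : 'M[R]_n :=
  if k is k'.+1 then 2^-1 *: (B + sqrt_iter B k' *m sqrt_iter B k') else 0.

Definition opb M (c : R) := forall x : 'cV[R]_n, enorm (M *m x) <= c * enorm x.

Lemma opbD M N a b : opb M a -> opb N b -> opb (M + N) (a + b).
Proof.
move=> hM hN x; rewrite mulmxDl mulrDl (le_trans (enormD _ _))//.
by rewrite lerD.
Qed.

Lemma opbM M N a b : 0 <= a -> opb M a -> opb N b -> opb (M *m N) (a * b).
Proof.
move=> a0 hM hN x; rewrite -mulmxA (le_trans (hM _))// -mulrA ler_wpM2l//.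
Qed.

Lemma opbZ M c a : opb M a -> opb (c *: M) (`|c| * a).
Proof. by move=> hM x; rewrite -scalemxAl enormZ -mulrA ler_wpM2l. Qed.

Lemma opbW M a b : a <= b -> opb M a -> opb M b.
Proof. by move=> ab hM x; rewrite (le_trans (hM x))// ler_wpM2r// enorm_ge0. Qed.

Lemma opb_entry M a i j : opb M a -> `|M i j| <= a.
Proof.
move=> hM; have := hM (delta_mx j 0).
have -> : M *m delta_mx j 0 = col j M by rewrite colE.
have -> : enorm (delta_mx j 0 : 'cV[R]_n) = 1.
  rewrite enormE /dotv (bigD1 j)//= big1 => [|l lj].
    by rewrite !mxE !eqxx mulr1 addr0 sqrtr1.
  by rewrite !mxE (negPf lj) mul0r.
rewrite mulr1; apply: le_trans.
by have := entry_le_enorm (col j M) i; rewrite mxE.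
Qed.

Lemma half_norm : `|2^-1 : R| = 2^-1.
Proof. by rewrite ger0_norm. Qed.

Lemma sqrt_iter_opb B q k : 0 <= q <= 1 -> opb B q -> opb (sqrt_iter B k) q.
Proof.
move=> /andP[q0 q1] hB; elim: k => [|k IH] /=.
  by move=> x; rewrite mul0mx enorm0 mulr_ge0// enorm_ge0.
apply: (opbW _ (opbZ (2^-1) (opbD hB (opbM q0 IH IH)))).
rewrite half_norm; nra.
Qed.

Lemma sqrt_iter_step B q k : 0 <= q <= 1 -> opb B q ->
  opb (sqrt_iter B k.+1 - sqrt_iter B k) (q ^+ k.+1).
Proof.
move=> q01 hB; have /andP[q0 q1] := q01.
elim: k => [|k IH].
  rewrite /= mul0mx addr0 subr0 expr1; apply: (opbW _ (opbZ (2^-1) hB)).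
  rewrite half_norm; nra.
set Y := sqrt_iter B k.+1; set X := sqrt_iter B k.
have -> : sqrt_iter B k.+2 - Y = 2^-1 *: (Y *m (Y - X) + (Y - X) *m X).
  rewrite mulmxBr mulmxBl addrA addrNK.
  have -> : Y = 2^-1 *: (B + X *m X) by [].
  by rewrite [LHS]/= -/X -scalerBr opprD addrACA subrr add0r.
have hY := sqrt_iter_opb k.+1 q01 hB; have hX := sqrt_iter_opb k q01 hB.
have qk0 : 0 <= q ^+ k.+1 by rewrite exprn_ge0.
apply: (opbW _ (opbZ (2^-1) (opbD (opbM q0 hY IH) (opbM qk0 IH hX)))).
by rewrite half_norm [q ^+ k.+2]exprS; lra.
Qed.

Lemma sqrt_iter_cvg B q : 0 <= q < 1 -> opb B q ->
  exists Y, mxlim (sqrt_iter B) Y.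
Proof.
move=> q01 hB; have /andP[q0 q1] := q01.
exists (\matrix_(i, j) limn (fun k => sqrt_iter B k i j)) => i j.
rewrite mxE; apply: (@cvg_geometric_increments _ _ q) => // k.
have := opb_entry i j (@sqrt_iter_step B q k _ hB).
rewrite !mxE => /(_ _)/le_trans; apply; first by rewrite q0 ltW.
by rewrite exprS ler_piMl ?exprn_ge0// ltW.
Qed.

Lemma sqrt_iter_sym B k : B^T = B -> (sqrt_iter B k)^T = sqrt_iter B k.
Proof.
by move=> sB; elim: k => [|k IH] /=; rewrite ?trmx0// linearZ/= linearD/= sB
  trmx_mul IH.
Qed.

Lemma sqrt_iter_comm B S k : S *m B = B *m S ->
  S *m sqrt_iter B k = sqrt_iter B k *m S.
Proof.
move=> SB; elim: k => [|k IH] /=; first by rewrite mulmx0 mul0mx.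
rewrite -scalemxAr -scalemxAl mulmxDr mulmxDl SB; congr (_ *: (_ + _)).
by rewrite mulmxA IH -!mulmxA IH.
Qed.

Lemma sqrt_posdef A S : A \in unitmx -> S^T = S -> psd S -> S *m S = A -> posdef S.
Proof.
move=> uA sS pS SA x x0; rewrite lt_def pS andbT; apply: contra_neq x0 => q0.
have := psd_cauchy_schwarz (S *m x) x sS pS.
rewrite q0 mulr0 => h.
have /dotvv_eq0 Sx : dotv (S *m x) (S *m x) = 0.
  by apply/eqP; rewrite -sqrf_eq0 eq_le h sqr_ge0.
by apply: (unitmx_eq uA); rewrite -SA -mulmxA Sx mulmx0.
Qed.

Lemma sqrt_spec_lim A Lam : A^T = A -> posdef A -> 0 < Lam ->
  (forall x, qform A x <= Lam * dotv x x) ->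
  exists Y, [/\ mxlim (sqrt_iter (1%:M - Lam^-1 *: A)) Y,
    (Num.sqrt Lam *: (1%:M - Y))^T = Num.sqrt Lam *: (1%:M - Y),
    psd (Num.sqrt Lam *: (1%:M - Y)),
    (Num.sqrt Lam *: (1%:M - Y)) *m (Num.sqrt Lam *: (1%:M - Y)) = A &
    forall S, S^T = S -> psd S -> S *m S = A -> S = Num.sqrt Lam *: (1%:M - Y)].
Proof.
move=> sA pA L0 hA; set B := 1%:M - _.
have [c c0 hc] := posdef_lower sA pA.
pose q := 1 - Num.min c Lam / Lam.
have m0 : 0 < Num.min c Lam by rewrite lt_min c0.
have q01 : 0 <= q < 1.
  rewrite /q subr_ge0 ler_pdivrMr// mul1r ge_min lexx orbT/=.
  by rewrite ltrBlDr ltrDl divr_gt0.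
have /andP[q0 q1] := q01.
have sB : B^T = B by rewrite /B linearB/= linearZ/= trmx1 sA.
have qB x : qform B x = dotv x x - Lam^-1 * qform A x.
  by rewrite !qformE /B mulmxBl mul1mx -scalemxAl !dotv_lin.
have pB : psd B.
  by move=> x; rewrite qB subr_ge0 ler_pdivrMl.
have BoundB x : qform B x <= q * dotv x x.
  rewrite qB /q mulrBl mul1r lerD2l lerN2 [leRHS]mulrC mulrAC ler_pM2r ?invr_gt0//.
  apply: le_trans (hc x); rewrite ler_wpM2r ?dotvv_ge0//.
  by rewrite ge_min lexx.
have oB : opb B q by move=> x; exact: psd_norm_le.
have [Y hY] := sqrt_iter_cvg q01 oB.
have YE : Y = 2^-1 *: (B + Y *m Y).
  apply: (mxlim_unique (mxlimS hY)) => /=.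
  by apply: mxlimZ; apply: mxlimD; [exact: mxlim_cst|exact: mxlimM].
have YYE : Y *m Y = Y + Y - B.
  by rewrite -[in RHS]mulr2n -scaler_nat [X in _ *: X]YE scalerA divff ?scale1r//
    addrC addKr.
set T := Num.sqrt Lam *: (1%:M - Y).
have sY : Y^T = Y.
  apply: (mxlim_unique (mxlim_tr hY)).
  by under eq_fun do rewrite sqrt_iter_sym//.
have sT : T^T = T by rewrite /T linearZ/= linearB/= trmx1 sY.
have TT : T *m T = A.
  rewrite /T -scalemxAl -scalemxAr scalerA -expr2 sqr_sqrtr ?ltW//.
  rewrite mulmxBl mul1mx mulmxBr mulmx1 YYE.
  have -> : 1%:M - Y - (Y - (Y + Y - B)) = 1%:M - B.
    by rewrite !opprD !opprK !addrA; apply/matrixP => i j; rewrite !mxE; ring.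
  by rewrite /B opprB addrC subrK scalerA divff ?scale1r// gt_eqF.
have pT : psd T.
  move=> x; rewrite /T qformZ mulr_ge0 ?sqrtr_ge0//.
  have -> : qform (1%:M - Y) x = dotv x x - qform Y x.
    by rewrite !qformE mulmxBl mul1mx !dotv_lin.
  rewrite subr_ge0; apply: (mxlim_qform_le hY) => k.
  have := dotv_le_enorm x (sqrt_iter B k *m x).
  rewrite -qformE => /(le_trans (ler_norm _))/le_trans; apply.
  have q01' : 0 <= q <= 1 by rewrite q0 ltW.
  have /= := sqrt_iter_opb k q01' oB x => h.
  rewrite -enorm_sqr expr2 ler_wpM2l ?enorm_ge0// (le_trans h)//.
  by rewrite ler_piMl ?enorm_ge0// ltW.
exists Y; split => // S sS pS SA.
have uA := posdef_unit pA.
have pdS := sqrt_posdef uA sS pS SA.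
have ST : S *m T = T *m S.
  have SB : S *m B = B *m S.
    by rewrite /B mulmxBr mulmxBl mulmx1 mul1mx -scalemxAr -scalemxAl -SA mulmxA.
  have SY : S *m Y = Y *m S.
    have L1 : mxlim (fun k => S *m sqrt_iter B k) (S *m Y).
      by apply: mxlimM => //; exact: mxlim_cst.
    have L2 : mxlim (fun k => S *m sqrt_iter B k) (Y *m S).
      under eq_fun do rewrite sqrt_iter_comm//.
      by apply: mxlimM => //; exact: mxlim_cst.
    exact: mxlim_unique L1 L2.
  by rewrite /T -scalemxAr -scalemxAl mulmxBr mulmxBl SY mulmx1 mul1mx.
have uST : S + T \in unitmx.
  apply: posdef_unit => x x0; rewrite qformD.
  by apply: ltr_wpDr; [exact: pT|exact: pdS].
have /(congr1 (mulmx^~ (invmx (S + T)))) : (S - T) *m (S + T) = 0.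
  rewrite mulmxBl !mulmxDr SA TT ST.
  by apply/matrixP => i j; rewrite !mxE; ring.
by rewrite mulmxK// mul0mx => /eqP; rewrite subr_eq0 => /eqP.
Qed.

Lemma sqrtmx_lim A Lam : A^T = A -> posdef A -> 0 < Lam ->
  (forall x, qform A x <= Lam * dotv x x) ->
  exists2 Y, mxlim (sqrt_iter (1%:M - Lam^-1 *: A)) Y &
    sqrtmx A = Num.sqrt Lam *: (1%:M - Y).
Proof.
move=> sA pA L0 hA; have [Y [hY sT pT TT U]] := sqrt_spec_lim sA pA L0 hA.
exists Y => //.
have [s [p e]] : [set S : 'M[R]_n | S^T = S /\ psd S /\ S *m S = A] (sqrtmx A).
  by apply: xgetPex; eexists; split; [exact: sT|split; eauto].
exact: U.
Qed.

Lemma qform_ub_gt0 A : exists2 Lam, 0 < Lam &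
  forall x, qform A x <= Lam * dotv x x.
Proof.
exists (\sum_i \sum_j `|A i j| + 1).
  by rewrite ltr_wpDl// sumr_ge0// => i _; rewrite sumr_ge0.
move=> x; rewrite (le_trans (qform_ub A x))// ler_wpM2r ?dotvv_ge0//.
by rewrite lerDl.
Qed.

Lemma sqrtmx_unique A S : A^T = A -> posdef A -> S^T = S -> psd S ->
  S *m S = A -> sqrtmx A = S.
Proof.
move=> sA pA sS pS SA; have [Lam L0 hL] := qform_ub_gt0 A.
have [Y [hY sT pT TT U]] := sqrt_spec_lim sA pA L0 hL.
have [s [p e]] : [set S : 'M[R]_n | S^T = S /\ psd S /\ S *m S = A] (sqrtmx A).
  by apply: xgetPex; exists S.
by rewrite (U (sqrtmx A))// (U S).
Qed.

Lemma sqrtmxP A : A^T = A -> posdef A ->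
  [/\ (sqrtmx A)^T = sqrtmx A, posdef (sqrtmx A), sqrtmx A *m sqrtmx A = A
    & sqrtmx A \in unitmx].
Proof.
move=> sA pA; have [Lam L0 hL] := qform_ub_gt0 A.
have [Y [hY sT pT TT _]] := sqrt_spec_lim sA pA L0 hL.
have uA := posdef_unit pA.
rewrite (sqrtmx_unique sA pA sT pT TT).
have pd := sqrt_posdef uA sT pT TT.
by split => //; exact: posdef_unit.
Qed.

End SquareRoot.

(** * Concatenated vectors and block diagonal matrices *)

Section Blocks.
Context {R : realType} {n d : nat}.
Implicit Types (x y : 'I_n -> 'cV[R]_d) (S : 'I_n -> 'M[R]_d).

Lemma catvE x i l : catv x (mxvec_index i l) 0 = x i l 0.
Proof. by rewrite mxE mxvecE mxE. Qed.

Lemma bdiagE S i l j m : bdiag S (mxvec_index i l) (mxvec_index j m) =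
  if i == j then S i l m else 0.
Proof. by rewrite mxE /mxvec_index !cast_ordK !enum_rankK. Qed.

Lemma sum_mxvec_index (F : 'I_(n * d) -> R) :
  \sum_a F a = \sum_i \sum_l F (mxvec_index i l).
Proof.
rewrite pair_bigA /= (reindex _ (curry_mxvec_bij n d)) /=.
by apply: eq_bigr => -[i l].
Qed.

Lemma dotv_catv x y : dotv (catv x) (catv y) = \sum_i dotv (x i) (y i).
Proof.
rewrite /dotv sum_mxvec_index; apply: eq_bigr => i _.
by apply: eq_bigr => l _; rewrite !catvE.
Qed.

Lemma eq_cV_mxvec (u v : 'cV[R]_(n * d)) :
  (forall i l, u (mxvec_index i l) 0 = v (mxvec_index i l) 0) -> u = v.
Proof.
by move=> h; apply/matrixP => a b; rewrite ord1; case/mxvec_indexP: a => i l.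
Qed.

Definition blockv (v : 'cV[R]_(n * d)) (i : 'I_n) : 'cV[R]_d :=
  \col_l v (mxvec_index i l) 0.

Lemma blockvK v : catv (blockv v) = v.
Proof. by apply: eq_cV_mxvec => i l; rewrite catvE mxE. Qed.

Lemma catvD x y : catv (fun i => x i + y i) = catv x + catv y.
Proof.
by apply: eq_cV_mxvec => i l; rewrite !mxE !mxvecE !mxE.
Qed.

Lemma bdiag_catv S x : bdiag S *m catv x = catv (fun i => S i *m x i).
Proof.
apply: eq_cV_mxvec => i l; rewrite mxE sum_mxvec_index catvE mxE (bigD1 i)//=.
rewrite [X in _ + X]big1 ?addr0 => [|j ji].
  by apply: eq_bigr => m _; rewrite bdiagE eqxx catvE.
by apply: big1 => m _; rewrite bdiagE eq_sym (negPf ji) mul0r.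
Qed.

Lemma qform_bdiag S x : qform (bdiag S) (catv x) = \sum_i qform (S i) (x i).
Proof.
by rewrite qformE bdiag_catv dotv_catv; apply: eq_bigr => i _; rewrite qformE.
Qed.

Lemma bdiag_sym S : (forall i, (S i)^T = S i) -> (bdiag S)^T = bdiag S.
Proof.
move=> sS; apply/matrixP => a b; rewrite mxE.
case/mxvec_indexP: a => i l; case/mxvec_indexP: b => j m; rewrite !bdiagE eq_sym.
by case: eqVneq => // ->; rewrite -[in LHS](sS j) mxE.
Qed.

Lemma bdiag_psd S : (forall i, psd (S i)) -> psd (bdiag S).
Proof.
move=> pS v; rewrite -(blockvK v) qform_bdiag.
by apply: sumr_ge0 => i _; exact: pS.
Qed.

Lemma bdiag_posdef S : (forall i, posdef (S i)) -> posdef (bdiag S).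
Proof.
move=> pS v v0; rewrite lt_def bdiag_psd ?andbT; last by move=> i; exact: posdef_psd.
apply: contra_neq v0; rewrite -{1}(blockvK v) qform_bdiag => /eqP.
rewrite psumr_eq0 => [/allP h|i _]; last exact: posdef_psd.
apply: eq_cV_mxvec => i l; rewrite mxE.
have := h i (mem_index_enum i) => /= /eqP qi.
have [bi|/(pS i)] := eqVneq (blockv v i) 0; last by rewrite qi ltxx.
by have /matrixP/(_ l 0) := bi; rewrite !mxE.
Qed.

Lemma bdiag_mul S S' : bdiag S *m bdiag S' = bdiag (fun i => S i *m S' i).
Proof.
apply/matrixP => a b; rewrite mxE sum_mxvec_index.
case/mxvec_indexP: a => i l; case/mxvec_indexP: b => j m.
rewrite (bigD1 i)//= [X in _ + X]big1 ?addr0 => [|k ki]; last first.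
  by apply: big1 => q _; rewrite bdiagE eq_sym (negPf ki) mul0r.
rewrite bdiagE; case: eqVneq => [<-|ij].
  by rewrite mxE; apply: eq_bigr => q _; rewrite !bdiagE eqxx.
by apply: big1 => q _; rewrite [X in _ * X]bdiagE (negPf ij) mulr0.
Qed.

Lemma sqrtmx_bdiag S : (forall i, (S i)^T = S i /\ posdef (S i)) ->
  sqrtmx (bdiag S) = bdiag (fun i => sqrtmx (S i)).
Proof.
move=> h; have sq i := let: conj s p := h i in sqrtmxP s p.
apply: sqrtmx_unique.
- by apply: bdiag_sym => i; case: (h i).
- by apply: bdiag_posdef => i; case: (h i).
- by apply: bdiag_sym => i; case: (sq i).
- by apply: bdiag_psd => i; apply: posdef_psd; case: (sq i).
- by rewrite bdiag_mul; congr bdiag; apply/funext => i; case: (sq i).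
Qed.

End Blocks.

Section CasboRewrite.
Context {R : realType} {d K N : nat}.
Variable f : forall k : 'I_K, 'cV[R]_(k.+1 * d) -> R.
Arguments f : clear implicits.
Variables (mu : 'I_K -> 'cV[R]_d) (Sig : 'I_K -> 'M[R]_d).
Variable z : 'I_K -> 'I_N -> 'cV[R]_d.
Hypothesis hSig : forall k, (Sig k)^T = Sig k /\ posdef (Sig k).

Lemma casbo_ghatE i k : casbo_ghat f mu Sig z i k =
  N%:R^-1 *: \sum_(j < N)
    ((f i (catv (pre i (casbo_x mu Sig z ^~ j))) - f i (catv (pre i mu)))
      *: (invmx (sqrtmx (Sig k)) *m z k j)).
Proof.
rewrite /casbo_ghat; congr (_ *: _); apply: eq_bigr => j _; congr ((f i _ - _) *: _).
rewrite sqrtmx_bdiag; last by move=> l; exact: hSig.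
by rewrite bdiag_catv -catvD.
Qed.

End CasboRewrite.

(** * Measurability of the iterates *)

Section RandomMatrices.
Context {R : realType} {d' : measure_display} {T : measurableType d'}.

Definition mmx m n (X : T -> 'M[R]_(m, n)) :=
  forall i j, measurable_fun setT (fun w => X w i j).

Lemma mmx_cst m n (M : 'M[R]_(m, n)) : mmx (fun=> M).
Proof. by move=> i j; exact: measurable_cst. Qed.

Lemma mmxD m n (X Y : T -> 'M[R]_(m, n)) : mmx X -> mmx Y ->
  mmx (fun w => X w + Y w).
Proof.
move=> hX hY i j; under eq_fun do rewrite mxE.
by apply: measurable_funD; [exact: hX|exact: hY].
Qed.

Lemma mmxZ m n (a : T -> R) (X : T -> 'M[R]_(m, n)) : measurable_fun setT a -> mmx X ->
  mmx (fun w => a w *: X w).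
Proof.
move=> ha hX i j; under eq_fun do rewrite mxE.
by apply: measurable_funM => //; exact: hX.
Qed.

Lemma mmxB m n (X Y : T -> 'M[R]_(m, n)) : mmx X -> mmx Y ->
  mmx (fun w => X w - Y w).
Proof.
move=> hX hY; apply: mmxD => // i j; under eq_fun do rewrite mxE.
exact: measurable_funN.
Qed.

Lemma measurable_sumr (I : Type) (r : seq I) (P : pred I) (F : I -> T -> R) :
  (forall i, measurable_fun setT (F i)) ->
  measurable_fun setT (fun w => \sum_(i <- r | P i) F i w).
Proof.
move=> hF; elim: r => [|i r IH].
  by under eq_fun do rewrite big_nil; exact: measurable_cst.
case Pi: (P i); under eq_fun do rewrite big_cons Pi; last by [].
exact: measurable_funD.
Qed.

Lemma measurable_prodr (I : Type) (r : seq I) (P : pred I) (F : I -> T -> R) :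
  (forall i, measurable_fun setT (F i)) ->
  measurable_fun setT (fun w => \prod_(i <- r | P i) F i w).
Proof.
move=> hF; elim: r => [|i r IH].
  by under eq_fun do rewrite big_nil; exact: measurable_cst.
case Pi: (P i); under eq_fun do rewrite big_cons Pi; last by [].
exact: measurable_funM.
Qed.

Lemma measurable_bigmax (I : Type) (r : seq I) (F : I -> T -> R) h :
  measurable_fun setT h -> (forall i, measurable_fun setT (F i)) ->
  measurable_fun setT (fun w => \big[Num.max/h w]_(i <- r) F i w).
Proof.
move=> hh hF; elim: r => [|i r IH]; first by under eq_fun do rewrite big_nil.
by under eq_fun do rewrite big_cons; exact: measurable_maxr.
Qed.

Lemma measurable_bigmin (I : Type) (r : seq I) (F : I -> T -> R) h :
  measurable_fun setT h -> (forall i, measurable_fun setT (F i)) ->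
  measurable_fun setT (fun w => \big[Num.min/h w]_(i <- r) F i w).
Proof.
move=> hh hF; elim: r => [|i r IH]; first by under eq_fun do rewrite big_nil.
by under eq_fun do rewrite big_cons; exact: measurable_minr.
Qed.

Lemma measurable_fmax N (s : T -> 'I_N -> R) :
  (forall j, measurable_fun setT (s ^~ j)) ->
  measurable_fun setT (fun w => fmax (s w)).
Proof.
move=> hs; rewrite /fmax; under eq_fun do rewrite big_map.
apply: measurable_bigmax => //.
case: (enum 'I_N) => [|j r] /=; [exact: measurable_cst|exact: hs].
Qed.

Lemma measurable_fmin N (s : T -> 'I_N -> R) :
  (forall j, measurable_fun setT (s ^~ j)) ->
  measurable_fun setT (fun w => fmin (s w)).
Proof.
move=> hs; rewrite /fmin; under eq_fun do rewrite big_map.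
apply: measurable_bigmin => //.
case: (enum 'I_N) => [|j r] /=; [exact: measurable_cst|exact: hs].
Qed.

Lemma measurable_invr (a : T -> R) : measurable_fun setT a ->
  measurable_fun setT (fun w => (a w)^-1).
Proof.
move=> ha; have -> : (fun w => (a w)^-1) = (fun w => a w * (a w ^+ 2) `^ (-1)).
  apply/funext => w; rewrite powR_inv1 ?sqr_ge0//.
  have [->|a0] := eqVneq (a w) 0; first by rewrite invr0 mul0r.
  by field.
apply: measurable_funM => //.
apply: (measurableT_comp (measurable_powR _)).
exact: measurable_funX.
Qed.

Lemma mmx_sum (I : Type) (r : seq I) (P : pred I) m n (F : I -> T -> 'M[R]_(m, n)) :
  (forall i, mmx (F i)) -> mmx (fun w => \sum_(i <- r | P i) F i w).
Proof.
move=> hF i j; under eq_fun do rewrite summxE.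
by apply: measurable_sumr => k; exact: hF.
Qed.

Lemma mmxM m n p (X : T -> 'M[R]_(m, n)) (Y : T -> 'M[R]_(n, p)) :
  mmx X -> mmx Y -> mmx (fun w => X w *m Y w).
Proof.
move=> hX hY i j; under eq_fun do rewrite mxE.
by apply: measurable_sumr => k; apply: measurable_funM; [exact: hX|exact: hY].
Qed.

Lemma mmx_tr m n (X : T -> 'M[R]_(m, n)) : mmx X -> mmx (fun w => (X w)^T).
Proof. by move=> hX i j; under eq_fun do rewrite mxE; exact: hX. Qed.

Lemma mmx_det n (X : T -> 'M[R]_n) : mmx X -> measurable_fun setT (fun w => \det (X w)).
Proof.
move=> hX; rewrite /determinant; apply: measurable_sumr => s.
apply: measurable_funM; first exact: measurable_cst.
by apply: measurable_prodr => i; exact: hX.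
Qed.

Lemma mmx_inv n (X : T -> 'M[R]_n) : mmx X -> (forall w, X w \in unitmx) ->
  mmx (fun w => invmx (X w)).
Proof.
move=> hX uX; under eq_fun do rewrite /invmx uX.
apply: mmxZ; first by apply: measurable_invr; exact: mmx_det.
move=> i j; under eq_fun do rewrite mxE /cofactor.
apply: measurable_funM; first exact: measurable_cst.
by apply: mmx_det => k l; under eq_fun do rewrite !mxE; exact: hX.
Qed.

Lemma mmx_lim m n (X : nat -> T -> 'M[R]_(m, n)) (Y : T -> 'M[R]_(m, n)) :
  (forall k, mmx (X k)) -> (forall w, mxlim (fun k => X k w) (Y w)) -> mmx Y.
Proof.
move=> hX hl i j.
apply: (@measurable_fun_cvg _ _ _ setT (fun k w => X k w i j)).
  by move=> k; exact: hX.
by move=> w _; exact: hl.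
Qed.

Lemma mmx_sqrt n (A : T -> 'M[R]_n) Lam : mmx A -> 0 < Lam ->
  (forall w, (A w)^T = A w /\ posdef (A w)) ->
  (forall w x, qform (A w) x <= Lam * dotv x x) ->
  mmx (fun w => sqrtmx (A w)).
Proof.
move=> mA L0 hA bA.
have /choice[Y hY] : forall w, exists Y,
    mxlim (sqrt_iter (1%:M - Lam^-1 *: A w)) Y /\
    sqrtmx (A w) = Num.sqrt Lam *: (1%:M - Y).
  move=> w; have [s p] := hA w.
  by have [Y h1 h2] := sqrtmx_lim s p L0 (bA w); exists Y.
under eq_fun do rewrite (hY _).2.
apply: mmxZ; first exact: measurable_cst.
apply: mmxB; first exact: mmx_cst.
apply: (@mmx_lim _ _ (fun k w => sqrt_iter (1%:M - Lam^-1 *: A w) k)); last first.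
  by move=> w; exact: (hY w).1.
elim=> [|k IH] /=; first exact: mmx_cst.
apply: mmxZ; first exact: measurable_cst.
apply: mmxD; last exact: mmxM.
apply: mmxB; first exact: mmx_cst.
by apply: mmxZ => //; exact: measurable_cst.
Qed.

Lemma measurable_sqrtr (a : T -> R) : measurable_fun setT a ->
  measurable_fun setT (fun w => Num.sqrt (a w)).
Proof.
move=> ha; apply: (measurableT_comp _ ha).
by apply: continuous_measurable_fun; exact: sqrt_continuous.
Qed.

Lemma measurable_dotv n (X Y : T -> 'cV[R]_n) : mmx X -> mmx Y ->
  measurable_fun setT (fun w => dotv (X w) (Y w)).
Proof.
move=> hX hY; apply: measurable_sumr => i.
by apply: measurable_funM; [exact: hX|exact: hY].
Qed.

Lemma measurable_enorm n (X : T -> 'cV[R]_n) : mmx X ->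
  measurable_fun setT (fun w => enorm (X w)).
Proof.
move=> hX; under eq_fun do rewrite enormE.
by apply: measurable_sqrtr; exact: measurable_dotv.
Qed.

Lemma rat_vector_dense n (x : 'cV[R]_n) (e : R) : 0 < e ->
  exists q : 'cV[rat]_n, enorm (x - map_mx ratr q) < e.
Proof.
move=> e0; pose e' := e / n.+1%:R.
have e'0 : 0 < e' by rewrite divr_gt0.
have /choice[q hq] : forall i, exists q : rat, `|x i 0 - ratr q| < e'.
  move=> i; have [q] := @rat_in_itvoo R (x i 0 - e') (x i 0 + e') ltac:(lra).
  by rewrite in_itv/= => /andP[h1 h2]; exists q; rewrite ltr_distlC h1 h2.
exists (\col_i q i).
apply: le_lt_trans (enorm_le_sum _) _.
apply: le_lt_trans (_ : \sum_(i < n) e' < e).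
  by apply: ler_sum => i _; rewrite !mxE ltW.
rewrite sumr_const card_ord -mulr_natr /e' mulrAC ltr_pdivrMr// ltr_pM2l//.
by rewrite ltr_nat.
Qed.

(* McShane: f x = inf over rational q of f q + L |x - q|. *)
Lemma measurable_lipschitz n (f : 'cV[R]_n -> R) (L : R) (X : T -> 'cV[R]_n) :
  (forall x y, `|f x - f y| <= L * enorm (x - y)) -> mmx X ->
  measurable_fun setT (fun w => f (X w)).
Proof.
move=> hf hX.
pose L' := `|L| + 1.
have L'0 : 0 < L' by rewrite ltr_wpDl.
have hf' x y : `|f x - f y| <= L' * enorm (x - y).
  rewrite (le_trans (hf x y))// ler_wpM2r ?enorm_ge0// /L'.
  by rewrite (le_trans (ler_norm _))// lerDl.
apply: (measurability _ (RGenInftyO.measurableE R)).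
move=> _ [_ [c ->] <-]; rewrite setTI.
have -> : (fun w => f (X w)) @^-1` `]-oo, c[%classic =
  \bigcup_(q : 'cV[rat]_n) [set w | f (map_mx ratr q) +
    L' * enorm (X w - map_mx ratr q) < c].
  apply/seteqP; split => w /=; rewrite in_itv/=.
    move=> fc.
    have e0 : 0 < (c - f (X w)) / (2 * L') by rewrite divr_gt0 ?mulr_gt0// subr_gt0.
    have [q hq] := rat_vector_dense (X w) e0.
    exists q => //=.
    have := hf' (X w) (map_mx ratr q); rewrite ler_norml => /andP[h1 _].
    move: hq; rewrite ltr_pdivlMr ?mulr_gt0// => hq.
    lra.
  move=> [q _] /=; apply: le_lt_trans.
  have := hf' (X w) (map_mx ratr q); rewrite ler_norml => /andP[_ h2].
  lra.
apply: countable_bigcupT_measurable; first exact: countableP.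
move=> q; set F := fun w => f (map_mx ratr q) + L' * enorm (X w - map_mx ratr q).
have mF : measurable_fun setT F.
  apply: measurable_funD; first exact: measurable_cst.
  apply: measurable_funM; first exact: measurable_cst.
  by apply: measurable_enorm; apply: mmxB => //; exact: mmx_cst.
have := mF measurableT `]-oo, c[%classic (measurable_itv _).
by rewrite setTI; congr measurable; apply/seteqP; split => w /=; rewrite in_itv.
Qed.

Lemma mmx_catv n d (X : 'I_n -> T -> 'cV[R]_d) : (forall i, mmx (X i)) ->
  mmx (fun w => catv (fun i => X i w)).
Proof.
move=> hX a b; rewrite ord1; case/mxvec_indexP: a => i l.
by under eq_fun do rewrite catvE; exact: hX.
Qed.

End RandomMatrices.

Section CasboMeasurable.
Context {R : realType} {d' : measure_display} {T : measurableType d'} {d K N : nat}.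
Variable f : forall k : 'I_K, 'cV[R]_(k.+1 * d) -> R.
Arguments f : clear implicits.
Variable L : 'I_K -> R.
Hypothesis fL : forall (k : 'I_K) (x y : 'cV[R]_(k.+1 * d)),
  `|f k x - f k y| <= L k * enorm (x - y).
Variables (mu : T -> 'I_K -> 'cV[R]_d) (Sig : T -> 'I_K -> 'M[R]_d).
Variables (z : T -> 'I_K -> 'I_N -> 'cV[R]_d) (c1 c2 : T -> 'I_K -> R).
Hypothesis mmu : forall k, mmx (mu ^~ k).
Hypothesis mSig : forall k, mmx (Sig ^~ k).
Hypothesis mz : forall k j, mmx (fun w => z w k j).
Hypothesis mc1 : forall k, measurable_fun setT (c1 ^~ k).
Hypothesis mc2 : forall k, measurable_fun setT (c2 ^~ k).
Hypothesis hSig : forall w k, (Sig w k)^T = Sig w k /\ posdef (Sig w k).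
Variable Lam : R.
Hypothesis Lam0 : 0 < Lam.
Hypothesis bSig : forall w k x, qform (Sig w k) x <= Lam * dotv x x.

Lemma mmx_sqrtSig k : mmx (fun w => sqrtmx (Sig w k)).
Proof. by apply: (@mmx_sqrt _ _ _ _ _ Lam). Qed.

Lemma mmx_isqrtSig k : mmx (fun w => invmx (sqrtmx (Sig w k))).
Proof.
apply: mmx_inv; first exact: mmx_sqrtSig.
by move=> w; have [s p] := hSig w k; have [] := sqrtmxP s p.
Qed.

Lemma mmx_casbo_x k j : mmx (fun w => casbo_x (mu w) (Sig w) (z w) k j).
Proof. by apply: mmxD => //; apply: mmxM => //; exact: mmx_sqrtSig. Qed.

Lemma measurable_f_catv i (X : 'I_K -> T -> 'cV[R]_d) : (forall k, mmx (X k)) ->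
  measurable_fun setT (fun w => f i (catv (pre i (X ^~ w)))).
Proof.
move=> hX; apply: (measurable_lipschitz (@fL i)).
by apply: mmx_catv => l; exact: hX.
Qed.

Lemma mmx_casbo_ghat i k : mmx (fun w => casbo_ghat f (mu w) (Sig w) (z w) i k).
Proof.
under eq_fun do rewrite casbo_ghatE//.
apply: mmxZ; first exact: measurable_cst.
apply: mmx_sum => j; apply: mmxZ; last by apply: mmxM => //; exact: mmx_isqrtSig.
apply: measurable_funB.
- by apply: measurable_f_catv => l; exact: mmx_casbo_x.
- by apply: measurable_f_catv => l; exact: mmu.
Qed.

Lemma measurable_casbo_s k j :
  measurable_fun setT (fun w => casbo_s f (mu w) (Sig w) (z w) k j).
Proof.
apply: measurable_sumr => i.
by apply: measurable_f_catv => l; exact: mmx_casbo_x.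
Qed.

Lemma mmx_casbo_G k :
  mmx (fun w => casbo_G f (mu w) (Sig w) (z w) (c1 w) (c2 w) k).
Proof.
apply: mmxM; last exact: mmx_isqrtSig.
apply: mmxM; first exact: mmx_isqrtSig.
apply: mmxD; last by apply: mmxZ => //; exact: mmx_cst.
apply: mmxZ => //; apply: mmxZ; first exact: measurable_cst.
apply: mmx_sum => j; apply: mmxZ; last by apply: mmxM => //; exact: mmx_tr.
have m1 : measurable_fun setT (fun w => fmax (casbo_s f (mu w) (Sig w) (z w) k)).
  by apply: measurable_fmax => j'; exact: measurable_casbo_s.
have m2 : measurable_fun setT (fun w => fmin (casbo_s f (mu w) (Sig w) (z w) k)).
  by apply: measurable_fmin => j'; exact: measurable_casbo_s.
apply: measurable_funM; last by apply: measurable_invr; exact: measurable_funB.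
by apply: measurable_funB => //; exact: measurable_casbo_s.
Qed.

Lemma mmx_casbo_mu_next b g k :
  mmx (fun w => casbo_mu_next f (mu w) (Sig w) (z w) b g k).
Proof.
apply: mmxB => //; apply: mmxZ; first exact: measurable_cst.
apply: mmxM => //; apply: mmxD; last by apply: mmx_sum => i; exact: mmx_casbo_ghat.
by apply: mmxZ => //; exact: measurable_cst.
Qed.

Lemma mmx_casbo_Sig_next a o k :
  (forall w, o *: invmx (Sig w k) +
     a *: casbo_G f (mu w) (Sig w) (z w) (c1 w) (c2 w) k \in unitmx) ->
  mmx (fun w => casbo_Sig_next f (mu w) (Sig w) (z w) (c1 w) (c2 w) a o k).
Proof.
move=> u; apply: mmx_inv => //; apply: mmxD.
  apply: mmxZ; first exact: measurable_cst.
  by apply: mmx_inv => // w; have [_ p] := hSig w k; exact: posdef_unit.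
by apply: mmxZ; [exact: measurable_cst|exact: mmx_casbo_G].
Qed.

End CasboMeasurable.

(** * Independence and decoupling *)

Section Independence.
Context {R : realType} {d0 : measure_display} {Om : measurableType d0}.
Variable P : probability Om R.
Variables (I : eqType) (X : I -> Om -> R).
Hypothesis indX : mutually_independent P X.
Hypothesis mX : forall i, measurable_fun setT (X i).

Definition coord_gen (A : set I) : set (set Om) :=
  [set E | exists i (C : set R), [/\ A i, measurable C & E = X i @^-1` C]].

Definition coord_cyl (s : seq I) (C : I -> set R) : set Om :=
  \big[setI/setT]_(i <- s) (X i @^-1` C i).

Lemma coord_cylP s C w : coord_cyl s C w <-> forall i, i \in s -> C i (X i w).
Proof.
rewrite /coord_cyl; elim: s => [|i s IH]; first by rewrite big_nil.
rewrite big_cons; split.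
  move=> [h /IH hs] j; rewrite inE => /orP[/eqP ->//|]; exact: hs.
move=> h; split; first by apply: h; rewrite inE eqxx.
by apply/IH => j js; apply: h; rewrite inE js orbT.
Qed.

Definition coord_pi (A : set I) : set (set Om) :=
  [set E | exists s C, [/\ uniq s, (forall i, i \in s -> A i),
     (forall i, measurable (C i)) & E = coord_cyl s C]].

Lemma measurable_coord i (C : set R) : measurable C -> measurable (X i @^-1` C).
Proof. by move=> mC; rewrite -[_ @^-1` _]setTI; exact: mX. Qed.

Lemma coord_pi_measurable A : coord_pi A `<=` measurable.
Proof.
move=> _ [s [C [_ _ mC ->]]]; rewrite /coord_cyl.
by apply: bigsetI_measurable => i _; exact: measurable_coord.
Qed.

Lemma coord_pi_setI A : setI_closed (coord_pi A).
Proof.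
move=> _ _ [s [C [us As mC ->]]] [s' [C' [us' As' mC' ->]]].
exists (undup (s ++ s')).
exists (fun i => (if i \in s then C i else setT) `&`
                 (if i \in s' then C' i else setT)).
split.
- exact: undup_uniq.
- by move=> i; rewrite mem_undup mem_cat => /orP[/As|/As'].
- by move=> i; apply: measurableI; case: ifP.
- apply/seteqP; split => w.
    move=> [/coord_cylP h /coord_cylP h']; apply/coord_cylP => i _.
    by split; case: ifP => // ?; [exact: h|exact: h'].
  move=> /coord_cylP h; split; apply/coord_cylP => i si.
    have := h i; rewrite mem_undup mem_cat si => /(_ isT)[+ _]; exact.
  have := h i; rewrite mem_undup mem_cat si orbT => /(_ isT)[_ +]; exact.
Qed.

Lemma coord_pi_setT A : coord_pi A setT.
Proof. by exists [::], (fun=> setT); split => //; rewrite /coord_cyl big_nil. Qed.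

Lemma coord_gen_pi A : coord_gen A `<=` coord_pi A.
Proof.
move=> _ [i [C [Ai mC ->]]]; exists [:: i], (fun=> C); split => //.
  by move=> j; rewrite inE => /eqP ->.
by rewrite /coord_cyl big_seq1.
Qed.

Lemma coord_gen_measurable A : <<s coord_gen A >> `<=` measurable.
Proof.
apply: smallest_sub; first exact: sigma_algebra_measurable.
exact: subset_trans (@coord_gen_pi A) (@coord_pi_measurable A).
Qed.

Lemma coord_pi_indep (A B : set I) E F : A `&` B = set0 ->
  coord_pi A E -> coord_pi B F -> P (E `&` F) = (P E * P F)%E.
Proof.
move=> AB [s [C [us As mC ->]]] [s' [C' [us' Bs mC' ->]]].
have dis i : i \in s -> i \in s' = false.
  move=> /As Ai; apply/negP => /Bs Bi.
  by have : (A `&` B) i by []; rewrite AB.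
pose C2 i := if i \in s then C i else C' i.
have -> : coord_cyl s C `&` coord_cyl s' C' = coord_cyl (s ++ s') C2.
  rewrite /coord_cyl big_cat/= /C2; congr (_ `&` _).
    by apply: eq_big_seq => i ->.
  apply: eq_big_seq => i si'; case: ifP => // /dis.
  by rewrite si'.
rewrite /coord_cyl !indX//; last 2 first.
- rewrite cat_uniq us us' andbT/=; apply/hasPn => i is'.
  by apply/negP => /dis; rewrite is'.
- by move=> i; rewrite /C2; case: ifP.
rewrite big_cat /C2; congr (_ * _)%E; first by apply: eq_big_seq => i ->.
apply: eq_big_seq => i si'; case: ifP => // /dis.
by rewrite si'.
Qed.

Lemma coord_indep_half (A : set I) F : measurable F ->
  (forall E, coord_pi A E -> P (E `&` F) = (P E * P F)%E) ->
  forall E, <<s coord_pi A >> E -> P (E `&` F) = (P E * P F)%E.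
Proof.
move=> mF h E sE.
have finF : P F \is a fin_num by exact: fin_num_measure.
pose r : {nonneg R} := NngNum (fine_ge0 (measure_ge0 P F)).
have rE A' : mscale r P A' = (P A' * P F)%E by rewrite /mscale/= fineK// muleC.
rewrite -rE -[LHS]/(mrestr P mF E).
apply: (g_sigma_algebra_measure_unique (coord_pi A) _ (fun=> setT)) => //.
- exact: coord_pi_measurable.
- by move=> _; exact: coord_pi_setT.
- by rewrite bigcup_const//; exists 0%N.
- exact: coord_pi_setI.
- by move=> E' hE'; rewrite [RHS]rE; exact: h.
- by move=> k; rewrite -[X in (X < _)%E]/(P (setT `&` F)) setTI ltey_eq finF.
Qed.

Lemma coord_indep (A B : set I) E F : A `&` B = set0 ->
  <<s coord_gen A >> E -> <<s coord_gen B >> F -> P (E `&` F) = (P E * P F)%E.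
Proof.
move=> AB sE sF.
have mE := coord_gen_measurable sE.
have {}sE := sub_sigma_algebra2 (@coord_gen_pi A) sE.
have {}sF := sub_sigma_algebra2 (@coord_gen_pi B) sF.
rewrite setIC muleC; apply: coord_indep_half sF => // F' hF'.
rewrite setIC muleC; apply: coord_indep_half sE; first exact: coord_pi_measurable hF'.
by move=> E' hE'; exact: (coord_pi_indep AB hE' hF').
Qed.

Definition coord_space (A : set I) := g_sigma_algebraType (coord_gen A).

Lemma measurable_coord_id (A : set I) :
  measurable_fun setT (id : Om -> coord_space A).
Proof. by move=> _ E mE; rewrite setTI; exact: coord_gen_measurable mE. Qed.

Lemma coord_space_measurable (A : set I) i : A i ->
  measurable_fun setT (X i : coord_space A -> R).
Proof.
move=> Ai _ C mC; rewrite setTI; apply: sub_sigma_algebra.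
by exists i, C; split.
Qed.

Lemma coord_space_mono (A B : set I) d1 (U : measurableType d1) (Y : Om -> U) :
  A `<=` B -> measurable_fun setT (Y : coord_space A -> U) ->
  measurable_fun setT (Y : coord_space B -> U).
Proof.
move=> AB mY _ C mC; have := mY measurableT C mC; rewrite !setTI.
apply: sub_sigma_algebra2 => E [i [C' [Ai mC' ->]]].
by exists i, C'; split => //; exact: AB.
Qed.

Lemma coord_space_sub (A : set I) d1 (U : measurableType d1) (Y : Om -> U) :
  measurable_fun setT (Y : coord_space A -> U) -> measurable_fun setT Y.
Proof.
move=> mY _ C mC; have := mY measurableT C mC; rewrite !setTI.
exact: coord_gen_measurable.
Qed.

Lemma measurable_decouple (A B : set I) (h : Om -> Om -> \bar R) :
  measurable_fun setT
    (fun p : coord_space A * coord_space B => h p.1 p.2) ->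
  (forall w w', 0 <= h w w')%E ->
  measurable_fun setT (fun w => \int[P]_w' h w w')%E.
Proof.
move=> mh h0; have mB := @measurable_coord_id B.
pose fB : {mfun Om >-> coord_space B} := HB.pack (id : Om -> coord_space B)
  (isMeasurableFun.Build _ _ _ _ _ mB).
pose H := fun p : coord_space A * coord_space B => h p.1 p.2.
have H0 p : (0 <= H p)%E by exact: h0.
apply: (@coord_space_sub A).
have := @measurable_fun_fubini_tonelli_F _ _ (coord_space A) (coord_space B) R
  (distribution P fB) H mh H0.
congr measurable_fun; apply/funext => w; rewrite /fubini_F.
have mh1 : measurable_fun setT (fun w' : coord_space B => H (w, w')).
  exact: (measurableT_comp mh (pair1_measurable (w : coord_space A))).
by rewrite (ge0_integral_distribution fB mh1).
Qed.

Lemma decouple (A B : set I) (h : Om -> Om -> \bar R) : A `&` B = set0 ->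
  measurable_fun setT
    (fun p : coord_space A * coord_space B => h p.1 p.2) ->
  (forall w w', 0 <= h w w')%E ->
  (\int[P]_w h w w = \int[P]_w \int[P]_w' h w w')%E.
Proof.
move=> AB mh h0.
have mA := @measurable_coord_id A; have mB := @measurable_coord_id B.
pose fA : {mfun Om >-> coord_space A} := HB.pack (id : Om -> coord_space A)
  (isMeasurableFun.Build _ _ _ _ _ mA).
pose fB : {mfun Om >-> coord_space B} := HB.pack (id : Om -> coord_space B)
  (isMeasurableFun.Build _ _ _ _ _ mB).
pose g := fun w : Om => (w : coord_space A, w : coord_space B).
have mg : measurable_fun setT g by exact: measurable_fun_pair.
pose gAB : {mfun Om >-> (coord_space A * coord_space B)%type} := HB.pack g
  (isMeasurableFun.Build _ _ _ _ _ mg).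
pose H := fun p : coord_space A * coord_space B => h p.1 p.2.
have H0 p : (0 <= H p)%E by exact: h0.
transitivity (\int[distribution P gAB]_p H p)%E.
  by rewrite ge0_integral_distribution.
transitivity (\int[distribution P fA \x distribution P fB]_p H p)%E.
  apply: eq_measure_integral => E mE _; apply/esym.
  apply: product_measure_unique => // E1 E2 mE1 mE2.
  exact: (coord_indep AB mE1 mE2).
rewrite fubini_tonelli1//.
rewrite ge0_integral_distribution//; last 2 first.
- exact: measurable_fun_fubini_tonelli_F.
- by move=> y; apply: integral_ge0.
apply: eq_integral => w _ /=; rewrite /fubini_F.
have mh1 : measurable_fun setT (fun w' : coord_space B => H (w, w')).
  exact: (measurableT_comp mh (pair1_measurable (w : coord_space A))).
by rewrite (ge0_integral_distribution fB mh1).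
Qed.

End Independence.

(** * The standard normal law *)

Section Density.
Context {R : realType} {d0 : measure_display} {T : measurableType d0}.
Variables (mu nu : {measure set T -> \bar R}) (p : T -> R).
Hypothesis p0 : forall x, 0 <= p x.
Hypothesis mp : measurable_fun setT p.
Hypothesis nuE : forall A, measurable A -> nu A = (\int[mu]_(x in A) (p x)%:E)%E.
Import HBNNSimple.
Local Open Scope ereal_scope.

Lemma ge0_integral_density (f : T -> \bar R) : measurable_fun setT f ->
  (forall x, 0 <= f x) -> \int[nu]_x f x = \int[mu]_x (f x * (p x)%:E).
Proof.
move=> mf f0; pose f_ := nnsfun_approx measurableT mf.
have pe0 x : 0 <= (p x)%:E by rewrite lee_fin.
have mpe : measurable_fun setT (EFin \o p) by exact/measurable_EFinP.
transitivity (limn (fun n => \int[nu]_x (f_ n x)%:E)).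
  rewrite -monotone_convergence//.
  - apply: eq_integral => y _; apply/esym/cvg_lim => //.
    by apply: cvg_nnsfun_approx.
  - by move=> n; exact/measurable_EFinP/measurable_funP.
  - by move=> n y _; rewrite lee_fin.
  - by move=> y _ m n mn; rewrite lee_fin; exact/lefP/nd_nnsfun_approx.
rewrite [X in limn X](_ : _ = (fun n => \int[mu]_x ((f_ n x)%:E * (p x)%:E))).
  rewrite -monotone_convergence//; last 3 first.
    - move=> n /=; apply: emeasurable_funM => //.
      exact/measurable_EFinP/measurable_funP.
    - by move=> n x _ /=; rewrite mule_ge0// lee_fin.
    - move=> x _ m n mn; rewrite lee_pmul// ?lee_fin//.
      exact/lefP/nd_nnsfun_approx.
  apply: eq_integral => x _ /=; apply/cvg_lim => //.
  under eq_fun do rewrite muleC.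
  rewrite muleC; apply: cvgeZl => //.
  by apply: cvg_nnsfun_approx.
apply/funext => n.
have mfn r : measurable (f_ n @^-1` [set r]).
  by rewrite -[_ @^-1` _]setTI; exact: measurable_funP.
transitivity (\sum_(k \in range (f_ n))
    \int[mu]_x ((k * \1_(f_ n @^-1` [set k]) x)%:E * (p x)%:E)).
  under eq_integral do rewrite fimfunE -fsumEFin//.
  rewrite ge0_integral_fsum//; last 2 first.
  - by move=> y; exact/measurable_EFinP/measurable_funM.
  - by move=> y x _; rewrite nnfun_muleindic_ge0.
  apply: eq_fsbigr => r; rewrite inE => -[x0 _ rE].
  have r0 : (0 <= r)%R by rewrite -rE.
  rewrite integralZl_indic_nnsfun// integral_indic//= setIT nuE//.
  under [in RHS]eq_integral do rewrite EFinM -muleA.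
  have mI : measurable_fun setT
      (fun x => (\1_(f_ n @^-1` [set r]) x)%:E * (p x)%:E).
    apply: emeasurable_funM => //.
    by apply/measurable_EFinP; exact: measurable_indic.
  have I0 x : 0 <= (\1_(f_ n @^-1` [set r]) x)%:E * (p x)%:E.
    by rewrite mule_ge0// lee_fin.
  rewrite ge0_integralZl//.
  congr (_ * _); rewrite integral_mkcond; apply: eq_integral => x _.
  rewrite patchE indicE; case: ifP => _; first by rewrite mul1e.
  by rewrite mul0e.
rewrite -ge0_integral_fsum//.
- apply: eq_integral => x _; rewrite -ge0_mule_fsuml; last first.
    by move=> y; rewrite nnfun_muleindic_ge0.
  by congr (_ * _); rewrite fsumEFin// -fimfunE.
- move=> r; apply: emeasurable_funM => //.
  by exact/measurable_EFinP/measurable_funM.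
- by move=> r x _; rewrite mule_ge0// nnfun_muleindic_ge0.
Qed.

End Density.

Section NormalLaw.
Context {R : realType} {d0 : measure_display} {Om : measurableType d0}.
Variable P : probability Om R.
Variable Z : Om -> R.
Hypothesis nZ : std_normal P Z.
Local Open Scope ereal_scope.
Local Notation leb := (@lebesgue_measure R).

Lemma std_normal_expect (f : R -> \bar R) : measurable_fun setT f ->
  (forall x, 0 <= f x) ->
  \int[P]_w f (Z w) = \int[leb]_x (f x * (normal_pdf 0 1 x)%:E).
Proof.
move=> mf f0; have [mZ hZ] := nZ.
have mZ' : measurable_fun setT (Z : Om -> measurableTypeR R) := mZ.
pose fZ : {mfun Om >-> measurableTypeR R} :=
  HB.pack (Z : Om -> measurableTypeR R) (isMeasurableFun.Build _ _ _ _ _ mZ').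
transitivity (\int[distribution P fZ]_x f x).
  by rewrite ge0_integral_distribution.
rewrite (@ge0_integral_density _ _ _ leb (distribution P fZ) (normal_pdf 0 1))//.
- by move=> x; exact: normal_pdf_ge0.
- exact: measurable_normal_pdf.
Qed.

Lemma lebesgue_translation (c : R) (A : set R) : measurable A ->
  pushforward leb (fun x : measurableTypeR R => (x + c)%R : measurableTypeR R) A
  = leb A.
Proof.
move=> mA.
have mf : measurable_fun setT
    (fun x : measurableTypeR R => (x + c)%R : measurableTypeR R).
  exact: measurable_funD.
pose f : {mfun measurableTypeR R >-> measurableTypeR R} :=
  HB.pack (fun x : measurableTypeR R => (x + c)%R : measurableTypeR R)
  (isMeasurableFun.Build _ _ _ _ _ mf).
apply/esym; apply: (@lebesgue_measure_unique R (pushforward leb f)) => //.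
move=> _ [[a b]] _ <-; rewrite /pushforward /=.
set Q := (X in _ = leb X).
have -> : Q = `](a - c)%R, (b - c)%R]%classic :> set R.
  by apply/seteqP; split => x; rewrite /Q /= !in_itv/= ltrBlDr lerBrDr.
rewrite !lebesgue_measure_itv/= !lte_fin ltrD2r; case: ifP => // _.
by rewrite -!EFinD; congr (_%:E); ring.
Qed.

Lemma integral_translation (f : R -> \bar R) c : measurable_fun setT f ->
  (forall x, 0 <= f x) -> \int[leb]_x f (x + c)%R = \int[leb]_x f x.
Proof.
move=> mf f0.
have mfc : measurable_fun setT
    (fun x : measurableTypeR R => (x + c)%R : measurableTypeR R).
  exact: measurable_funD.
have := @ge0_integral_pushforward _ _ _ _ R _ mfc leb setT f measurableT mf.
rewrite preimage_setT => <-; last by move=> x _.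
by apply: eq_measure_integral => A mA _; exact: lebesgue_translation.
Qed.

Lemma std_normal_shift (f : R -> R) c : measurable_fun setT f ->
  (forall x, 0 <= f x)%R ->
  \int[P]_w (f (Z w + c)%R)%:E =
  \int[P]_w (f (Z w) * expR (c * Z w - c ^+ 2 / 2))%:E.
Proof.
move=> mf f0.
have mexp : measurable_fun setT (fun x : R => expR (c * x - c ^+ 2 / 2)).
  apply: (measurableT_comp (@measurable_expR R)).
  apply: measurable_funB; last exact: measurable_cst.
  by apply: (@measurable_funM _ _ R setT (cst c) id).
have mG : measurable_fun setT (fun x : R => f x * expR (c * x - c ^+ 2 / 2))%R.
  exact: measurable_funM.
have mF : measurable_fun setT (fun x : R =>
    (f x * expR (c * x - c ^+ 2 / 2))%:E * (normal_pdf 0 1 x)%:E).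
  apply: emeasurable_funM; first exact/measurable_EFinP.
  by apply/measurable_EFinP; exact: measurable_normal_pdf.
rewrite (@std_normal_expect (fun x => (f (x + c)%R)%:E)); last 2 first.
- by apply/measurable_EFinP; apply: measurableT_comp => //; exact: measurable_funD.
- by move=> x; rewrite lee_fin.
rewrite (@std_normal_expect (fun x => (f x * expR (c * x - c ^+ 2 / 2))%:E));
  last 2 first.
- exact/measurable_EFinP.
- by move=> x; rewrite lee_fin mulr_ge0// expR_ge0.
rewrite -[RHS](integral_translation c mF); last first.
  by move=> x; rewrite mule_ge0// lee_fin ?mulr_ge0 ?expR_ge0 ?normal_pdf_ge0.
apply: eq_integral => x _; rewrite -!EFinM -mulrA; congr (_ * _)%:E.
rewrite /normal_pdf oner_eq0 /normal_fun mulrCA -expRD.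
congr (_ * expR _)%R; rewrite !subr0 expr1n mulr2n.
by move: (x : R) => y; field.
Qed.

Lemma std_normal_flip (f : R -> R) : measurable_fun setT f ->
  (forall x, 0 <= f x)%R ->
  \int[P]_w (f (- Z w)%R)%:E = \int[P]_w (f (Z w))%:E.
Proof.
move=> mf f0.
rewrite (@std_normal_expect (fun x => (f (- x)%R)%:E)); last 2 first.
- by apply/measurable_EFinP; apply: measurableT_comp.
- by move=> x; rewrite lee_fin.
rewrite (@std_normal_expect (fun x => (f x)%:E)); last 2 first.
- by apply/measurable_EFinP.
- by move=> x; rewrite lee_fin.
have mN : measurable_fun setT (-%R : measurableTypeR R -> measurableTypeR R).
  exact: oppr_measurable.
have mF : measurable_fun setT (fun x => (f x)%:E * (normal_pdf 0 1 x)%:E).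
  apply: emeasurable_funM; first exact/measurable_EFinP.
  by apply/measurable_EFinP; exact: measurable_normal_pdf.
have := @ge0_integral_pushforward _ _ _ _ R _ mN leb setT _ measurableT mF.
rewrite preimage_setT => h.
transitivity (\int[pushforward leb (-%R : measurableTypeR R -> measurableTypeR R)]_x
  ((f x)%:E * (normal_pdf 0 1 x)%:E)).
  rewrite h; last by move=> x _; rewrite mule_ge0// lee_fin ?normal_pdf_ge0.
  apply: eq_integral => x _ /=; congr (_ * _%:E).
  rewrite /normal_pdf oner_eq0 /normal_fun.
  by rewrite !subr0 sqrrN.
by apply: eq_measure_integral => A mA _; exact: lebesgue_measureN.
Qed.

End NormalLaw.

(** * Expectations *)

Section Expectation.
Context {R : realType} {d0 : measure_display} {Om : measurableType d0}.
Variable P : probability Om R.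
Implicit Types f g : Om -> R.

Definition intg f := P.-integrable setT (EFin \o f).
Definition Ex f : R := fine (\int[P]_w (f w)%:E).

Lemma ExE f : intg f -> (\int[P]_w (f w)%:E)%E = (Ex f)%:E.
Proof. by move=> hf; rewrite /Ex fineK//; exact: integrable_fin_num. Qed.

Lemma intgD f g : intg f -> intg g -> intg (fun w => f w + g w).
Proof.
by move=> hf hg; have := integrableD measurableT hf hg; apply: eq_integrable.
Qed.

Lemma intgZ c f : intg f -> intg (fun w => c * f w).
Proof.
by move=> hf; have := integrableZl measurableT c hf; apply: eq_integrable.
Qed.

Lemma intgN f : intg f -> intg (fun w => - f w).
Proof.
by move=> hf; have := integrableN hf; apply: eq_integrable.
Qed.

Lemma intgB f g : intg f -> intg g -> intg (fun w => f w - g w).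
Proof. by move=> hf hg; apply: intgD => //; exact: intgN. Qed.

Lemma intg_cst c : intg (fun=> c).
Proof. exact: finite_measure_integrable_cst. Qed.

Lemma intg_sum (J : Type) (r : seq J) (Q : pred J) (F : J -> Om -> R) :
  (forall j, Q j -> intg (F j)) -> intg (fun w => \sum_(j <- r | Q j) F j w).
Proof.
move=> hF; elim: r => [|j r IH].
  by under eq_fun do rewrite big_nil; exact: intg_cst.
case Qj: (Q j); under eq_fun do rewrite big_cons Qj; last exact: IH.
by apply: intgD => //; exact: hF.
Qed.

Lemma intg_dom f g : measurable_fun setT f -> intg g ->
  (forall w, `|f w| <= g w) -> intg f.
Proof.
move=> mf hg fg; apply: le_integrable hg => //; first exact/measurable_EFinP.
by move=> w _; rewrite /= lee_fin (le_trans (fg w))// ler_norm.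
Qed.

Lemma intg_ge0 f : measurable_fun setT f -> (forall w, 0 <= f w) ->
  (\int[P]_w (f w)%:E < +oo)%E -> intg f.
Proof.
move=> mf f0 fin; apply/integrableP; split; first exact/measurable_EFinP.
by under eq_integral do rewrite /= ger0_norm//.
Qed.

Lemma ExD f g : intg f -> intg g -> Ex (fun w => f w + g w) = Ex f + Ex g.
Proof.
move=> hf hg; apply: EFin_inj; rewrite -ExE; last exact: intgD.
rewrite EFinD -!ExE// -integralD//.
Qed.

Lemma ExZ c f : intg f -> Ex (fun w => c * f w) = c * Ex f.
Proof.
move=> hf; apply: EFin_inj; rewrite -ExE; last exact: intgZ.
by rewrite EFinM -ExE// -integralZl.
Qed.

Lemma ExN f : intg f -> Ex (fun w => - f w) = - Ex f.
Proof.
by move=> hf; under eq_fun do rewrite -mulN1r; rewrite ExZ// mulN1r.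
Qed.

Lemma ExB f g : intg f -> intg g -> Ex (fun w => f w - g w) = Ex f - Ex g.
Proof. by move=> hf hg; rewrite ExD ?ExN//; exact: intgN. Qed.

Lemma Ex_cst c : Ex (fun=> c) = c.
Proof.
by apply: EFin_inj; rewrite -ExE ?integral_cst//= ?probability_setT ?mule1//;
  exact: intg_cst.
Qed.

Lemma Ex_sum (J : Type) (r : seq J) (Q : pred J) (F : J -> Om -> R) :
  (forall j, Q j -> intg (F j)) ->
  Ex (fun w => \sum_(j <- r | Q j) F j w) = \sum_(j <- r | Q j) Ex (F j).
Proof.
move=> hF; elim: r => [|j r IH].
  by under eq_fun do rewrite big_nil; rewrite big_nil Ex_cst.
rewrite big_cons; case Qj: (Q j); under eq_fun do rewrite big_cons Qj; last exact: IH.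
rewrite ExD ?IH//; first exact: hF.
exact: intg_sum.
Qed.

Lemma Ex_le f g : intg f -> intg g -> (forall w, f w <= g w) -> Ex f <= Ex g.
Proof.
move=> hf hg fg; rewrite -lee_fin -!ExE//; apply: le_integral => //.
by move=> w _; rewrite /= lee_fin.
Qed.

Lemma Ex_ge0 f : (forall w, 0 <= f w) -> 0 <= Ex f.
Proof. by move=> f0; apply: fine_ge0; apply: integral_ge0 => w _; rewrite lee_fin. Qed.

Lemma Ex_transfer f g : measurable_fun setT f -> (forall w, 0 <= f w) ->
  (\int[P]_w (f w)%:E = \int[P]_w (g w)%:E)%E -> intg g ->
  intg f /\ Ex f = Ex g.
Proof.
move=> mf f0 fg hg; split; last by rewrite /Ex fg.
by apply: intg_ge0 => //; rewrite fg ExE// ltry.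
Qed.

End Expectation.

(** * Moments of the standard normal law *)

Section RealInequalities.
Context {R : realType}.
Implicit Types x c u : R.

Lemma expR_sub1_le u : expR u - 1 <= u * expR u.
Proof.
have h := expR_ge1Dx (- u).
have e0 := expR_gt0 u.
have : (1 - u) * expR u <= expR (- u) * expR u by rewrite ler_pM2r.
by rewrite -expRD addNr expR0; lra.
Qed.

Lemma le_expR_limit x c : 0 <= c ->
  (forall u, 0 < u -> u < 1 -> x <= c * expR u) -> x <= c.
Proof.
move=> c0 h; have [//|cx] := leP x c.
have x0 : 0 < x by exact: le_lt_trans cx.
pose u := (x - c) / (2 * x).
have u0 : 0 < u by rewrite divr_gt0 ?subr_gt0 ?mulr_gt0.
have u1 : u < 1 by rewrite ltr_pdivrMr ?mulr_gt0//; lra.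
have hu := h u u0 u1.
have : x * (1 - u) <= c.
  have e := expR_ge1Dx (- u).
  have : x * expR (- u) <= c.
    have : x * expR (- u) <= c * expR u * expR (- u) by rewrite ler_pM2r ?expR_gt0.
    by rewrite -mulrA -expRD subrr expR0 mulr1.
  by apply: le_trans; rewrite ler_pM2l.
have -> : x * (1 - u) = (x + c) / 2 by rewrite /u; field; lra.
lra.
Qed.

Lemma sinh_ge x : 0 <= x -> 2 * x <= expR x - expR (- x).
Proof.
move=> x0; pose g (y : R) := expR y - expR (- y) - 2 * y.
have dg (y : R) : is_derive y (1 : R) g (expR y + expR (- y) - 2).
  have h1 : is_derive y (1 : R) (expR : R -> R) (expR y) by exact: is_derive_expR.
  have h2 : is_derive y (1 : R) (fun z : R => expR (- z)) (- expR (- y)).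
    have hN : is_derive y (1 : R) (fun z : R => - z) (- 1) by exact: is_deriveN.
    have hE : is_derive (- y) (1 : R) (expR : R -> R) (expR (- y)).
      exact: is_derive_expR.
    by have := is_derive1_comp hE hN; rewrite mulrN1.
  have h3 : is_derive y (1 : R) (fun z : R => 2 * z) 2.
    by have := is_deriveZ (2:R) (is_derive_id y (1:R)); rewrite /= scaler1.
  have := is_deriveB (is_deriveB h1 h2) h3.
  by rewrite opprK.
have : g 0 <= g x.
  apply: (@ger0_derive1_ndecr _ g 0 x) => //.
  - move=> y _; rewrite derive1E (@derive_val _ _ _ _ _ _ _ (dg y)).
    have e1 := expR_gt0 y; have : expR y * expR (- y) = 1.
      by rewrite -expRD subrr expR0.
    have := sqr_ge0 (expR y - expR (- y)) => q pr.
    have e2 := expR_gt0 (- y).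
    nra.
  - apply: derivable_within_continuous => y _.
    by have := dg y.
rewrite /g oppr0 subrr mulr0 subrr; lra.
Qed.

Lemma cosh_ge x : 1 + x ^+ 2 / 2 <= (expR x + expR (- x)) / 2.
Proof.
wlog x0 : x / 0 <= x => [h|].
  have [/h//|xn] := leP 0 x.
  have /h : 0 <= - x by lra.
  by rewrite opprK sqrrN [expR (- x) + _]addrC.
have h := @sinh_ge (x / 2) ltac:(lra).
have e1 : expR x = expR (x / 2) ^+ 2 by rewrite expr2 -expRD; congr expR; field.
have e2 : expR (- x) = expR (- (x / 2)) ^+ 2.
  by rewrite expr2 -expRD; congr expR; field.
have e3 : expR (x / 2) * expR (- (x / 2)) = 1 by rewrite -expRD subrr expR0.
rewrite e1 e2.
have : x ^+ 2 <= (expR (x / 2) - expR (- (x / 2))) ^+ 2.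
  rewrite ler_pXn2r ?nnegrE//; lra.
nra.
Qed.

End RealInequalities.

Section NormalMoments.
Context {R : realType} {d0 : measure_display} {Om : measurableType d0}.
Variable P : probability Om R.
Variable Z : Om -> R.
Hypothesis nZ : std_normal P Z.

Let mZ : measurable_fun setT Z. Proof. by have [] := nZ. Qed.

Let expZ (s : R) : intg P (fun w => expR (s * Z w)) /\
  Ex P (fun w => expR (s * Z w)) = expR (s ^+ 2 / 2).
Proof.
have h := @std_normal_shift _ _ _ P Z nZ (fun=> 1) s (measurable_cst _) (fun=> ler01).
have [i e] : intg P (fun w => 1 * expR (s * Z w - s ^+ 2 / 2)) /\
    Ex P (fun w => 1 * expR (s * Z w - s ^+ 2 / 2)) = 1.
  rewrite -[RHS](Ex_cst P); apply: Ex_transfer.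
  - apply: measurable_funM => //; apply: measurableT_comp => //.
    apply: measurable_funB => //.
    by apply: (@measurable_funM _ _ R setT (cst s)).
  - by move=> w; rewrite mul1r expR_ge0.
  - by rewrite -h.
  - exact: intg_cst.
have E w : expR (s * Z w) = expR (s ^+ 2 / 2) * (1 * expR (s * Z w - s ^+ 2 / 2)).
  by rewrite mul1r -expRD addrC subrK.
under eq_fun do rewrite E; split; first exact: intgZ.
by rewrite ExZ// e mulr1.
Qed.

Let sqrtE (u : R) : 0 < u -> let s := Num.sqrt (2 * u) in 0 < s /\ s ^+ 2 / 2 = u.
Proof.
move=> u0 s; have u2 : 0 < 2 * u by rewrite mulr_gt0.
by split; rewrite ?sqrtr_gt0// sqr_sqrtr ?ltW// mulrC mulKf.
Qed.

Lemma std_normal_intg2 : intg P (fun w => Z w ^+ 2).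
Proof.
apply: (@intg_dom _ _ _ P _ (fun w => expR (1 * Z w) + expR (- 1 * Z w))).
- exact: measurable_funX.
- by apply: intgD; exact: (expZ _).1.
- move=> w; rewrite ger0_norm ?sqr_ge0// mul1r mulN1r.
  have := cosh_ge (Z w); lra.
Qed.

Lemma std_normal_moment2 : Ex P (fun w => Z w ^+ 2) <= 1.
Proof.
apply: le_expR_limit => // u u0 _; rewrite mul1r.
have [s0 sE] := sqrtE u0; set s := Num.sqrt _ in s0 sE.
have [i1 e1] := expZ s; have [i2 e2] := expZ (- s).
have i := std_normal_intg2.
have : Ex P (fun w => 1 + u * Z w ^+ 2) <=
       Ex P (fun w => 2^-1 * (expR (s * Z w) + expR (- s * Z w))).
  apply: Ex_le.
  - by apply: intgD; [exact: intg_cst|exact: intgZ].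
  - by apply: intgZ; exact: intgD.
  - move=> w; have := cosh_ge (s * Z w); rewrite exprMn mulNr -sE; lra.
rewrite ExD ?Ex_cst ?ExZ ?ExD ?e1 ?e2//; [|exact: intgD|exact: intg_cst|exact: intgZ].
rewrite sqrrN sE => h.
have := expR_sub1_le u => h2.
rewrite -(ler_pM2l u0); lra.
Qed.

Let sqexpZ (s : R) : intg P (fun w => Z w ^+ 2 * expR (s * Z w)) /\
  Ex P (fun w => Z w ^+ 2 * expR (s * Z w)) =
  expR (s ^+ 2 / 2) * Ex P (fun w => (Z w + s) ^+ 2).
Proof.
have h := @std_normal_shift _ _ _ P Z nZ (fun x => x ^+ 2) s
  (exprn_measurable _) (fun x => sqr_ge0 x).
have i2 : intg P (fun w => (Z w + s) ^+ 2).
  apply: (@intg_dom _ _ _ P _ (fun w => 2 * Z w ^+ 2 + 2 * s ^+ 2)).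
  - by apply: measurable_funX; exact: measurable_funD.
  - by apply: intgD; [apply: intgZ; exact: std_normal_intg2|exact: intg_cst].
  - move=> w; rewrite ger0_norm ?sqr_ge0//.
    have := sqr_ge0 (Z w - s); lra.
have [i e] : intg P (fun w => Z w ^+ 2 * expR (s * Z w - s ^+ 2 / 2)) /\
    Ex P (fun w => Z w ^+ 2 * expR (s * Z w - s ^+ 2 / 2)) =
    Ex P (fun w => (Z w + s) ^+ 2).
  apply: Ex_transfer => //.
  - apply: measurable_funM => //; first exact: measurable_funX.
    apply: measurableT_comp => //.
    apply: measurable_funB => //.
    by apply: (@measurable_funM _ _ R setT (cst s)).
  - by move=> w; rewrite mulr_ge0 ?sqr_ge0 ?expR_ge0.
have E w : Z w ^+ 2 * expR (s * Z w) =
    expR (s ^+ 2 / 2) * (Z w ^+ 2 * expR (s * Z w - s ^+ 2 / 2)).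
  by rewrite mulrCA -expRD [s ^+ 2 / 2 + _]addrC subrK.
under eq_fun do rewrite E; split; first exact: intgZ.
by rewrite ExZ// e.
Qed.

Let sqcosh_ge s w : Z w ^+ 2 + s ^+ 2 / 2 * Z w ^+ 4 <=
  2^-1 * (Z w ^+ 2 * expR (s * Z w) + Z w ^+ 2 * expR (- s * Z w)).
Proof.
have := cosh_ge (s * Z w); rewrite mulNr.
set a := expR _; set b := expR _ => h.
have z2 := sqr_ge0 (Z w).
have := ler_wpM2l z2 h.
have -> : Z w ^+ 4 = Z w ^+ 2 * Z w ^+ 2 by rewrite -exprD.
rewrite exprMn; lra.
Qed.

Lemma std_normal_intg4 : intg P (fun w => Z w ^+ 4).
Proof.
apply: (@intg_dom _ _ _ P _
  (fun w => Z w ^+ 2 * expR (1 * Z w) + Z w ^+ 2 * expR (- 1 * Z w))).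
- exact: measurable_funX.
- by apply: intgD; exact: (sqexpZ _).1.
- move=> w; have -> : Z w ^+ 4 = (Z w ^+ 2) ^+ 2 by rewrite -exprM.
  rewrite ger0_norm ?sqr_ge0//.
  have := sqcosh_ge 1 w; have := sqr_ge0 (Z w).
  have -> : Z w ^+ 4 = (Z w ^+ 2) ^+ 2 by rewrite -exprM.
  lra.
Qed.

Lemma std_normal_moment4 : Ex P (fun w => Z w ^+ 4) <= 3.
Proof.
apply: le_expR_limit => // u u0 _.
have [s0 sE] := sqrtE u0; set s := Num.sqrt _ in s0 sE.
have [i1 e1] := sqexpZ s; have [i2 e2] := sqexpZ (- s).
have i := std_normal_intg2; have i4 := std_normal_intg4.
have iZ : intg P Z.
  apply: (@intg_dom _ _ _ P _ (fun w => 1 + Z w ^+ 2)) => //.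
    by apply: intgD => //; exact: intg_cst.
  by move=> w; rewrite ler_norml; apply/andP; split; nra.
have S (r : R) : Ex P (fun w => (Z w + r) ^+ 2) =
    Ex P (fun w => Z w ^+ 2) + (2 * r) * Ex P Z + r ^+ 2.
  have -> : (fun w => (Z w + r) ^+ 2) =
     (fun w => (Z w ^+ 2 + (2 * r) * Z w) + r ^+ 2).
    by apply/funext => w; ring.
  rewrite ExD; [|by apply: intgD => //; exact: intgZ|exact: intg_cst].
  rewrite Ex_cst ExD//; last exact: intgZ.
  by rewrite ExZ.
have : Ex P (fun w => Z w ^+ 2 + u * Z w ^+ 4) <=
  Ex P (fun w => 2^-1 * (Z w ^+ 2 * expR (s * Z w) + Z w ^+ 2 * expR (- s * Z w))).
  apply: Ex_le.
  - by apply: intgD => //; exact: intgZ.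
  - by apply: intgZ; exact: intgD.
  - by move=> w; rewrite -sE; exact: sqcosh_ge.
rewrite ExD ?ExZ ?ExD ?e1 ?e2//; [|exact: intgD|exact: intgZ].
rewrite !S sqrrN sE => h.
have h2 := expR_sub1_le u.
have h3 := std_normal_moment2; set m := Ex P (fun w => Z w ^+ 2) in h h3.
have m0 : 0 <= m by apply: Ex_ge0 => w; rewrite sqr_ge0.
have s2 : s ^+ 2 = 2 * u by rewrite -sE; lra.
have e0 := expR_gt0 u.
rewrite s2 in h.
rewrite -(ler_pM2l u0).
have k1 : (expR u - 1) * m <= u * expR u.
  apply: le_trans (ler_wpM2r m0 h2) _.
  by rewrite ler_piMr// mulr_ge0 ?ltW.
lra.
Qed.

End NormalMoments.

(** * Standard Gaussian vectors *)

Section BorelFunctions.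
Context {R : realType} {n : nat}.
Implicit Types phi psi : 'cV[R]_n -> R.

(* [phi] is Borel, expressed through random vectors so that no sigma-algebra
   on ['cV[R]_n] is needed. *)
Definition borelv phi := forall (d1 : measure_display) (T : measurableType d1)
  (Y : T -> 'cV[R]_n), mmx Y -> measurable_fun setT (fun w => phi (Y w)).

Lemma borelv_cst c : borelv (fun=> c).
Proof. by move=> d1 T Y _; exact: measurable_cst. Qed.

Lemma borelv_entry i : borelv (fun x => x i 0).
Proof. by move=> d1 T Y; apply. Qed.

Lemma borelvD phi psi : borelv phi -> borelv psi -> borelv (fun x => phi x + psi x).
Proof.
by move=> h1 h2 d1 T Y mY; apply: measurable_funD; [exact: h1|exact: h2].
Qed.

Lemma borelvM phi psi : borelv phi -> borelv psi -> borelv (fun x => phi x * psi x).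
Proof.
by move=> h1 h2 d1 T Y mY; apply: measurable_funM; [exact: h1|exact: h2].
Qed.

Lemma borelv_expR phi : borelv phi -> borelv (fun x => expR (phi x)).
Proof. by move=> h1 d1 T Y mY; apply: measurableT_comp => //; exact: h1. Qed.

Lemma borelv_norm phi : borelv phi -> borelv (fun x => `|phi x|).
Proof. by move=> h1 d1 T Y mY; apply: measurableT_comp => //; exact: h1. Qed.

Lemma borelv_sum (J : Type) (r : seq J) (F : J -> 'cV[R]_n -> R) :
  (forall j, borelv (F j)) -> borelv (fun x => \sum_(j <- r) F j x).
Proof.
by move=> h d1 T Y mY; apply: measurable_sumr => j; exact: h.
Qed.

Lemma borelv_dotv a : borelv (dotv a).
Proof. by move=> d1 T Y mY; apply: measurable_dotv => //; exact: mmx_cst. Qed.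

Lemma borelv_dotvv : borelv (fun x => dotv x x).
Proof. by move=> d1 T Y mY; exact: measurable_dotv. Qed.

Lemma borelv_lipschitz phi L :
  (forall x y, `|phi x - phi y| <= L * enorm (x - y)) -> borelv phi.
Proof. by move=> h d1 T Y mY; exact: (measurable_lipschitz h mY). Qed.

Lemma borelv_shift phi a : borelv phi -> borelv (fun x => phi (x + a)).
Proof.
by move=> h d1 T Y mY; apply: h; apply: mmxD => //; exact: mmx_cst.
Qed.

Definition updv (x : 'cV[R]_n) (l : 'I_n) (r : R) : 'cV[R]_n :=
  \col_i if i == l then r else x i 0.

Lemma updv_id x l : updv x l (x l 0) = x.
Proof.
by apply/matrixP => i j; rewrite ord1 mxE; case: eqVneq => // ->.
Qed.

Lemma mmx_updv d1 (T : measurableType d1) (Y : T -> 'cV[R]_n) l (r : T -> R) :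
  (forall i, i != l -> measurable_fun setT (fun w => Y w i 0)) ->
  measurable_fun setT r ->
  mmx (fun w => updv (Y w) l (r w)).
Proof.
move=> mY mr i j; rewrite ord1; under eq_fun do rewrite mxE.
by case: eqVneq => // il; exact: mY.
Qed.

End BorelFunctions.

Section GaussianVector.
Context {R : realType} {d0 : measure_display} {Om : measurableType d0}.
Variable P : probability Om R.
Variables (I : eqType) (X : I -> Om -> R).
Hypothesis indX : mutually_independent P X.
Hypothesis nX : forall i, std_normal P (X i).
Variables (n : nat) (idx : 'I_n -> I).
Hypothesis idx_inj : injective idx.

Let mX i : measurable_fun setT (X i). Proof. by have [] := nX i. Qed.

Definition gvec (w : Om) : 'cV[R]_n := \col_l X (idx l) w.
Local Notation Z := gvec.

Lemma mmx_gvec : mmx Z.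
Proof. by move=> i j; under eq_fun do rewrite mxE; exact: mX. Qed.

Lemma gvec_coord_change (T1 rho : R -> R) (l : 'I_n) (psi : 'cV[R]_n -> R) :
  measurable_fun setT T1 -> measurable_fun setT rho -> (forall x, 0 <= rho x) ->
  (forall f : R -> R, measurable_fun setT f -> (forall x, 0 <= f x) ->
    (\int[P]_w (f (T1 (X (idx l) w)))%:E =
     \int[P]_w (f (X (idx l) w) * rho (X (idx l) w))%:E)%E) ->
  borelv psi -> (forall x, 0 <= psi x) ->
  (\int[P]_w (psi (updv (Z w) l (T1 (Z w l 0))))%:E =
   \int[P]_w (psi (Z w) * rho (Z w l 0))%:E)%E.
Proof.
move=> mT1 mrho rho0 h bpsi psi0.
pose A : set I := [set i | i != idx l]; pose B : set I := [set idx l].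
have AB : A `&` B = set0.
  by apply/seteqP; split => // i [/= /eqP iN iE]; exact: iN iE.
have mZA i : i != l -> measurable_fun setT
    (fun p : coord_space X A * coord_space X B => Z p.1 i 0).
  move=> il; under eq_fun do rewrite mxE.
  apply: (measurableT_comp _ measurable_fst).
  by apply: coord_space_measurable => //=; rewrite /A/= (inj_eq idx_inj).
have mXB : measurable_fun setT
    (fun p : coord_space X A * coord_space X B => X (idx l) p.2).
  by apply: (measurableT_comp _ measurable_snd); exact: coord_space_measurable.
pose h1 w w' := (psi (updv (Z w) l (T1 (X (idx l) w'))))%:E.
pose h2 w w' := (psi (updv (Z w) l (X (idx l) w')) * rho (X (idx l) w'))%:E.
have E1 : (\int[P]_w h1 w w = \int[P]_w \int[P]_w' h1 w w')%E.
  apply: (decouple indX mX AB) => [|w w']; last by rewrite lee_fin.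
  apply/measurable_EFinP; apply: bpsi; apply: mmx_updv => //.
  exact: (measurableT_comp mT1).
have E2 : (\int[P]_w h2 w w = \int[P]_w \int[P]_w' h2 w w')%E.
  apply: (decouple indX mX AB) => [|w w']; last by rewrite lee_fin mulr_ge0.
  apply/measurable_EFinP; apply: measurable_funM; last exact: (measurableT_comp mrho).
  by apply: bpsi; exact: mmx_updv.
transitivity (\int[P]_w h1 w w)%E.
  by apply: eq_integral => w _; rewrite /h1 mxE.
transitivity (\int[P]_w h2 w w)%E; last first.
  apply: eq_integral => w _; rewrite /h2.
  have -> : X (idx l) w = Z w l 0 by rewrite mxE.
  by rewrite updv_id.
rewrite E1 E2; apply: eq_integral => w _.
apply: (h (fun x => psi (updv (Z w) l x))) => //.
apply: (bpsi _ _ (fun x : R => updv (Z w) l x)).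
apply: (@mmx_updv _ _ _ _ (fun=> Z w)) => //.
Qed.

Let shv (a : 'cV[R]_n) (s : seq 'I_n) : 'cV[R]_n :=
  \col_i if i \in s then a i 0 else 0.

Let gvec_shift_seq (a : 'cV[R]_n) (s : seq 'I_n) : uniq s ->
  forall psi, borelv psi -> (forall x, 0 <= psi x) ->
  (\int[P]_w (psi (Z w + shv a s))%:E =
   \int[P]_w (psi (Z w) *
      expR (\sum_(l <- s) (a l 0 * Z w l 0 - a l 0 ^+ 2 / 2)))%:E)%E.
Proof.
elim: s => [_|l s IH /= /andP[ls us]] psi bpsi psi0.
  apply: eq_integral => w _; rewrite big_nil expR0 mulr1; congr (psi _)%:E.
  by apply/matrixP => i j; rewrite ord1 !mxE addr0.
pose psi' x := psi (updv x l (x l 0 + a l 0)).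
have bpsi' : borelv psi'.
  move=> d1 T Y mY; apply: bpsi; apply: mmx_updv => [i _|]; first exact: mY.
  by apply: measurable_funD => //; exact: mY.
transitivity (\int[P]_w (psi' (Z w + shv a s))%:E)%E.
  apply: eq_integral => w _; congr (psi _)%:E; apply/matrixP => i j.
  rewrite ord1 !mxE inE; case: eqVneq => [->|il] /=; last by [].
  by rewrite (negPf ls) addr0.
rewrite IH//; last by move=> x; exact: psi0.
pose psi2 x := psi x * expR (\sum_(m <- s) (a m 0 * x m 0 - a m 0 ^+ 2 / 2)).
have bpsi2 : borelv psi2.
  apply: borelvM => //; apply: borelv_expR; apply: borelv_sum => m.
  apply: borelvD; last exact: borelv_cst.
  by apply: borelvM; [exact: borelv_cst|exact: borelv_entry].
have psi20 x : 0 <= psi2 x by rewrite mulr_ge0 ?expR_ge0.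
pose rho x := expR (a l 0 * x - a l 0 ^+ 2 / 2).
have mrho : measurable_fun setT rho.
  have m1 : measurable_fun setT (fun x : R => a l 0 * x).
    by apply: (@measurable_funM _ _ R setT (cst (a l 0)) id).
  have m2 : measurable_fun setT (fun x : R => a l 0 * x - a l 0 ^+ 2 / 2).
    exact: measurable_funB.
  exact: (measurableT_comp (@measurable_expR R) m2).
have mT1 : measurable_fun setT (fun x : R => x + a l 0) by exact: measurable_funD.
have := @gvec_coord_change (fun x => x + a l 0) rho l psi2 mT1 mrho
  (fun x => expR_ge0 _) (fun f mf f0 => std_normal_shift (nX (idx l)) (a l 0) mf f0)
  bpsi2 psi20.
transitivity (\int[P]_w (psi2 (updv (Z w) l (Z w l 0 + a l 0)))%:E)%E.
  apply: eq_integral => w _; rewrite /psi2 /psi'; congr (_ * expR _)%:E.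
  apply: eq_big_seq => m ms; rewrite !mxE; case: eqVneq => // ml.
  by move: ls; rewrite -ml ms.
rewrite H; apply: eq_integral => w _; rewrite /psi2 -mulrA -expRD big_cons.
by rewrite [X in expR X]addrC.
Qed.

Lemma gvec_shift (a : 'cV[R]_n) psi : borelv psi -> (forall x, 0 <= psi x) ->
  (\int[P]_w (psi (Z w + a))%:E =
   \int[P]_w (psi (Z w) * expR (dotv a (Z w) - dotv a a / 2))%:E)%E.
Proof.
move=> bpsi psi0; have := gvec_shift_seq a (enum_uniq 'I_n) bpsi psi0.
have -> : shv a (enum 'I_n) = a.
  by apply/matrixP => i j; rewrite ord1 mxE mem_enum.
move=> ->; apply: eq_integral => w _; congr (_ * expR _)%:E.
rewrite big_enum big_split/= sumrN; congr (_ - _).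
by rewrite /dotv mulr_suml; apply: eq_bigr => i _; rewrite expr2.
Qed.

Let flipv (s : seq 'I_n) (x : 'cV[R]_n) : 'cV[R]_n :=
  \col_i if i \in s then - x i 0 else x i 0.

Let gvec_flip_seq (s : seq 'I_n) : uniq s ->
  forall psi, borelv psi -> (forall x, 0 <= psi x) ->
  (\int[P]_w (psi (flipv s (Z w)))%:E = \int[P]_w (psi (Z w))%:E)%E.
Proof.
elim: s => [_|l s IH /= /andP[ls us]] psi bpsi psi0.
  apply: eq_integral => w _; congr (psi _)%:E.
  by apply/matrixP => i j; rewrite ord1 !mxE.
pose psi' x := psi (updv x l (- x l 0)).
have bpsi' : borelv psi'.
  move=> d1 T Y mY; apply: bpsi; apply: mmx_updv => [i _|]; first exact: mY.
  by apply: measurable_funN; exact: mY.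
transitivity (\int[P]_w (psi' (flipv s (Z w)))%:E)%E.
  apply: eq_integral => w _; congr (psi _)%:E; apply/matrixP => i j.
  rewrite ord1 !mxE inE; case: eqVneq => [->|il] /=; last by [].
  by rewrite (negPf ls).
rewrite IH//; last by move=> x; exact: psi0.
have mopp : measurable_fun setT (fun x : R => - x) by exact: oppr_measurable.
have := @gvec_coord_change (fun x => - x) (fun=> 1) l psi mopp
  (measurable_cst _) (fun=> ler01) _ bpsi psi0.
move=> ->; first by apply: eq_integral => w _; rewrite mulr1.
move=> f mf f0; rewrite (std_normal_flip (nX (idx l)) mf f0).
by apply: eq_integral => w _; rewrite mulr1.
Qed.

Lemma gvec_flip psi : borelv psi -> (forall x, 0 <= psi x) ->
  (\int[P]_w (psi (- Z w))%:E = \int[P]_w (psi (Z w))%:E)%E.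
Proof.
move=> bpsi psi0; rewrite -(gvec_flip_seq (enum_uniq 'I_n) bpsi psi0).
apply: eq_integral => w _; congr (psi _)%:E.
by apply/matrixP => i j; rewrite ord1 !mxE mem_enum.
Qed.

Lemma Ex_gvec_flip psi : borelv psi -> intg P (fun w => psi (Z w)) ->
  intg P (fun w => psi (- Z w)) /\
  Ex P (fun w => psi (- Z w)) = Ex P (fun w => psi (Z w)).
Proof.
move=> bpsi ipsi.
have mpsi w : measurable_fun setT (fun w => psi (- Z w)).
  apply: bpsi => i j; under eq_fun do rewrite mxE.
  by apply: measurable_funN; exact: mmx_gvec.
have mapsi := borelv_norm bpsi.
have iapsi : intg P (fun w => `|psi (Z w)|).
  apply: (@intg_dom _ _ _ P _ (fun w => `|psi (Z w)|)); last first.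
  - by move=> w; rewrite normr_id.
  - exact: (integrable_norm ipsi).
  - by apply: mapsi; exact: mmx_gvec.
have mN : mmx (fun w => - Z w).
  by move=> i j; under eq_fun do rewrite mxE; apply: measurable_funN; exact: mmx_gvec.
have [i1 e1] : intg P (fun w => `|psi (- Z w)|) /\
    Ex P (fun w => `|psi (- Z w)|) = Ex P (fun w => `|psi (Z w)|).
  apply: Ex_transfer => //; first exact: mapsi.
  exact: (@gvec_flip (fun x => `|psi x|)).
have bs := borelvD bpsi mapsi.
have s0 x : 0 <= psi x + `|psi x|.
  by have := ler_norm (- psi x); rewrite normrN; lra.
have [i2 e2] : intg P (fun w => psi (- Z w) + `|psi (- Z w)|) /\
    Ex P (fun w => psi (- Z w) + `|psi (- Z w)|) =
    Ex P (fun w => psi (Z w) + `|psi (Z w)|).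
  apply: Ex_transfer => //.
  - exact: bs.
  - exact: (@gvec_flip (fun x => psi x + `|psi x|)).
  - exact: intgD.
have i3 : intg P (fun w => psi (- Z w)).
  have := intgB i2 i1; congr intg; apply/funext => w; exact: addrK.
split => //; move: e2; rewrite !ExD// e1; lra.
Qed.

Lemma Ex_gvec_odd psi : borelv psi -> (forall x, psi (- x) = - psi x) ->
  intg P (fun w => psi (Z w)) -> Ex P (fun w => psi (Z w)) = 0.
Proof.
move=> bpsi odd ipsi; have [_] := Ex_gvec_flip bpsi ipsi.
under eq_fun do rewrite odd; rewrite ExN//; lra.
Qed.

Lemma gvec_moment22 l m : l != m ->
  intg P (fun w => Z w l 0 ^+ 2 * Z w m 0 ^+ 2) /\
  Ex P (fun w => Z w l 0 ^+ 2 * Z w m 0 ^+ 2) <= 1.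
Proof.
move=> lm; have i k : intg P (fun w => X (idx k) w ^+ 2) := std_normal_intg2 (nX _).
have m2 k : Ex P (fun w => X (idx k) w ^+ 2) <= 1 := std_normal_moment2 (nX _).
have AB : [set idx l] `&` [set idx m] = set0.
  apply/seteqP; split => // i' [/= -> /idx_inj E].
  by move: lm; rewrite E eqxx.
have ZE w : Z w l 0 ^+ 2 * Z w m 0 ^+ 2 = X (idx l) w ^+ 2 * X (idx m) w ^+ 2.
  by rewrite !mxE.
under eq_fun do rewrite ZE.
have : (\int[P]_w (X (idx l) w ^+ 2 * X (idx m) w ^+ 2)%:E =
    \int[P]_w \int[P]_w' (X (idx l) w ^+ 2 * X (idx m) w' ^+ 2)%:E)%E.
  apply: (decouple indX mX AB); last by move=> w w'; rewrite lee_fin mulr_ge0 ?sqr_ge0.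
  apply/measurable_EFinP; apply: measurable_funM; apply: measurable_funX.
    by apply: (measurableT_comp _ measurable_fst); exact: coord_space_measurable.
  by apply: (measurableT_comp _ measurable_snd); exact: coord_space_measurable.
rewrite [RHS](_ : _ = \int[P]_w (Ex P (fun w' => X (idx m) w' ^+ 2) *
    X (idx l) w ^+ 2)%:E)%E; last first.
  apply: eq_integral => w _; rewrite [LHS]ExE; last exact: intgZ.
  by rewrite ExZ// mulrC.
move=> E; have [h1 h2] : intg P (fun w => X (idx l) w ^+ 2 * X (idx m) w ^+ 2) /\
   Ex P (fun w => X (idx l) w ^+ 2 * X (idx m) w ^+ 2) =
   Ex P (fun w => Ex P (fun w' => X (idx m) w' ^+ 2) * X (idx l) w ^+ 2).
  apply: Ex_transfer E _ => //.
  - by apply: measurable_funM; exact: measurable_funX.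
  - by move=> w; rewrite mulr_ge0 ?sqr_ge0.
  - exact: intgZ.
split => //; rewrite h2 ExZ// mulr_ile1//; apply: Ex_ge0 => w; exact: sqr_ge0.
Qed.

Lemma gvec_moment2 : intg P (fun w => dotv (Z w) (Z w)) /\
  Ex P (fun w => dotv (Z w) (Z w)) <= n%:R.
Proof.
have i k : intg P (fun w => Z w k 0 * Z w k 0).
  have := std_normal_intg2 (nX (idx k)); congr intg; apply/funext => w.
  by rewrite mxE expr2.
split; first by apply: intg_sum.
rewrite /dotv Ex_sum//.
apply: le_trans (_ : \sum_(k < n) 1 <= _); last by rewrite sumr_const card_ord.
apply: ler_sum => k _; have := std_normal_moment2 (nX (idx k)).
by congr (Ex P _ <= _); apply/funext => w; rewrite mxE expr2.
Qed.

Lemma gvec_moment4 : intg P (fun w => dotv (Z w) (Z w) ^+ 2) /\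
  Ex P (fun w => dotv (Z w) (Z w) ^+ 2) <= (n%:R + 1) ^+ 2.
Proof.
pose c (l m : 'I_n) : R := if l == m then 3 else 1.
have h l m : intg P (fun w => Z w l 0 ^+ 2 * Z w m 0 ^+ 2) /\
    Ex P (fun w => Z w l 0 ^+ 2 * Z w m 0 ^+ 2) <= c l m.
  rewrite /c; case: eqVneq => [<-|lm]; last exact: gvec_moment22.
  have E : (fun w => Z w l 0 ^+ 2 * Z w l 0 ^+ 2) = (fun w => X (idx l) w ^+ 4).
    by apply/funext => w; rewrite mxE -exprD.
  rewrite E; split; first exact: std_normal_intg4.
  exact: std_normal_moment4.
have E : (fun w => dotv (Z w) (Z w) ^+ 2) =
    (fun w => \sum_l \sum_m Z w l 0 ^+ 2 * Z w m 0 ^+ 2).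
  apply/funext => w; rewrite expr2 {1}/dotv mulr_suml.
  apply: eq_bigr => l _; rewrite /dotv mulr_sumr; apply: eq_bigr => m _.
  by rewrite !expr2.
have is1 l : intg P (fun w => \sum_m Z w l 0 ^+ 2 * Z w m 0 ^+ 2).
  by apply: intg_sum => m _; exact: (h l m).1.
rewrite E; split; first by apply: intg_sum.
rewrite Ex_sum//.
apply: le_trans (_ : \sum_l \sum_m c l m <= _).
  apply: ler_sum => l _; rewrite Ex_sum => [|m _]; last exact: (h l m).1.
  by apply: ler_sum => m _; exact: (h l m).2.
have -> : \sum_l \sum_m c l m = \sum_(l < n) (n%:R + 2).
  apply: eq_bigr => l _; rewrite (bigD1 l)//= /c eqxx.
  have -> : \sum_(m < n | m != l) (if l == m then 3 else 1) = \sum_(m < n | m != l) 1 :> R.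
    by apply: eq_bigr => m ml; rewrite eq_sym (negPf ml).
  have : \sum_(m < n) 1 = n%:R :> R by rewrite sumr_const card_ord.
  by rewrite (bigD1 l)//=; lra.
rewrite sumr_const card_ord -mulr_natr; lra.
Qed.

Lemma gvec_intg_dom psi c : borelv psi ->
  (forall x, `|psi x| <= c * (1 + dotv x x ^+ 2)) -> intg P (fun w => psi (Z w)).
Proof.
move=> bpsi hc.
apply: (@intg_dom _ _ _ P _ (fun w => c * (1 + dotv (Z w) (Z w) ^+ 2))) => //.
- exact: bpsi mmx_gvec.
- by apply: intgZ; apply: intgD; [exact: intg_cst|exact: gvec_moment4.1].
Qed.

Section ConvexLipschitz.
Variables (phi : 'cV[R]_n -> R) (M : R).
Hypothesis phiC : forall x y lam, 0 <= lam <= 1 ->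
  phi (lam *: x + (1 - lam) *: y) <= lam * phi x + (1 - lam) * phi y.
Hypothesis phiL : forall x y, `|phi x - phi y| <= M * enorm (x - y).
Hypothesis M0 : 0 <= M.

Let enorm_le (x : 'cV[R]_n) : enorm x <= 1 + dotv x x ^+ 2.
Proof.
rewrite -enorm_sqr; move: (enorm x) => r.
have := sqr_ge0 (r - 1); have := sqr_ge0 (r ^+ 2 - 1).
have := sqr_ge0 (r ^+ 2); lra.
Qed.

Let dotvv_le (x : 'cV[R]_n) : dotv x x <= 1 + dotv x x ^+ 2.
Proof. by move: (dotv x x) => r; nra. Qed.

Let phi_abs x : `|phi x| <= `|phi 0| + M * enorm x.
Proof.
have := phiL x 0; rewrite subr0 => h.
have -> : phi x = phi 0 + (phi x - phi 0) by rewrite addrC subrK.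
by rewrite (le_trans (ler_normD _ _))// lerD2l.
Qed.

Let bphi : borelv phi. Proof. exact: (borelv_lipschitz phiL). Qed.

Lemma gvec_intg_phi a : intg P (fun w => phi (Z w + a)).
Proof.
apply: (@gvec_intg_dom (fun x => phi (x + a)) (`|phi 0| + M * enorm a + M)).
  exact: borelv_shift.
move=> x; apply: le_trans (phi_abs _) _.
have h1 := enormD x a; have h2 := enorm_le x; have h3 := sqr_ge0 (dotv x x).
have h4 := ler_wpM2l M0 h1; have h5 := ler_wpM2l M0 h2.
have h6 : 0 <= (`|phi 0| + M * enorm a) * dotv x x ^+ 2.
  apply: mulr_ge0 => //; apply: addr_ge0 => //; apply: mulr_ge0 => //.
  exact: enorm_ge0.
lra.
Qed.

Lemma gvec_intg_phi0 : intg P (fun w => phi (Z w)).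
Proof.
by have := gvec_intg_phi 0; congr intg; apply/funext => w; rewrite addr0.
Qed.

Lemma gvec_intg_dotv a : intg P (fun w => dotv a (Z w)).
Proof.
apply: (@gvec_intg_dom (dotv a) (enorm a)); first exact: borelv_dotv.
move=> x; rewrite (le_trans (dotv_le_enorm _ _))// ler_wpM2l ?enorm_ge0//.
Qed.

Lemma gvec_intg_dotv_phi a : intg P (fun w => dotv a (Z w) * phi (Z w)).
Proof.
apply: (@gvec_intg_dom (fun x => dotv a x * phi x) (enorm a * (`|phi 0| + M))).
  by apply: borelvM => //; exact: borelv_dotv.
move=> x; rewrite normrM.
apply: le_trans (ler_pM _ _ (dotv_le_enorm a x) (phi_abs x)) _ => //.
have h2 := enorm_le x; have h3 := dotvv_le x; rewrite -enorm_sqr in h3 *.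
have e0 := enorm_ge0 x; have a0 := enorm_ge0 a.
rewrite -!mulrA ler_wpM2l//.
have k1 := ler_wpM2l (normr_ge0 (phi 0)) h2; have k2 := ler_wpM2l M0 h3.
rewrite -enorm_sqr in k1.
lra.
Qed.

Lemma gvec_intg_dotv_sqr a : intg P (fun w => dotv a (Z w) * dotv (Z w) (Z w)).
Proof.
apply: (@gvec_intg_dom (fun x => dotv a x * dotv x x) (enorm a)).
  by apply: borelvM; [exact: borelv_dotv|exact: borelv_dotvv].
move=> x; rewrite normrM.
apply: le_trans (ler_wpM2r _ (dotv_le_enorm a x)) _ => //.
rewrite -mulrA ler_wpM2l ?enorm_ge0// ger0_norm ?dotvv_ge0// -enorm_sqr.
by move: (enorm x) (enorm_ge0 x) => r r0; nra.
Qed.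

Lemma gvec_jensen : phi 0 <= Ex P (fun w => phi (Z w)).
Proof.
have i := gvec_intg_phi0; have [i' e'] := Ex_gvec_flip bphi i.
have : Ex P (fun=> phi 0) <= Ex P (fun w => 2^-1 * (phi (Z w) + phi (- Z w))).
  apply: Ex_le; [exact: intg_cst|by apply: intgZ; exact: intgD|].
  move=> w; have := @phiC (Z w) (- Z w) 2^-1 ltac:(lra).
  have -> : 1 - 2^-1 = 2^-1 :> R by lra.
  by rewrite scalerN subrr; lra.
rewrite Ex_cst ExZ ?ExD ?e'//; last exact: intgD.
lra.
Qed.

Section NonnegPerturbation.
Variables (c C : R) (a : 'cV[R]_n).
Hypothesis c0 : 0 < c.
Let psi x := phi x + (c * dotv x x + C).
Hypothesis psi0 : forall x, 0 <= psi x.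

Let bpsi : borelv psi.
Proof.
apply: borelvD => //; apply: borelvD; last exact: borelv_cst.
by apply: borelvM; [exact: borelv_cst|exact: borelv_dotvv].
Qed.

Let psiC x s : 0 <= s <= 1 -> psi (x + s *: a) <= (1 - s) * psi x + s * psi (x + a).
Proof.
move=> s01; have /andP[s0 s1] := s01.
have := phiC (x + a) x s01.
have -> : s *: (x + a) + (1 - s) *: x = x + s *: a.
  by apply/matrixP => i' j'; rewrite !mxE; ring.
have : dotv (x + s *: a) (x + s *: a) <=
    (1 - s) * dotv x x + s * dotv (x + a) (x + a).
  rewrite !dotv_lin (dotvC a x).
  have := dotvv_ge0 a; move: (dotv a a) (dotv x a) (dotv x x) => u v t u0.
  have : 0 <= (1 - s) * s * u by rewrite !mulr_ge0// subr_ge0.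
  lra.
move=> h1 h2; rewrite /psi; have := ler_wpM2l (ltW c0) h1.
lra.
Qed.

Let dotv_shift_intg b : intg P (fun w => c * dotv (Z w + b) (Z w + b) + C).
Proof.
have E : (fun w => c * dotv (Z w + b) (Z w + b) + C) =
   (fun w => c * (dotv (Z w) (Z w) + 2 * dotv b (Z w)) + (c * dotv b b + C)).
  by apply/funext => w; rewrite !dotv_lin (dotvC (Z w) b); ring.
rewrite E; apply: intgD; last exact: intg_cst.
apply: intgZ; apply: intgD; first exact: gvec_moment2.1.
by apply: intgZ; exact: gvec_intg_dotv.
Qed.

Let ipsi b : intg P (fun w => psi (Z w + b)).
Proof. by apply: intgD; [exact: gvec_intg_phi|exact: dotv_shift_intg]. Qed.

Let ipsi0 : intg P (fun w => psi (Z w)).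
Proof. by have := ipsi 0; congr intg; apply/funext => w; rewrite addr0. Qed.

Let iapsi : intg P (fun w => dotv a (Z w) * psi (Z w)).
Proof.
have -> : (fun w => dotv a (Z w) * psi (Z w)) = (fun w => dotv a (Z w) * phi (Z w)
   + (c * (dotv a (Z w) * dotv (Z w) (Z w)) + C * dotv a (Z w))).
  by apply/funext => w; rewrite /psi; ring.
apply: intgD; first exact: gvec_intg_dotv_phi.
by apply: intgD; apply: intgZ; [exact: gvec_intg_dotv_sqr|exact: gvec_intg_dotv].
Qed.

Let shift_step s : 0 < s -> s <= 1 ->
  Ex P (fun w => dotv a (Z w) * psi (Z w)) <=
  Ex P (fun w => psi (Z w + a)) - Ex P (fun w => psi (Z w))
    + s * (dotv a a / 2 * Ex P (fun w => psi (Z w))).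
Proof.
move=> s0 s1.
have := gvec_shift (s *: a) bpsi psi0.
rewrite ExE => [h|]; last exact: ipsi.
pose D w := s * dotv a (Z w) - s ^+ 2 * dotv a a / 2.
have i : intg P (fun w => psi (Z w) * expR (D w)).
  apply: intg_ge0.
  - apply: measurable_funM; first exact: bpsi mmx_gvec.
    apply: measurableT_comp => //; apply: measurable_funB => //.
    by apply: measurable_funM => //; exact: (borelv_dotv _ mmx_gvec).
  - by move=> w; rewrite mulr_ge0// expR_ge0.
  - have E : (\int[P]_w (psi (Z w) * expR (D w))%:E)%E =
       (Ex P (fun w => psi (Z w + s *: a)))%:E.
      rewrite h; apply: eq_integral => w _; congr (_ * expR _)%:E.
      by rewrite /D !dotv_lin; ring.
    by rewrite E ltry.
have E : Ex P (fun w => psi (Z w) * expR (D w)) = Ex P (fun w => psi (Z w + s *: a)).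
  apply: EFin_inj; rewrite -ExE// h; apply: eq_integral => w _.
  by congr (_ * expR _)%:E; rewrite /D !dotv_lin; ring.
have h1 : Ex P (fun w => (1 - s ^+ 2 * dotv a a / 2) * psi (Z w) +
    s * (dotv a (Z w) * psi (Z w))) <= Ex P (fun w => psi (Z w) * expR (D w)).
  apply: Ex_le => //; first by apply: intgD; exact: intgZ.
  move=> w; have := ler_wpM2l (psi0 (Z w)) (expR_ge1Dx (D w)).
  by apply: le_trans; rewrite /D; lra.
have h2 : Ex P (fun w => psi (Z w + s *: a)) <=
    Ex P (fun w => (1 - s) * psi (Z w) + s * psi (Z w + a)).
  apply: Ex_le; [exact: ipsi|by apply: intgD; apply: intgZ => //; exact: ipsi|].
  by move=> w; apply: psiC; rewrite ltW.
have ia := ipsi a.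
have E1 : Ex P (fun w => (1 - s ^+ 2 * dotv a a / 2) * psi (Z w) +
    s * (dotv a (Z w) * psi (Z w))) = (1 - s ^+ 2 * dotv a a / 2) *
    Ex P (fun w => psi (Z w)) + s * Ex P (fun w => dotv a (Z w) * psi (Z w)).
  by rewrite -!ExZ// -ExD//; exact: intgZ.
have E2 : Ex P (fun w => (1 - s) * psi (Z w) + s * psi (Z w + a)) =
    (1 - s) * Ex P (fun w => psi (Z w)) + s * Ex P (fun w => psi (Z w + a)).
  by rewrite -!ExZ// -ExD//; exact: intgZ.
rewrite E1 E in h1; rewrite E2 in h2.
rewrite -(ler_pM2l s0); lra.
Qed.

Lemma gvec_convex_perturbed :
  Ex P (fun w => dotv a (Z w) * phi (Z w)) <=
  Ex P (fun w => phi (Z w + a)) - Ex P (fun w => phi (Z w)) + c * dotv a a.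
Proof.
have : Ex P (fun w => dotv a (Z w) * psi (Z w)) <=
  Ex P (fun w => psi (Z w + a)) - Ex P (fun w => psi (Z w)).
  set x := (X in X <= _); set y := (X in _ <= X).
  set k := dotv a a / 2 * Ex P (fun w => psi (Z w)).
  have k0 : 0 <= k.
    by rewrite mulr_ge0 ?divr_ge0 ?dotvv_ge0//; apply: Ex_ge0 => w; exact: psi0.
  apply/ler_addgt0Pr => e e0.
  pose s := Num.min 1 (e / (k + 1)).
  have s0 : 0 < s by rewrite lt_min ltr01 divr_gt0// ltr_wpDl.
  have s1 : s <= 1 by rewrite ge_min lexx.
  apply: le_trans (shift_step s0 s1) _; rewrite lerD2l -/k.
  have : s <= e / (k + 1) by rewrite ge_min lexx orbT.
  rewrite ler_pdivlMr ?ltr_wpDl//; nra.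
have o1 : Ex P (fun w => dotv a (Z w)) = 0.
  apply: Ex_gvec_odd; [exact: borelv_dotv|by move=> x; rewrite dotvNr|].
  exact: gvec_intg_dotv.
have o3 : Ex P (fun w => dotv a (Z w) * dotv (Z w) (Z w)) = 0.
  apply: (@Ex_gvec_odd (fun x => dotv a x * dotv x x)).
  - by apply: borelvM; [exact: borelv_dotv|exact: borelv_dotvv].
  - by move=> x; rewrite !dotv_lin; ring.
  - exact: gvec_intg_dotv_sqr.
have -> : (fun w => dotv a (Z w) * psi (Z w)) = (fun w => dotv a (Z w) * phi (Z w)
   + (c * (dotv a (Z w) * dotv (Z w) (Z w)) + C * dotv a (Z w))).
  by apply/funext => w; rewrite /psi; ring.
have i1 := gvec_intg_dotv a; have i3 := gvec_intg_dotv_sqr a.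
have ip := gvec_intg_dotv_phi a.
have i2 := gvec_moment2.1.
have ic3 := intgZ c i3; have iC1 := intgZ C i1; have i31 := intgD ic3 iC1.
rewrite (ExD ip i31) (ExD ic3 iC1) (ExZ c i3) (ExZ C i1) o1 o3.
have Ea : Ex P (fun w => psi (Z w + a)) = Ex P (fun w => phi (Z w + a)) +
   (c * Ex P (fun w => dotv (Z w) (Z w)) + (c * dotv a a + C)).
  rewrite ExD; [|exact: gvec_intg_phi|exact: dotv_shift_intg].
  congr (_ + _).
  have -> : (fun w => c * dotv (Z w + a) (Z w + a) + C) =
     (fun w => c * (dotv (Z w) (Z w) + 2 * dotv a (Z w)) + (c * dotv a a + C)).
    by apply/funext => w; rewrite !dotv_lin (dotvC (Z w) a); ring.
  have i2' : intg P (fun w => dotv (Z w) (Z w) + 2 * dotv a (Z w)).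
    by apply: intgD => //; exact: intgZ.
  have i1' := intgZ 2 i1.
  rewrite (ExD (intgZ c i2') (intg_cst P _)) Ex_cst (ExZ c i2') (ExD i2 i1').
  by rewrite (ExZ 2 i1) o1 mulr0 addr0.
have E0 : Ex P (fun w => psi (Z w)) = Ex P (fun w => phi (Z w)) +
   (c * Ex P (fun w => dotv (Z w) (Z w)) + C).
  have iC : intg P (fun=> C) by exact: intg_cst.
  have ic : intg P (fun w => c * dotv (Z w) (Z w)) by exact: intgZ.
  rewrite ExD; [|exact: gvec_intg_phi0|exact: intgD].
  by rewrite ExD// Ex_cst ExZ.
rewrite Ea E0; lra.
Qed.

End NonnegPerturbation.

(* The gradient of [a |-> E phi(Z + a)] at [0] is [E (phi(Z) Z)], and this map is
   convex.  Adding a small quadratic makes [phi] nonnegative, so that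
   [1 + y <= expR y] replaces a passage to the limit under the integral. *)
Lemma gvec_convex a :
  Ex P (fun w => dotv a (Z w) * phi (Z w)) <=
  Ex P (fun w => phi (Z w + a)) - Ex P (fun w => phi (Z w)).
Proof.
apply/ler_addgt0Pr => e e0.
pose c := e / (dotv a a + 1).
have a1 : 0 < dotv a a + 1 by rewrite ltr_wpDl ?dotvv_ge0.
have c0 : 0 < c by rewrite divr_gt0.
pose C := `|phi 0| + M ^+ 2 / (4 * c).
apply: le_trans (@gvec_convex_perturbed c C a c0 _) _.
  move=> x; have := phi_abs x; rewrite ler_norml => /andP[h _].
  have : M * enorm x <= c * dotv x x + M ^+ 2 / (4 * c).
    rewrite -enorm_sqr -subr_ge0.
    have -> : c * enorm x ^+ 2 + M ^+ 2 / (4 * c) - M * enorm x =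
      c * (enorm x - M / (2 * c)) ^+ 2 by field; lra.
    by rewrite mulr_ge0 ?sqr_ge0// ltW.
  by rewrite /C; lra.
rewrite lerD2l /c mulrAC ler_pdivrMr// ler_pM2l//; lra.
Qed.

End ConvexLipschitz.

End GaussianVector.

(** * One step of the algorithm *)

Section OneStep.
Context {R : realType} {d : nat}.
Implicit Types (Sig H P : 'M[R]_d) (x y : 'cV[R]_d).

Lemma psd_young P (r : R) x y : P^T = P -> psd P -> 0 < r ->
  qform P (x + y) <= (1 + r) * qform P x + (1 + r^-1) * qform P y.
Proof.
move=> sP pP r0; have := pP (r *: x + (- 1) *: y).
rewrite qform_sym_expand//.
have := qform_sym_expand x y 1 1 sP; rewrite !scale1r => ->.
move: (qform P x) (qform P y) (dotv x _) => a c b h.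
have : 0 <= r^-1 * (r ^+ 2 * a + 2 * (r * -1) * b + (- 1) ^+ 2 * c).
  by rewrite mulr_ge0// invr_ge0 ltW.
have -> : r^-1 * (r ^+ 2 * a + 2 * (r * -1) * b + (- 1) ^+ 2 * c) =
  r * a - 2 * b + r^-1 * c by field; rewrite gt_eqF.
clear -r0; lra.
Qed.

Lemma sqrtmx_qform Sig x : Sig^T = Sig -> posdef Sig ->
  qform Sig x = dotv (sqrtmx Sig *m x) (sqrtmx Sig *m x).
Proof.
move=> sS pS; have [s _ e _] := sqrtmxP sS pS.
by rewrite qformE -[in LHS]e -mulmxA dotv_sym.
Qed.

Lemma dotv_mul_le Sig lam x : Sig^T = Sig -> posdef Sig ->
  (forall y, qform Sig y <= lam * dotv y y) ->
  dotv (Sig *m x) (Sig *m x) <= lam * qform Sig x.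
Proof.
move=> sS pS hl; have [_ _ e _] := sqrtmxP sS pS.
rewrite [in leRHS]sqrtmx_qform// -[in leLHS]e -!mulmxA.
by rewrite -[leLHS]sqrtmx_qform.
Qed.

Lemma isqrtmx_mul Sig : Sig^T = Sig -> posdef Sig ->
  invmx (sqrtmx Sig) *m invmx (sqrtmx Sig) = invmx Sig.
Proof.
move=> sS pS; have [s _ e u] := sqrtmxP sS pS.
have uS := posdef_unit pS.
have : Sig *m (invmx (sqrtmx Sig) *m invmx (sqrtmx Sig)) = 1%:M.
  by rewrite -[X in X *m _]e mulmxA mulmxK// mulmxV.
by move=> /(congr1 (mulmx (invmx Sig))); rewrite mulKmx// mulmx1.
Qed.

Lemma isqrtmx_qform Sig x : Sig^T = Sig -> posdef Sig ->
  qform (invmx Sig) x =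
  dotv (invmx (sqrtmx Sig) *m x) (invmx (sqrtmx Sig) *m x).
Proof.
move=> sS pS; have [s _ e u] := sqrtmxP sS pS.
by rewrite qformE -isqrtmx_mul// -mulmxA dotv_sym//; exact: invmx_sym.
Qed.

Lemma precision_update Sig H (a e g nu : R) : Sig^T = Sig -> posdef Sig -> H^T = H ->
  0 < a -> 0 < nu ->
  loewner H (e *: 1%:M + g *: Sig) ->
  loewner (nu *: 1%:M) (invmx (sqrtmx Sig) *m H *m invmx (sqrtmx Sig)) ->
  let P := 1 *: invmx Sig + a *: (invmx (sqrtmx Sig) *m H *m invmx (sqrtmx Sig)) in
  [/\ P^T = P, posdef P,
    forall x, qform (invmx Sig) x + a * nu * dotv x x <= qform P x &
    forall x, qform P x <= (1 + a * e) * qform (invmx Sig) x + a * g * dotv x x].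
Proof.
move=> sS pS sH a0 nu0 /loewnerP hH /loewnerP hG; set G := _ *m H *m _ => P.
have [s _ E u] := sqrtmxP sS pS; set S := sqrtmx Sig in s E u G hG P *.
have sI := invmx_sym s.
have qG x : qform G x = qform H (invmx S *m x).
  by rewrite !qformE /G -!mulmxA dotv_sym.
have qP x : qform P x = qform (invmx Sig) x + a * qform G x.
  by rewrite /P scale1r qformD qformZ.
have lowP x : qform (invmx Sig) x + a * nu * dotv x x <= qform P x.
  rewrite qP lerD2l -mulrA ler_pM2l//.
  by have := hG x; rewrite qformZ qform1.
split => //.
- by rewrite /P /G scale1r linearD/= linearZ/= !trmx_mul sI sH invmx_sym// mulmxA.
- move=> x x0; apply: lt_le_trans (lowP x).
  by rewrite ltr_wpDr ?posdef_inv// mulr_ge0 ?mulr_ge0 ?dotvv_ge0 ?ltW.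
- move=> x; rewrite qP qG mulrDl mul1r -addrA lerD2l.
  have := hH (invmx S *m x); rewrite qformD !qformZ qform1 -isqrtmx_qform//.
  have -> : qform Sig (invmx S *m x) = dotv x x.
    by rewrite sqrtmx_qform// -/S mulKVmx.
  by move=> /(ler_wpM2l (ltW a0)); rewrite mulrDr !mulrA.
Qed.

Lemma mean_update Sig (mu ms v : 'cV[R]_d) (b g r lam : R) : Sig^T = Sig -> posdef Sig ->
  0 < b -> 0 < r -> 0 <= g -> (forall x, qform Sig x <= lam * dotv x x) ->
  b^-1 * qform (invmx Sig) (mu - b *: (Sig *m (g *: mu + v)) - ms) <=
  b^-1 * qform (invmx Sig) (mu - ms) - 2 * dotv v (mu - ms)
  - g * (dotv mu mu + dotv (mu - ms) (mu - ms) - dotv ms ms)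
  + b * ((1 + r) * (g ^+ 2 * (lam * dotv mu mu)) + (1 + r^-1) * qform Sig v).
Proof.
move=> sS pS b0 r0 g0 hl; have uS := posdef_unit pS.
set y := g *: mu + v.
have -> : mu - b *: (Sig *m y) - ms = 1 *: (mu - ms) + (- b) *: (Sig *m y).
  by rewrite scale1r scaleNr addrAC.
rewrite qform_sym_expand; last exact: invmx_sym.
rewrite mulKmx// (qformE (invmx Sig) (Sig *m y)) mulKmx// (dotvC (Sig *m y) y) -qformE.
have Y : qform Sig y <= (1 + r) * (g ^+ 2 * (lam * dotv mu mu)) +
    (1 + r^-1) * qform Sig v.
  apply: le_trans (psd_young _ _ sS (posdef_psd pS) r0) _.
  have -> : qform Sig (g *: mu) = g ^+ 2 * qform Sig mu.
    by rewrite !qformE -scalemxAr !dotv_lin; ring.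
  rewrite lerD2r ler_wpM2l//; first by rewrite addr_ge0// ltW.
  by rewrite ler_wpM2l ?sqr_ge0.
have DY : 2 * dotv (mu - ms) y = 2 * dotv v (mu - ms) +
   g * (dotv mu mu + dotv (mu - ms) (mu - ms) - dotv ms ms).
  rewrite /y !dotv_lin (dotvC ms mu) (dotvC v mu) (dotvC v ms); ring.
have := ler_wpM2l (ltW b0) Y; move: DY.
set Q := _ + (1 + _) * qform Sig v.
move: (qform Sig y) (dotv (mu - ms) y) (qform (invmx Sig) (mu - ms)) => A B C DY h.
have -> : b^-1 * (1 ^+ 2 * C + 2 * (1 * - b) * B + (- b) ^+ 2 * A) =
  b^-1 * C - 2 * B + b * A by field; rewrite gt_eqF.
clear -DY h; lra.
Qed.

Lemma dotv_sum_le m (F : 'I_m -> 'cV[R]_d) :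
  dotv (\sum_i F i) (\sum_i F i) <= m%:R * \sum_i dotv (F i) (F i).
Proof.
rewrite dotv_sumr; under eq_bigr do rewrite dotvC dotv_sumr.
apply: le_trans (_ : \sum_(i < m) \sum_(j < m)
   (2^-1 * dotv (F i) (F i) + 2^-1 * dotv (F j) (F j)) <= _).
  apply: ler_sum => i _; apply: ler_sum => j _.
  have := dotvv_ge0 (F i - F j); rewrite !dotv_lin (dotvC (F j)); lra.
set S := (X in _ <= _ * X).
have E i : \sum_(j < m) (2^-1 * dotv (F i) (F i) + 2^-1 * dotv (F j) (F j)) =
    m%:R * (2^-1 * dotv (F i) (F i)) + 2^-1 * S.
  by rewrite big_split/= sumr_const card_ord -[X in X + _]mulr_natl -mulr_sumr.
rewrite (eq_bigr _ (fun i _ => E i)) big_split/= -!mulr_sumr sumr_const card_ord.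
rewrite -/S -[S *+ m]mulr_natl; lra.
Qed.

End OneStep.

Section StepEstimates.
Context {R : realType} {d K N : nat}.
Variable f : forall k : 'I_K, 'cV[R]_(k.+1 * d) -> R.
Arguments f : clear implicits.
Variable L : 'I_K -> R.
Hypothesis fL : forall (k : 'I_K) (x y : 'cV[R]_(k.+1 * d)),
  `|f k x - f k y| <= L k * enorm (x - y).
Variables (mu : 'I_K -> 'cV[R]_d) (Sig : 'I_K -> 'M[R]_d).
Variable z : 'I_K -> 'I_N -> 'cV[R]_d.
Hypothesis hSig : forall k, (Sig k)^T = Sig k /\ posdef (Sig k).
Hypothesis N0 : (0 < N)%N.

Definition zcat (i : 'I_K) (j : 'I_N) : 'cV[R]_(i.+1 * d) :=
  catv (pre i (z ^~ j)).

Definition gsum (k : 'I_K) : 'cV[R]_d :=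
  \sum_(i < K | (k <= i)%N) casbo_ghat f mu Sig z i k.

Definition incr (i : 'I_K) (j : 'I_N) : R :=
  f i (catv (pre i (casbo_x mu Sig z ^~ j))) - f i (catv (pre i mu)).

Definition sqrtB (i : 'I_K) : 'M[R]_(i.+1 * d) :=
  bdiag (pre i (fun l => sqrtmx (Sig l))).

Lemma catv_casbo_x i j : catv (pre i (casbo_x mu Sig z ^~ j)) =
  catv (pre i mu) + sqrtB i *m zcat i j.
Proof. by rewrite /sqrtB /zcat bdiag_catv -catvD. Qed.

Lemma sum_pre (i : 'I_K) (F : 'I_K -> R) :
  \sum_(k < K | (k <= i)%N) F k = \sum_(l < i.+1) pre i F l.
Proof. by rewrite (big_ord_narrow (ltn_ord i)). Qed.

Lemma enorm_sqrtB lam i v : (forall k x, qform (Sig k) x <= lam * dotv x x) ->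
  dotv (sqrtB i *m v) (sqrtB i *m v) <= lam * dotv v v.
Proof.
move=> hl; rewrite -(blockvK v) bdiag_catv !dotv_catv mulr_sumr.
apply: ler_sum => l _; rewrite /pre; have [s p] := hSig (widen_ord (ltn_ord i) l).
by rewrite -sqrtmx_qform.
Qed.

Lemma enorm_sqrtB_le lam i v : 0 <= lam ->
  (forall k x, qform (Sig k) x <= lam * dotv x x) ->
  enorm (sqrtB i *m v) <= Num.sqrt lam * enorm v.
Proof.
move=> l0 hl; rewrite !enormE -sqrtrM//; apply: ler_wsqrtr.
exact: enorm_sqrtB.
Qed.

Lemma incr_sqr_le lam i j : (forall k x, qform (Sig k) x <= lam * dotv x x) ->
  incr i j ^+ 2 <= L i ^+ 2 * (lam * dotv (zcat i j) (zcat i j)).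
Proof.
move=> hl; rewrite /incr catv_casbo_x.
have := fL (catv (pre i mu) + sqrtB i *m zcat i j) (catv (pre i mu)).
rewrite addrAC subrr add0r => h.
rewrite -[leLHS]real_normK ?num_real//.
apply: le_trans (_ : (L i * enorm (sqrtB i *m zcat i j)) ^+ 2 <= _).
  by rewrite ler_sqr ?nnegrE// (le_trans _ h).
by rewrite exprMn enorm_sqr ler_wpM2l ?sqr_ge0// enorm_sqrtB.
Qed.

Lemma sqrt_ghat i k : sqrtmx (Sig k) *m casbo_ghat f mu Sig z i k =
  N%:R^-1 *: \sum_j incr i j *: z k j.
Proof.
have [s p] := hSig k; have [_ _ _ u] := sqrtmxP s p.
rewrite casbo_ghatE// -scalemxAr mulmx_sumr; congr (_ *: _).
by apply: eq_bigr => j _; rewrite -scalemxAr mulKVmx.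
Qed.

Lemma gsum_qform_le lam : (forall k x, qform (Sig k) x <= lam * dotv x x) ->
  0 <= lam ->
  \sum_k qform (Sig k) (gsum k) <=
  lam * \sum_(i < K) K%:R * L i ^+ 2 *
     (N%:R^-1 * \sum_(j < N) dotv (zcat i j) (zcat i j) ^+ 2).
Proof.
move=> hl l0.
have Ninv : 0 <= N%:R^-1 :> R by rewrite invr_ge0.
have step k : qform (Sig k) (gsum k) <= \sum_(i < K | (k <= i)%N)
    K%:R * (N%:R^-1 * \sum_j incr i j ^+ 2 * dotv (z k j) (z k j)).
  have [s p] := hSig k; rewrite sqrtmx_qform// /gsum mulmx_sumr big_mkcond/=.
  apply: le_trans (dotv_sum_le _) _.
  rewrite mulr_sumr [leRHS]big_mkcond/=; apply: ler_sum => i _.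
  case: ifP => _; last by rewrite dotv0 mulr0.
  rewrite ler_wpM2l// sqrt_ghat !dotv_lin mulrCA ler_wpM2l//.
  rewrite ler_pdivrMl ?ltr0n//; apply: le_trans (dotv_sum_le _) _.
  rewrite ler_wpM2l//; apply: ler_sum => j _; rewrite !dotv_lin; lra.
apply: le_trans (ler_sum _ (fun k _ => step k)) _.
rewrite (exchange_big_dep xpredT)//= mulr_sumr; apply: ler_sum => i _.
rewrite [leRHS](_ : _ = K%:R * (N%:R^-1 * (L i ^+ 2 * (lam *
   \sum_(j < N) dotv (zcat i j) (zcat i j) ^+ 2)))); last by ring.
rewrite -mulr_sumr ler_wpM2l// -mulr_sumr ler_wpM2l//.
rewrite exchange_big/= mulrA mulr_sumr; apply: ler_sum => j _.
rewrite -mulr_sumr sum_pre.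
have -> : \sum_(l < i.+1) pre i (fun k => dotv (z k j) (z k j)) l =
    dotv (zcat i j) (zcat i j) by rewrite dotv_catv.
rewrite expr2 mulrA ler_wpM2r ?dotvv_ge0// -mulrA.
exact: incr_sqr_le.
Qed.

Variable ms : 'I_K -> 'cV[R]_d.

Definition shiftv (i : 'I_K) : 'cV[R]_(i.+1 * d) :=
  catv (pre i (fun l => invmx (sqrtmx (Sig l)) *m (ms l - mu l))).

Lemma sqrtB_shiftv i :
  catv (pre i mu) + sqrtB i *m shiftv i = catv (pre i ms).
Proof.
rewrite /sqrtB /shiftv bdiag_catv -catvD; congr catv; apply/funext => l.
rewrite /pre; set k := widen_ord _ l.
have [s p] := hSig k; have [_ _ _ u] := sqrtmxP s p.
by rewrite mulKVmx// addrC subrK.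
Qed.

Lemma gsum_inner : \sum_k dotv (gsum k) (mu k - ms k) =
  \sum_(i < K) N%:R^-1 * \sum_(j < N) (- dotv (shiftv i) (zcat i j)) * incr i j.
Proof.
have step k : dotv (gsum k) (mu k - ms k) = \sum_(i < K | (k <= i)%N)
    N%:R^-1 * \sum_j incr i j *
      dotv (z k j) (invmx (sqrtmx (Sig k)) *m (mu k - ms k)).
  rewrite dotvC dotv_sumr; apply: eq_bigr => i _.
  rewrite casbo_ghatE// dotvZr dotv_sumr; congr (_ * _).
  apply: eq_bigr => j _; rewrite dotvZr; congr (_ * _).
  have [s p] := hSig k; have [sS _ _ _] := sqrtmxP s p.
  by rewrite dotv_sym ?invmx_sym// dotvC.
rewrite (eq_bigr _ (fun k _ => step k)) (exchange_big_dep xpredT)//=.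
apply: eq_bigr => i _; rewrite -mulr_sumr; congr (_ * _).
rewrite exchange_big/=; apply: eq_bigr => j _.
rewrite -mulr_sumr mulrC; congr (_ * _).
rewrite sum_pre /shiftv /zcat dotv_catv -sumrN; apply: eq_bigr => l _.
rewrite /pre -[X in - dotv (_ *m X) _]opprB mulmxN dotvNl opprK dotvC.
by [].
Qed.

End StepEstimates.

(** * Step sizes *)

Section Schedules.
Context {R : realType}.
Variables alpha beta nu : R.
Hypothesis alpha0 : 0 < alpha.
Hypothesis beta0 : 0 < beta.
Hypothesis nu0 : 0 < nu.

Local Notation sq t := (Num.sqrt (t%:R : R)).

Let sq_ge0 t : 0 <= sq t. Proof. exact: sqrtr_ge0. Qed.
Let sq_gt0 t : 0 < sq t.+1. Proof. by rewrite sqrtr_gt0 ltr0n. Qed.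
Let sqE t : sq t ^+ 2 = t%:R. Proof. by rewrite sqr_sqrtr. Qed.
Let sqS t : sq t.+1 ^+ 2 = sq t ^+ 2 + 1.
Proof. by rewrite !sqE -natr1. Qed.
Let sqlt t : sq t < sq t.+1.
Proof. by rewrite ltr_sqrt ?ltr0n// ltr_nat. Qed.

(* [lam_t t] bounds the covariances of iteration [t]; the growth [t ^ (3/2)] comes
   from summing [alpha_t = sqrt (t + 1) alpha]. *)
Definition cden (t : nat) : R := 1 + 2 / 3 * (t%:R * sq t).
Definition lam_t (t : nat) : R := (alpha * nu * cden t)^-1.

(* Weight in Young's inequality.  The weight 1 fails only at [t = 2]. *)
Definition young_t (t : nat) : R := if t == 2%N then 3^-1 else 1.

Lemma young_t_gt0 t : 0 < young_t t.
Proof. by rewrite /young_t; case: ifP. Qed.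

Lemma cden_gt0 t : 0 < cden t.
Proof. by rewrite /cden ltr_wpDr// !mulr_ge0. Qed.

Lemma lam_t_gt0 t : 0 < lam_t t.
Proof. by rewrite invr_gt0 !mulr_gt0// cden_gt0. Qed.

Lemma cden1 : cden 1 = 5 / 3.
Proof. by rewrite /cden sqrtr1; lra. Qed.

Let cdenE t : cden t = 1 + 2 / 3 * sq t ^+ 3.
Proof. by rewrite /cden exprSr sqE. Qed.

Lemma cden_step t : cden t.+1 <= cden t + sq t.+1.
Proof.
rewrite !cdenE; have := sqS t; have := sq_ge0 t; have := sqlt t.
move: (sq t) (sq t.+1) => a b ab a0 e.
have h : 2 * (b ^+ 3 - a ^+ 3) * (a + b) <= 3 * b * (a + b).
  have -> : 2 * (b ^+ 3 - a ^+ 3) * (a + b) =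
     2 * (b ^+ 2 - a ^+ 2) * (b ^+ 2 + a * b + a ^+ 2) by ring.
  have : a * a <= a * b by rewrite ler_wpM2l// ltW.
  rewrite [X in 2 * X](_ : _ = 1); lra.
rewrite ler_pM2r in h; lra.
Qed.

Lemma cden_alpha_step t :
  alpha * nu * cden t.+1 <= alpha * nu * cden t + alpha_t alpha t * nu.
Proof.
rewrite /alpha_t; have := cden_step t.
rewrite -(ler_pM2l (mulr_gt0 alpha0 nu0)); lra.
Qed.

Let mean_coef_scaled t : (2 <= t)%N ->
  (1 + young_t t) * sq t ^+ 3 + 2 * sq t.+1 ^+ 2 * cden t <=
  3 * (sq t * sq t.+1) * cden t.
Proof.
move=> t2; rewrite cdenE.
have e := sqS t; have a0 := sq_ge0 t; have ab := sqlt t; have ea := sqE t.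
rewrite /young_t; case: eqVneq => [t2E|t2N].
  rewrite t2E in e a0 ab ea *; move: (sq 2) (sq 3) e a0 ab ea => a b e a0 ab ea.
  have a1 : a <= 14143 / 10000 by nra.
  have a2 : 1414 / 1000 <= a by nra.
  have b1 : 1732 / 1000 <= b by nra.
  have -> : a ^+ 3 = 2 * a by rewrite exprS ea; lra.
  have -> : b ^+ 2 = 3 by rewrite e ea; lra.
  have : (1414 / 1000) * (1732 / 1000) <= a * b by nra.
  have -> : 3 * (a * b) * (1 + 2 / 3 * (2 * a)) = 3 * (a * b) + 4 * a ^+ 2 * b by field.
  rewrite ea; lra.
case: (eqVneq t 3%N) => [t3E|t3N].
  rewrite t3E in e a0 ab ea *; move: (sq 3) (sq 4) e a0 ab ea => a b e a0 ab ea.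
  have a1 : a <= 175 / 100 by nra.
  have -> : b = 2 by nra.
  have -> : a ^+ 3 = 3 * a by rewrite exprS ea; lra.
  nra.
have t4 : 4 <= sq t ^+ 2.
  by rewrite ea ler_nat ltn_neqAle eq_sym t3N ltn_neqAle eq_sym t2N.
have -> : (1 + 1) * sq t ^+ 3 = 2 * (sq t * sq t ^+ 2) by rewrite -exprS; ring.
have -> : sq t ^+ 3 = sq t * sq t ^+ 2 by rewrite -exprS.
move: (sq t) (sq t.+1) e a0 ab t4 {ea} => a b e a0 ab t4.
have b0 : 0 <= a * b by nra.
have h : 2 * a ^+ 2 + 5 <= 3 * (a * b).
  rewrite -(@ler_pXn2r _ 2%N) ?nnegrE//; [|nra|lra].
  rewrite !exprMn e; move: (a ^+ 2) t4 => x t4.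
  have : 0 <= (x - 4) * (5 * x + 9) by rewrite mulr_ge0; lra.
  lra.
have D0 : 0 <= 1 + 2 / 3 * (a * a ^+ 2) by rewrite addr_ge0// !mulr_ge0// sqr_ge0.
have := ler_wpM2r D0 h; rewrite e; lra.
Qed.

Lemma gamma_tE t : gamma_t alpha beta nu t = alpha * nu / beta / sq t.+1.
Proof. by rewrite /gamma_t; field; rewrite !gt_eqF ?sq_gt0. Qed.

Lemma gamma_t_gt0 t : 0 < gamma_t alpha beta nu t.
Proof. by rewrite gamma_tE !divr_gt0 ?mulr_gt0 ?sq_gt0. Qed.

Lemma gamma_t_ndecr t : gamma_t alpha beta nu t.+1 <= gamma_t alpha beta nu t.
Proof.
rewrite !gamma_tE ler_pM2l ?divr_gt0 ?mulr_gt0// lef_pV2 ?posrE ?sq_gt0//.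
by rewrite ltW.
Qed.

Let bgl t : beta_t beta t * (gamma_t alpha beta nu t ^+ 2 * lam_t t) =
  gamma_t alpha beta nu t * (sq t ^+ 2 / (sq t.+1 * cden t)).
Proof.
rewrite gamma_tE /beta_t /lam_t sqE; field.
by rewrite !gt_eqF ?sq_gt0 ?cden_gt0.
Qed.

Lemma mean_coef1 : beta_t beta 1 *
  ((1 + young_t 1) * (gamma_t alpha beta nu 1 ^+ 2 * lam_t 1)) <=
  gamma_t alpha beta nu 1.
Proof.
rewrite mulrCA bgl cden1 sqrtr1 /young_t /=.
rewrite mulrCA -[leRHS]mulr1 ler_pM2l ?gamma_t_gt0// expr1n mul1r.
have s2 := sqE 2; have s0 := sq_gt0 1; move: (sq 2) s2 s0 => s s2 s0.
have h : 6 / 5 <= s by nra.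
rewrite ler_pdivrMr; lra.
Qed.

Lemma mean_coef t : (1 <= t)%N -> beta_t beta t.+1 *
  ((1 + young_t t.+1) * (gamma_t alpha beta nu t.+1 ^+ 2 * lam_t t.+1)) +
  2 * (gamma_t alpha beta nu t - gamma_t alpha beta nu t.+1) <=
  gamma_t alpha beta nu t.+1.
Proof.
move=> t1; rewrite mulrCA bgl.
have -> : gamma_t alpha beta nu t =
    gamma_t alpha beta nu t.+1 * (sq t.+2 / sq t.+1).
  by rewrite !gamma_tE; field; rewrite !gt_eqF ?sq_gt0.
have := @mean_coef_scaled t.+1 t1; have g0 := gamma_t_gt0 t.+1.
have a0 := sq_gt0 t; have b0 := sq_gt0 t.+1; have c0 := cden_gt0 t.+1.
move: (gamma_t _ _ _ _) (sq t.+1) (sq t.+2) (cden _) (young_t _) g0 a0 b0 c0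
  => g a b c y g0 a0 b0 c0 h.
rewrite -subr_ge0.
have -> : g - ((1 + y) * (g * (a ^+ 2 / (b * c))) + 2 * (g * (b / a) - g)) =
  g / (a * b * c) * (3 * (a * b) * c - ((1 + y) * a ^+ 3 + 2 * b ^+ 2 * c)).
  by field; rewrite !gt_eqF.
by rewrite mulr_ge0 ?subr_ge0// divr_ge0 ?mulr_ge0 ?ltW.
Qed.

Lemma sum_gamma T : \sum_(1 <= t < T.+1) gamma_t alpha beta nu t <=
  alpha * nu / beta * (2 * (sq T.+1 - 1)).
Proof.
elim: T => [|T IH]; first by rewrite big_geq// sqrtr1 subrr !mulr0.
rewrite big_nat_recr//= (le_trans (lerD IH (lexx _)))// gamma_tE -mulrDr.
rewrite ler_pM2l ?divr_gt0 ?mulr_gt0//.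
have := sqS T.+1; have := sq_gt0 T; have := sq_gt0 T.+1; have := sqlt T.+1.
move: (sq T.+1) (sq T.+2) => a b ab b0 a0 e.
have : b^-1 <= 2 * (b - a).
  rewrite -(ler_pM2r b0) mulVf ?gt_eqF//; nra.
lra.
Qed.

Lemma beta_lam t : beta_t beta t * lam_t t = beta / (alpha * nu) * (t%:R / cden t).
Proof. by rewrite /beta_t /lam_t; field; rewrite !gt_eqF ?cden_gt0. Qed.

Let noise_term t : t.+1%:R / cden t.+1 <= 3 * (sq t.+1 - sq t).
Proof.
rewrite ler_pdivrMr ?cden_gt0// cdenE -[X in X <= _](sqE t.+1).
have := sqS t; have := sq_ge0 t; have := sqlt t.
move: (sq t) (sq t.+1) => a b ab a0 e.
have h1 : 1 <= 2 * b * (b - a) by nra.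
have : 0 <= b ^+ 2 * (2 * b * (b - a) - 1).
  by rewrite mulr_ge0 ?sqr_ge0// subr_ge0.
nra.
Qed.

Lemma sum_noise T : (1 <= T)%N -> \sum_(1 <= t < T.+1)
  (1 + (young_t t)^-1) / 2 * (beta_t beta t * lam_t t) <=
  beta / (alpha * nu) * (3 * sq T).
Proof.
move=> T1; under eq_bigr do rewrite beta_lam mulrCA.
rewrite -mulr_sumr ler_pM2l ?divr_gt0 ?mulr_gt0//.
have term1 : (1 + (young_t 1)^-1) / 2 * (1%:R / cden 1) = 3 / 5.
  by rewrite cden1 /young_t /= invr1; field.
case: T T1 => // -[_|T _]; first by rewrite big_nat1 term1 sqrtr1; lra.
elim: T => [|T IH].
  rewrite big_nat_recr//= big_nat1 term1 /young_t /= invrK.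
  rewrite cdenE; have ea := sqE 2; have a0 := sq_ge0 2.
  have -> : sq 2 ^+ 3 = 2 * sq 2 by rewrite exprS ea mulrC.
  move: (sq 2) ea a0 => a ea a0.
  have a2 : 1414 / 1000 <= a by nra.
  have : 2%:R / (1 + 2 / 3 * (2 * a)) <= 1 by rewrite ler_pdivrMr; lra.
  lra.
rewrite big_nat_recr//=; have := noise_term T.+2.
have -> : (1 + (young_t T.+3)^-1) / 2 = 1 by rewrite /young_t /= invr1; lra.
rewrite mul1r; lra.
Qed.

Local Notation qq t := (Num.sqrt (sq t)).

Let bias_term t : Num.sqrt (lam_t t.+1) <=
  Num.sqrt 3 / Num.sqrt (alpha * nu) * (4 * (qq t.+1 - qq t)).
Proof.
have an0 : 0 < alpha * nu by rewrite mulr_gt0.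
have -> : Num.sqrt (lam_t t.+1) =
    (Num.sqrt (alpha * nu))^-1 * (Num.sqrt (cden t.+1))^-1.
  have c0 : 0 < cden t.+1 by exact: cden_gt0.
  rewrite /lam_t sqrtrV; last by rewrite mulr_ge0 ?ltW.
  by rewrite (sqrtrM _ (ltW an0)) invfM.
rewrite -[Num.sqrt 3 / _ * _]mulrA mulrCA ler_pM2l ?invr_gt0 ?sqrtr_gt0//.
have q1 : qq t.+1 ^+ 4 = t.+1%:R.
  by rewrite (exprM _ 2 2) sqr_sqrtr// sqE.
have q0 : qq t ^+ 4 = t%:R by rewrite (exprM _ 2 2) sqr_sqrtr// sqE.
have b0 : 0 < qq t.+1 by rewrite sqrtr_gt0.
have a0 : 0 <= qq t by rewrite sqrtr_ge0.
have ab : qq t <= qq t.+1 by rewrite ler_wsqrtr// ltW.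
have key : qq t.+1 ^+ 3 <= Num.sqrt 3 * Num.sqrt (cden t.+1).
  rewrite -sqrtrM// -(@ler_pXn2r _ 2%N) ?nnegrE ?exprn_ge0 ?ltW ?sqrtr_gt0//;
    last by rewrite mulr_gt0 ?cden_gt0.
  rewrite sqr_sqrtr ?mulr_ge0 ?ltW ?cden_gt0// cdenE.
  have -> : (qq t.+1 ^+ 3) ^+ 2 = sq t.+1 ^+ 3.
    by rewrite -exprM -[in RHS](sqr_sqrtr (sq_ge0 t.+1)) -exprM.
  have : 0 <= sq t.+1 ^+ 3 by rewrite exprn_ge0.
  lra.
have c0 : 0 < Num.sqrt (cden t.+1) by rewrite sqrtr_gt0 cden_gt0.
rewrite -(ler_pM2r c0) mulVf ?gt_eqF//.
have e : qq t.+1 ^+ 4 = qq t ^+ 4 + 1 by rewrite q1 q0 -natr1.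
move: (qq t) (qq t.+1) (Num.sqrt 3) (Num.sqrt (cden _)) key a0 b0 ab e
  => a b s c key a0 b0 ab e.
have h1 : 1 <= 4 * (b - a) * b ^+ 3.
  have E1 : (b - a) * (b ^+ 3 + b ^+ 2 * a + b * a ^+ 2 + a ^+ 3) = 1 by lra.
  have ba : 0 <= b - a by rewrite subr_ge0.
  have h2 : a ^+ 2 <= b ^+ 2 by rewrite ler_sqr ?nnegrE// ltW.
  have h3 : a ^+ 3 <= b ^+ 3 by rewrite lerXn2r ?nnegrE// ltW.
  have h4 : b ^+ 2 * a <= b ^+ 2 * b by rewrite ler_wpM2l ?sqr_ge0.
  have h5 : b * a ^+ 2 <= b * b ^+ 2 by rewrite ler_pM2l.
  have : 0 <= (b - a) * (4 * b ^+ 3 - (b ^+ 3 + b ^+ 2 * a + b * a ^+ 2 + a ^+ 3)).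
    by rewrite mulr_ge0//; lra.
  lra.
have : 4 * (b - a) * b ^+ 3 <= 4 * (b - a) * (s * c).
  by rewrite ler_wpM2l// mulr_ge0// subr_ge0.
lra.
Qed.

Lemma sum_bias T : \sum_(1 <= t < T.+1) Num.sqrt (lam_t t) <=
  Num.sqrt 3 / Num.sqrt (alpha * nu) * (4 * qq T).
Proof.
elim: T => [|T IH].
  by rewrite big_geq// !mulr_ge0 ?sqrtr_ge0 ?invr_ge0.
rewrite big_nat_recr//=; have := bias_term T; lra.
Qed.

(* Summation of the one-step inequalities; [Dq] is the squared distance to the
   minimizer, [Nq] the squared norm. *)
Lemma descent_sum (V U Dq Nq I Gn : nat -> R) (B : R) :
  0 <= B -> (forall t, 0 <= U t) -> (forall t, 0 <= Nq t) -> (forall t, 0 <= Dq t) ->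
  (forall t, Dq t <= 2 * Nq t + 2 * B) ->
  (forall t, (1 <= t)%N -> U t <= V t - 2 * I t
     - gamma_t alpha beta nu t * (Nq t + Dq t - B)
     + beta_t beta t * ((1 + young_t t) * (gamma_t alpha beta nu t ^+ 2 *
         (lam_t t * Nq t)) + (1 + (young_t t)^-1) * Gn t)) ->
  (forall t, (1 <= t)%N -> V t.+1 <= U t + gamma_t alpha beta nu t * Dq t.+1) ->
  forall T, (1 <= T)%N -> \sum_(1 <= t < T.+1) I t <=
   V 1%N / 2 + B * (alpha * nu / beta * Num.sqrt (T.+2%:R)) +
   \sum_(1 <= t < T.+1) (1 + (young_t t)^-1) / 2 * (beta_t beta t * Gn t).
Proof.
move=> B0 U0 Nq0 Dq0 DN h1 h2 T T1.
set g := gamma_t alpha beta nu in h1 h2 *.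
have claim : 2 * (\sum_(1 <= t < T.+1) I t) + U T <= V 1%N +
    B * (\sum_(1 <= t < T.+1) g t + 2 * (g 1%N - g T)) +
    2 * \sum_(1 <= t < T.+1) (1 + (young_t t)^-1) / 2 * (beta_t beta t * Gn t).
  elim: T T1 => // -[_ _|T IH _].
    rewrite !big_nat1; have := h1 1%N isT.
    have := ler_wpM2r (Nq0 1%N) mean_coef1; rewrite -/g.
    have : 0 <= g 1%N * Dq 1%N by rewrite mulr_ge0// ltW// gamma_t_gt0.
    lra.
  rewrite !(@big_nat_recr _ _ _ T.+2 1)//=; have {}IH := IH isT.
  have := h1 T.+2 isT; have := h2 T.+1 isT.
  have := ler_wpM2r (Nq0 T.+2) (@mean_coef T.+1 isT); rewrite -/g.
  have : (g T.+1 - g T.+2) * Dq T.+2 <= (g T.+1 - g T.+2) * (2 * Nq T.+2 + 2 * B).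
    by rewrite ler_wpM2l// subr_ge0; exact: gamma_t_ndecr.
  lra.
have gs := ler_wpM2l B0 (sum_gamma T); rewrite -/g in gs.
have UT := U0 T.
have g1 : g 1%N = alpha * nu / beta / sq 2 by exact: gamma_tE.
have gT : 0 <= g T by rewrite ltW// gamma_t_gt0.
have s2 : (sq 2)^-1 <= 1.
  by rewrite invf_le1 ?sq_gt0// -[X in X <= _]sqrtr1 ler_wsqrtr// ler1n.
have k0 : 0 < alpha * nu / beta by rewrite divr_gt0 ?mulr_gt0.
have sT : sq T.+1 <= sq T.+2 by rewrite ltW.
have k1 : B * g 1%N <= B * (alpha * nu / beta).
  by rewrite ler_wpM2l// g1 ler_piMr// ltW.
have k2 : 0 <= B * g T by rewrite mulr_ge0.
have k3 : B * (alpha * nu / beta) * sq T.+1 <= B * (alpha * nu / beta) * sq T.+2.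
  by rewrite ler_wpM2l// mulr_ge0// ltW.
lra.
Qed.

End Schedules.

Section DecoupledBound.
Context {R : realType} {d0 : measure_display} {Om : measurableType d0}.
Variable P : probability Om R.
Variables (I : eqType) (X : I -> Om -> R).
Hypothesis indX : mutually_independent P X.
Hypothesis mX : forall i, measurable_fun setT (X i).

Lemma Ex_decouple_ge (A B : set I) (h : Om -> Om -> R) (psi u v : Om -> R) :
  A `&` B = set0 ->
  measurable_fun setT (fun p : coord_space X A * coord_space X B => h p.1 p.2) ->
  measurable_fun setT (u : coord_space X A -> R) ->
  measurable_fun setT (v : coord_space X B -> R) ->
  (forall w w', `|h w w'| <= u w + v w') ->
  intg P u -> intg P v -> intg P psi -> (forall w, psi w <= Ex P (h w)) ->
  intg P (fun w => h w w) /\ Ex P psi <= Ex P (fun w => h w w).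
Proof.
move=> AB mh mu mv hb iu iv ipsi hpsi.
have mhh : measurable_fun setT (fun w => h w w).
  have mg : measurable_fun setT
      (fun w : Om => (w : coord_space X A, w : coord_space X B)).
    by apply: measurable_fun_pair; exact: measurable_coord_id.
  exact: (measurableT_comp mh mg).
have ihh : intg P (fun w => h w w).
  by apply: (intg_dom mhh (intgD iu iv)) => w; exact: hb.
split => //.
pose g w w' := h w w' + (u w + v w').
have g0 w w' : 0 <= g w w'.
  have := hb w w'; rewrite ler_norml => /andP[+ _]; rewrite /g; lra.
have ge0E w w' : (0 <= (g w w')%:E)%E by rewrite lee_fin.
have mg : measurable_fun setT
    (fun p : coord_space X A * coord_space X B => (g p.1 p.2)%:E).
  apply/measurable_EFinP; apply: measurable_funD => //; apply: measurable_funD.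
    exact: (measurableT_comp mu measurable_fst).
  exact: (measurableT_comp mv measurable_snd).
have ih w : intg P (h w).
  have mhw : measurable_fun setT (h w).
    apply: (coord_space_sub mX (A := B)).
    exact: (measurableT_comp mh (pair1_measurable (w : coord_space X A))).
  by apply: (intg_dom mhw (intgD (intg_cst P (u w)) iv)) => w'; exact: hb.
have igw w : intg P (g w).
  by apply: intgD => //; apply: intgD => //; exact: intg_cst.
have E w : Ex P (g w) = Ex P (h w) + (u w + Ex P v).
  have iuv := intgD (intg_cst P (u w)) iv.
  by rewrite (ExD (ih w) iuv) (ExD (intg_cst P _) iv) Ex_cst.
pose G w := Ex P (g w).
have GE w : (\int[P]_w' (g w w')%:E)%E = (G w)%:E by exact: ExE.
have mG : measurable_fun setT G.
  apply/measurable_EFinP.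
  have := @measurable_decouple _ _ _ P _ _ mX A B (fun w w' => (g w w')%:E) mg ge0E.
  by congr measurable_fun; apply/funext => w; exact: GE.
have igg : intg P (fun w => g w w) by apply: intgD => //; exact: intgD.
have [iG eG] : intg P G /\ Ex P G = Ex P (fun w => g w w).
  apply: Ex_transfer => //; first by move=> w; exact: Ex_ge0.
  rewrite (@decouple _ _ _ P _ _ indX mX A B (fun w w' => (g w w')%:E) AB mg ge0E).
  by apply: eq_integral => w _; rewrite GE.
have : Ex P (fun w => psi w + (u w + Ex P v)) <= Ex P G.
  apply: Ex_le => //; first by apply: intgD => //; apply: intgD => //; exact: intg_cst.
  by move=> w; rewrite /G E lerD2r.
have iuv := intgD iu iv; have iuc := intgD iu (intg_cst P (Ex P v)).
rewrite eG (ExD ihh iuv) (ExD ipsi iuc) (ExD iu iv) (ExD iu (intg_cst P _)) Ex_cst.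
lra.
Qed.

End DecoupledBound.

(** * The random run *)

Section RandomRunBounds.
Context {R : realType} {disp : measure_display} {Om : measurableType disp}.
Variable P : probability Om R.
Variables d K N : nat.
Variable f : forall k : 'I_K, 'cV[R]_(k.+1 * d) -> R.
Arguments f : clear implicits.
Variable L : 'I_K -> R.
Variables (mustar mu1 : 'I_K -> 'cV[R]_d) (Sig1 : 'I_K -> 'M[R]_d).
Variables alpha beta nu : R.
Variables (zc : nat -> 'I_K -> 'I_N -> 'I_d -> Om -> R) (c1 c2 : nat -> 'I_K -> Om -> R).
Hypothesis d0 : (0 < d)%N.
Hypothesis N0 : (0 < N)%N.
Hypothesis fC : forall (k : 'I_K) (x y : 'cV[R]_(k.+1 * d)) (lam : R),
  0 <= lam <= 1 ->
  f k (lam *: x + (1 - lam) *: y) <= lam * f k x + (1 - lam) * f k y.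
Hypothesis fL : forall (k : 'I_K) (x y : 'cV[R]_(k.+1 * d)),
  `|f k x - f k y| <= L k * enorm (x - y).
Hypothesis hSig1 : forall k, (Sig1 k)^T = Sig1 k /\ posdef (Sig1 k).
Hypothesis alpha0 : 0 < alpha.
Hypothesis beta0 : 0 < beta.
Hypothesis nu0 : 0 < nu.
Hypothesis hop : forall k, (opnorm (Sig1 k))^-1 >= 5 / 3 * alpha * nu.

Definition coordX (i : nat * 'I_K * 'I_N * 'I_d) : Om -> R :=
  zc i.1.1.1 i.1.1.2 i.1.2 i.2.

Hypothesis indX : mutually_independent P coordX.
Hypothesis nz : forall t k j l, std_normal P (zc t k j l).
Hypothesis mc1 : forall t k, measurable_wrt
  (fun i : {i : nat * 'I_K * 'I_N * 'I_d | (i.1.1.1 <= t)%N} =>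
    zc (val i).1.1.1 (val i).1.1.2 (val i).1.2 (val i).2) (c1 t k).
Hypothesis mc2 : forall t k, measurable_wrt
  (fun i : {i : nat * 'I_K * 'I_N * 'I_d | (i.1.1.1 <= t)%N} =>
    zc (val i).1.1.1 (val i).1.1.2 (val i).1.2 (val i).2) (c2 t k).

Local Notation mu := (rmu f alpha beta nu mu1 Sig1 zc c1 c2).
Local Notation Sig := (rSig f alpha beta nu mu1 Sig1 zc c1 c2).
Local Notation zv := (zvec zc).

Hypothesis hC : forall t k w, (1 <= t)%N ->
  constr_C1 alpha beta nu t (Sig t w k)
    (rH f alpha beta nu mu1 Sig1 zc c1 c2 t w k) /\
  constr_C2 nu (rG f alpha beta nu mu1 Sig1 zc c1 c2 t w k).

Let nX i : std_normal P (coordX i). Proof. exact: nz. Qed.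
Let mX i : measurable_fun setT (coordX i). Proof. by have [] := nX i. Qed.

Lemma lipschitz_cst_ge0 i : 0 <= L i.
Proof.
have n0 : (0 < i.+1 * d)%N by rewrite muln_gt0.
pose e : 'cV[R]_(i.+1 * d) := delta_mx (Ordinal n0) 0.
have e0 : 0 < enorm e.
  rewrite enormE sqrtr_gt0; apply: dotvv_gt0; apply/eqP => /matrixP/(_ (Ordinal n0) 0).
  by rewrite !mxE !eqxx; apply/eqP; rewrite oner_eq0.
have := le_trans (normr_ge0 _) (fL e 0); rewrite subr0.
by rewrite pmulr_lge0.
Qed.

Lemma rmuS t w : (1 <= t)%N -> mu t.+1 w = casbo_mu_next f (mu t w) (Sig t w) (zv t w)
  (beta_t beta t) (gamma_t alpha beta nu t).
Proof.
case: t => // t _; rewrite /rmu /rSig /casbo_mu /casbo_Sig /=.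
by case: (casbo_run _ _ _ _ _ _ _ _ _ t).
Qed.

Lemma rSigS t w : (1 <= t)%N -> Sig t.+1 w = casbo_Sig_next f (mu t w) (Sig t w)
  (zv t w) (c1 t ^~ w) (c2 t ^~ w) (alpha_t alpha t) (omega_t R t).
Proof.
case: t => // t _; rewrite /rmu /rSig /casbo_mu /casbo_Sig /=.
by case: (casbo_run _ _ _ _ _ _ _ _ _ t).
Qed.

Lemma opnorm_inv_le (A : 'M[R]_d) c : A^T = A -> posdef A -> 0 < c ->
  c <= (opnorm A)^-1 -> forall x, c * dotv x x <= qform (invmx A) x.
Proof.
move=> sA pA c0 hc x; set E := [set enorm (A *m y) | y in [set y : 'cV[R]_d | enorm y <= 1]].
have o0 : 0 < opnorm A by rewrite -invr_gt0 (lt_le_trans c0).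
have sE : has_sup E.
  apply: contrapT => nE; move: o0; rewrite /opnorm -/E sup_out// ltxx//.
have bA y : enorm (A *m y) <= opnorm A * enorm y.
  have [->|y0] := eqVneq y 0; first by rewrite mulmx0 !enorm0 mulr0.
  have e0 : 0 < enorm y by rewrite enormE sqrtr_gt0 dotvv_gt0.
  rewrite -ler_pdivrMr// mulrC.
  have : E (enorm (A *m ((enorm y)^-1 *: y))).
    by exists ((enorm y)^-1 *: y) => //=; rewrite enormZ gtr0_norm ?invr_gt0// mulVf// gt_eqF.
  move=> /(ub_le_sup sE.2); rewrite -scalemxAr enormZ gtr0_norm ?invr_gt0//.
have qA y : qform A y <= opnorm A * dotv y y.
  rewrite qformE (le_trans (ler_norm _))// (le_trans (dotv_le_enorm _ _))//.
  by rewrite -enorm_sqr expr2 mulrCA ler_wpM2l ?enorm_ge0.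
have := qform_inv_ge sA pA qA x.
rewrite -ler_pdivrMl// => h; apply: le_trans h.
by rewrite ler_wpM2r ?dotvv_ge0.
Qed.

Lemma casbo_H_sym (m : 'I_K -> 'cV[R]_d) (S : 'I_K -> 'M[R]_d)
  (z : 'I_K -> 'I_N -> 'cV[R]_d) (a b : 'I_K -> R) k :
  (casbo_H f m S z a b k)^T = casbo_H f m S z a b k.
Proof.
rewrite /casbo_H scalerA linearD/= !linearZ/= trmx1 linear_sum/=.
congr (_ *: _ + _).
by apply: eq_bigr => j _; rewrite linearZ/= trmx_mul trmxK.
Qed.

Fixpoint prec_ub (t : nat) : R :=
  if t is t'.+1 then
    if t' is t''.+1 then
      (1 + (t'%:R)^-1) * prec_ub t' + beta_t beta t * gamma_t alpha beta nu t'
    else \sum_k \sum_i \sum_j `|invmx (Sig1 k) i j|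
  else 0.

Let prec_ubS t : prec_ub t.+2 = (1 + (t.+1%:R)^-1) * prec_ub t.+1 +
  beta_t beta t.+2 * gamma_t alpha beta nu t.+1.
Proof. by []. Qed.

Let alpha_t_gt0 t : 0 < alpha_t alpha t.
Proof. by rewrite /alpha_t mulr_gt0 // sqrtr_gt0 ltr0n. Qed.

Lemma rSig_inv t w k : (1 <= t)%N ->
  [/\ (Sig t w k)^T = Sig t w k, posdef (Sig t w k),
   forall x, alpha * nu * cden t * dotv x x <= qform (invmx (Sig t w k)) x &
   forall x, qform (invmx (Sig t w k)) x <= prec_ub t * dotv x x].
Proof.
elim: t k => // -[_ k _|t IH k _].
  have [s p] := hSig1 k; rewrite -[Sig 1%N w k]/(Sig1 k); split => //.
    move=> x; rewrite cden1; apply: opnorm_inv_le => //.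
      by rewrite !mulr_gt0.
    by apply: le_trans (hop k); rewrite le_eqVlt; apply/orP; left; apply/eqP; ring.
  move=> x; apply: le_trans (qform_ub _ _) _.
  rewrite ler_wpM2r ?dotvv_ge0// /= (bigD1 k)//= lerDl.
  by apply: sumr_ge0 => l _; apply: sumr_ge0 => i _; apply: sumr_ge0.
have [s p lo up] := IH k isT.
have [hC1 hC2] := hC k w (ltn0Sn t).
have t0 : 0 < t.+1%:R :> R by rewrite ltr0n.
have sq0 : 0 < Num.sqrt (t.+2%:R : R) by rewrite sqrtr_gt0 ltr0n.
move: hC1; rewrite /constr_C1 scalerA => hC1.
have [sP pP h1 h2] := precision_update s p (casbo_H_sym _ _ _ _ _ k)
  (alpha_t_gt0 t.+1) nu0 hC1 hC2.
rewrite rSigS// /casbo_Sig_next /omega_t.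
rewrite -/(casbo_G _ _ _ _ _ _ _) in sP pP h1 h2.
set W := (1 *: _ + _) in sP pP h1 h2 *.
have uW := posdef_unit pP.
split.
- exact: invmx_sym.
- exact: posdef_inv.
- move=> x; rewrite invmxK; apply: le_trans (h1 x).
  apply: le_trans (lerD (lo x) (lexx _)).
  by rewrite -mulrDl ler_wpM2r ?dotvv_ge0// cden_alpha_step.
- move=> x; rewrite invmxK; apply: le_trans (h2 x) _.
  have -> : 1 + alpha_t alpha t.+1 * ((alpha_t alpha t.+1)^-1 *
      (beta_t beta t.+2 / beta_t beta t.+1 - omega_t R t.+1)) = 1 + (t.+1%:R)^-1.
    rewrite mulrA divff ?gt_eqF// mul1r /beta_t /omega_t -[t.+2%:R]natr1.
    by field; rewrite !gt_eqF.
  have -> : alpha_t alpha t.+1 * (beta_t beta t.+2 * gamma_t alpha beta nu t.+1 /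
      alpha_t alpha t.+1) = beta_t beta t.+2 * gamma_t alpha beta nu t.+1.
    by field; rewrite gt_eqF.
  rewrite prec_ubS [leRHS]mulrDl lerD2r -[leRHS]mulrA ler_wpM2l//.
Qed.

Lemma prec_ub_ge0 t : 0 <= prec_ub t.
Proof.
case: t => // t; elim: t => [|t IH].
  by apply: sumr_ge0 => l _; apply: sumr_ge0 => i _; apply: sumr_ge0.
rewrite prec_ubS addr_ge0// mulr_ge0//.
  by rewrite /beta_t mulr_ge0// ltW.
by rewrite ltW// gamma_t_gt0.
Qed.

Lemma rSig_spd t w k : (1 <= t)%N -> (Sig t w k)^T = Sig t w k /\ posdef (Sig t w k).
Proof. by move=> /(rSig_inv w k)[]. Qed.

Lemma rSig_ub t w k x : (1 <= t)%N ->
  qform (Sig t w k) x <= lam_t alpha nu t * dotv x x.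
Proof.
move=> t1; have [s p lo _] := rSig_inv w k t1.
have u := posdef_unit p.
rewrite -[Sig t w k in leLHS]invmxK; apply: qform_inv_le => //.
  by rewrite unitmx_inv.
by rewrite !mulr_gt0// cden_gt0.
Qed.

Lemma precision_growth t w k x : (1 <= t)%N ->
  (beta_t beta t.+1)^-1 * qform (invmx (Sig t.+1 w k)) x <=
  (beta_t beta t)^-1 * qform (invmx (Sig t w k)) x +
  gamma_t alpha beta nu t * dotv x x.
Proof.
move=> t1; have [s p lo up] := rSig_inv w k t1.
have [hC1 hC2] := hC k w t1.
have t0 : 0 < t%:R :> R by rewrite ltr0n.
move: hC1; rewrite /constr_C1 scalerA => hC1.
have [sP pP h1 h2] := precision_update s p (casbo_H_sym _ _ _ _ _ k)
  (alpha_t_gt0 t) nu0 hC1 hC2.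
have b0 : 0 < beta_t beta t by rewrite /beta_t mulr_gt0.
have b1 : 0 < beta_t beta t.+1 by rewrite /beta_t mulr_gt0// ltr0n.
rewrite rSigS// /casbo_Sig_next /omega_t invmxK.
rewrite -(ler_pM2l b1) mulVKf ?gt_eqF//; apply: le_trans (h2 x) _.
have -> : 1 + alpha_t alpha t * ((alpha_t alpha t)^-1 *
    (beta_t beta t.+1 / beta_t beta t - omega_t R t)) = beta_t beta t.+1 / beta_t beta t.
  by rewrite mulrA divff ?gt_eqF// mul1r /omega_t addrC subrK.
have -> : alpha_t alpha t * (beta_t beta t.+1 * gamma_t alpha beta nu t /
    alpha_t alpha t) = beta_t beta t.+1 * gamma_t alpha beta nu t.
  by field; rewrite gt_eqF.
by rewrite mulrDr !mulrA.
Qed.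

Definition past (t : nat) : set (nat * 'I_K * 'I_N * 'I_d) := [set i | (i.1.1.1 < t)%N].
Definition present (t : nat) : set (nat * 'I_K * 'I_N * 'I_d) := [set i | i.1.1.1 == t].

Lemma past_present t : past t `&` present t = set0.
Proof.
by apply/seteqP; split => // i [/= h /eqP E]; move: h; rewrite /past/= E ltnn.
Qed.

Lemma measurable_wrt_past t (Y : Om -> R) : measurable_wrt
  (fun i : {i : nat * 'I_K * 'I_N * 'I_d | (i.1.1.1 <= t)%N} =>
    zc (val i).1.1.1 (val i).1.1.2 (val i).1.2 (val i).2) Y ->
  measurable_fun setT (Y : coord_space coordX (past t.+1) -> R).
Proof.
move=> h _ C mC; rewrite setTI; have := h C mC.
apply: sub_sigma_algebra2 => E [[i /= it] [D [mD ->]]].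
by exists i, D; split.
Qed.

Lemma mmx_run t : (1 <= t)%N ->
  (forall k, mmx (fun w : coord_space coordX (past t) => mu t w k)) /\
  (forall k, mmx (fun w : coord_space coordX (past t) => Sig t w k)).
Proof.
elim: t => // -[_ _|t IH _].
  by split => k; exact: mmx_cst.
have {IH}[IHm IHS] := IH isT.
have lift m n (Y : Om -> 'M[R]_(m, n)) :
    mmx (Y : coord_space coordX (past t.+1) -> _) ->
    mmx (Y : coord_space coordX (past t.+2) -> _).
  move=> hY i j.
  apply: (@coord_space_mono _ _ _ _ coordX (past t.+1)); last exact: hY.
  by move=> x; rewrite /past /= => /ltnW.
pose T := coord_space coordX (past t.+2).
have mmu k : mmx (fun w : T => mu t.+1 w k) := lift _ _ _ (IHm k).
have mSig k : mmx (fun w : T => Sig t.+1 w k) := lift _ _ _ (IHS k).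
have mz k j : mmx (fun w : T => zv t.+1 w k j).
  move=> i l; under eq_fun do rewrite mxE.
  apply: (@coord_space_measurable _ _ _ _ coordX _ (t.+1, k, j, i)).
  by rewrite /past/=.
have mC1 k : measurable_fun setT (fun w : T => c1 t.+1 k w).
  exact: measurable_wrt_past.
have mC2 k : measurable_fun setT (fun w : T => c2 t.+1 k w).
  exact: measurable_wrt_past.
have spd (w : T) k : (Sig t.+1 w k)^T = Sig t.+1 w k /\ posdef (Sig t.+1 w k).
  exact: rSig_spd.
have ub (w : T) k x : qform (Sig t.+1 w k) x <= lam_t alpha nu t.+1 * dotv x x.
  exact: rSig_ub.
have l0 := lam_t_gt0 alpha0 nu0 t.+1.
split => k.
  under eq_fun do rewrite rmuS//.
  exact: (mmx_casbo_mu_next fL mmu mSig mz spd l0 ub).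
under eq_fun do rewrite rSigS//.
apply: (mmx_casbo_Sig_next fL mmu mSig mz mC1 mC2 spd l0 ub) => w.
have [_ p _ _] := @rSig_inv t.+2 w k isT.
by have := posdef_unit p; rewrite rSigS// /casbo_Sig_next unitmx_inv.
Qed.

Definition zidx (t : nat) (i : 'I_K) (j : 'I_N) (a : 'I_(i.+1 * d)) :
    nat * 'I_K * 'I_N * 'I_d :=
  let: (l, m) := enum_val (cast_ord (esym (mxvec_cast i.+1 d)) a) in
  (t, widen_ord (ltn_ord i) l, j, m).

Lemma zidxE t i j l m :
  @zidx t i j (mxvec_index l m) = (t, widen_ord (ltn_ord i) l, j, m).
Proof. by rewrite /zidx /mxvec_index cast_ordK enum_rankK. Qed.

Lemma zidx_inj t i j : injective (@zidx t i j).
Proof.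
move=> a b; case/mxvec_indexP: a => l m; case/mxvec_indexP: b => l' m'.
rewrite !zidxE => -[El ->]; congr mxvec_index; apply/val_inj.
exact: El.
Qed.

Lemma zcatE t w i j : zcat (zv t w) i j = gvec coordX (@zidx t i j) w.
Proof.
by apply: eq_cV_mxvec => l m; rewrite catvE !mxE zidxE.
Qed.

Definition noise4 t w : R := \sum_(i < K) K%:R * L i ^+ 2 *
  (N%:R^-1 * \sum_(j < N) dotv (zcat (zv t w) i j) (zcat (zv t w) i j) ^+ 2).

Lemma noise4_moment t : intg P (noise4 t) /\
  Ex P (noise4 t) <= \sum_(i < K) K%:R * L i ^+ 2 * ((i.+1 * d)%:R + 1) ^+ 2.
Proof.
have h i j : intg P (fun w => dotv (zcat (zv t w) i j) (zcat (zv t w) i j) ^+ 2) /\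
    Ex P (fun w => dotv (zcat (zv t w) i j) (zcat (zv t w) i j) ^+ 2) <=
    ((i.+1 * d)%:R + 1) ^+ 2.
  under eq_fun do rewrite zcatE.
  exact: (gvec_moment4 indX nX (@zidx_inj t i j)).
have is0 i : intg P (fun w =>
    \sum_(j < N) dotv (zcat (zv t w) i j) (zcat (zv t w) i j) ^+ 2).
  by apply: intg_sum => j _; exact: (h i j).1.
have is1 i := intgZ N%:R^-1 (is0 i).
split; first by apply: intg_sum => i _; exact: (intgZ _ (is1 i)).
rewrite Ex_sum => [|i _]; last exact: (intgZ _ (is1 i)).
apply: ler_sum => i _; rewrite (ExZ _ (is1 i)) (ExZ _ (is0 i)).
apply: ler_wpM2l; first by rewrite mulr_ge0 ?sqr_ge0.
rewrite ler_pdivrMl ?ltr0n// Ex_sum => [|j _]; last exact: (h i j).1.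
apply: le_trans (ler_sum _ (fun j _ => (h i j).2)) _.
by rewrite sumr_const card_ord -[leLHS]mulr_natl.
Qed.

Lemma measurable_rmu t k : (1 <= t)%N -> mmx (fun w => mu t w k).
Proof.
move=> t1 i j; apply: (coord_space_sub mX (A := past t)).
exact: (mmx_run t1).1.
Qed.

Lemma rmu_intg t k : (1 <= t)%N -> intg P (fun w => dotv (mu t w k) (mu t w k)).
Proof.
elim: t k => // -[_ k _|t IH k _].
  exact: (intg_cst P (dotv (mu1 k) (mu1 k))).
have {}IH := IH k isT; set l := lam_t alpha nu t.+1.
have l0 : 0 < l by exact: lam_t_gt0.
set b := beta_t beta t.+1; set g := gamma_t alpha beta nu t.+1.
apply: (@intg_dom _ _ _ P _ (fun w => (2 + 4 * b ^+ 2 * l ^+ 2 * g ^+ 2) *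
    dotv (mu t.+1 w k) (mu t.+1 w k) + (4 * b ^+ 2 * l ^+ 2) * noise4 t.+1 w)).
- by apply: measurable_dotv; exact: measurable_rmu.
- by apply: intgD; apply: intgZ => //; exact: (noise4_moment _).1.
move=> w; rewrite ger0_norm ?dotvv_ge0// rmuS// /casbo_mu_next.
set m := mu t.+1 w k; set S := Sig t.+1 w k.
rewrite -/(gsum f (mu t.+1 w) (Sig t.+1 w) (zv t.+1 w) k) -/b -/g.
set v := gsum _ _ _ _ k; set y := g *: m + v.
have spd k' := @rSig_spd t.+1 w k' isT.
have [s p] := spd k.
have ub k' x : qform (Sig t.+1 w k') x <= l * dotv x x by exact: rSig_ub.
have h1 : dotv (m - b *: (S *m y)) (m - b *: (S *m y)) <=
    2 * dotv m m + 2 * (b ^+ 2 * dotv (S *m y) (S *m y)).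
  have := dotvv_ge0 (m + b *: (S *m y)); rewrite !dotv_lin (dotvC (S *m y) m).
  by clear s; lra.
have h2 : dotv (S *m y) (S *m y) <= l * qform S y.
  by apply: dotv_mul_le => //; exact: ub.
have h3 : qform S y <= 2 * (g ^+ 2 * (l * dotv m m)) + 2 * qform S v.
  have := psd_young (g *: m) v s (posdef_psd p) (@ltr01 R); rewrite invr1 -/y.
  have -> : qform S (g *: m) = g ^+ 2 * qform S m.
    by rewrite !qformE -scalemxAr !dotv_lin; ring.
  have := ler_wpM2l (sqr_ge0 g) (ub k m); rewrite -/S.
  by clear s; lra.
have h4 : qform S v <= l * noise4 t.+1 w.
  have := gsum_qform_le fL (mu t.+1 w) (zv t.+1 w) spd N0 ub (ltW l0).
  apply: le_trans; rewrite (bigD1 k)//= -/v -/S lerDl.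
  by apply: sumr_ge0 => k' _; apply: posdef_psd; exact: (spd k').2.
apply: le_trans h1 _.
have k3 : b ^+ 2 * dotv (S *m y) (S *m y) <=
    b ^+ 2 * (l * (2 * (g ^+ 2 * (l * dotv m m)) + 2 * (l * noise4 t.+1 w))).
  rewrite ler_wpM2l ?sqr_ge0//; apply: le_trans h2 _.
  apply: ler_wpM2l; first exact: ltW.
  by apply: le_trans h3 _; rewrite lerD2l ler_wpM2l.
by clear s; lra.
Qed.

Lemma mmx_comp (d1 d2 : measure_display) (T1 : measurableType d1)
    (T2 : measurableType d2) m n (Y : T2 -> 'M[R]_(m, n)) (g : T1 -> T2) :
  measurable_fun setT g -> mmx Y -> mmx (fun w => Y (g w)).
Proof. by move=> mg mY i j; exact: (measurableT_comp (mY i j) mg). Qed.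

Lemma intg_f t i : (1 <= t)%N -> intg P (fun w => f i (catv (pre i (mu t w)))).
Proof.
move=> t1; apply: (@intg_dom _ _ _ P _ (fun w => `|f i 0| + L i * (1 +
    \sum_(l < i.+1) dotv (mu t w (widen_ord (ltn_ord i) l))
                         (mu t w (widen_ord (ltn_ord i) l))))).
- apply: (measurable_lipschitz (@fL i)); apply: mmx_catv => l.
  exact: measurable_rmu.
- apply: intgD; first exact: intg_cst.
  apply: intgZ; apply: intgD; first exact: intg_cst.
  by apply: intg_sum => l _; exact: rmu_intg.
move=> w; set x := catv _.
have E : \sum_(l < i.+1) dotv (mu t w (widen_ord (ltn_ord i) l))
    (mu t w (widen_ord (ltn_ord i) l)) = enorm x ^+ 2.
  by rewrite enorm_sqr dotv_catv.
rewrite E; have := fL x 0; rewrite subr0 => h.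
have -> : f i x = f i 0 + (f i x - f i 0) by rewrite addrC subrK.
apply: le_trans (ler_normD _ _) _; rewrite lerD2l; apply: le_trans h _.
rewrite ler_wpM2l ?lipschitz_cst_ge0//.
have := sqr_ge0 (enorm x - 1); have := sqr_ge0 (enorm x); lra.
Qed.

Section InnerProduct.
Variables (t : nat) (i : 'I_K) (j : 'I_N).
Hypothesis t1 : (1 <= t)%N.
Local Notation n := (i.+1 * d)%N.
Local Notation Z := (gvec coordX (@zidx t i j)).
Local Notation lam := (lam_t alpha nu t).

Let lam0 : 0 < lam. Proof. exact: lam_t_gt0. Qed.
Let Li0 : 0 <= L i. Proof. exact: lipschitz_cst_ge0. Qed.
Let mm w : 'cV[R]_n := catv (pre i (mu t w)).
Let fstar := f i (catv (pre i mustar)).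
Let av w : 'cV[R]_n := shiftv (mu t w) (Sig t w) mustar i.
Let Am w : 'M[R]_n := sqrtB (Sig t w) i.
Let phi w z := f i (mm w + Am w *m z) - f i (mm w).
Let h w w' := (- dotv (av w) (Z w')) * phi w (Z w').

Let spd w k : (Sig t w k)^T = Sig t w k /\ posdef (Sig t w k).
Proof. exact: rSig_spd. Qed.

Let ub w k x : qform (Sig t w k) x <= lam * dotv x x.
Proof. exact: rSig_ub. Qed.

Let M := L i * Num.sqrt lam.
Let M0 : 0 <= M. Proof. by rewrite mulr_ge0 ?sqrtr_ge0. Qed.

Let phiL w x y : `|phi w x - phi w y| <= M * enorm (x - y).
Proof.
rewrite /phi opprB addrA subrK; apply: le_trans (fL _ _) _.
rewrite opprD addrACA subrr add0r -mulmxBr -mulrA ler_wpM2l//.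
by apply: enorm_sqrtB_le => //; rewrite ltW.
Qed.

Let phiC w x y s : 0 <= s <= 1 ->
  phi w (s *: x + (1 - s) *: y) <= s * phi w x + (1 - s) * phi w y.
Proof.
move=> s01; rewrite /phi.
have -> : mm w + Am w *m (s *: x + (1 - s) *: y) =
   s *: (mm w + Am w *m x) + (1 - s) *: (mm w + Am w *m y).
  rewrite mulmxDr -!scalemxAr !scalerDr addrACA -scalerDl.
  by rewrite [s + (1 - s)]addrC subrK scale1r.
have := fC (mm w + Am w *m x) (mm w + Am w *m y) s01; lra.
Qed.

Let phi0 w : phi w 0 = 0.
Proof. by rewrite /phi mulmx0 addr0 subrr. Qed.

Let phi_le w z : `|phi w z| <= M * enorm z.
Proof. by have := phiL w z 0; rewrite phi0 !subr0. Qed.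

Let jensen_shift w :
  f i (mm w) - fstar - L i * Num.sqrt lam * n%:R <= Ex P (h w).
Proof.
have inj := @zidx_inj t i j.
have C := gvec_convex indX nX inj (phiC w) (phiL w) M0 (av w).
have J := gvec_jensen indX nX inj (phiC w) (phiL w) M0; rewrite phi0 in J.
have i1 := gvec_intg_dotv_phi indX nX inj (phiL w) M0 (av w).
have i2 := gvec_intg_phi indX nX inj (phiL w) M0 (av w).
have [i3 m2] := gvec_moment2 nX (@zidx t i j).
have E : Ex P (h w) = - Ex P (fun w' => dotv (av w) (Z w') * phi w (Z w')).
  by rewrite -ExN//; congr (Ex P); apply/funext => w'; rewrite /h mulNr.
have S : Ex P (fun w' => phi w (Z w' + av w)) <=
    Ex P (fun w' => (fstar - f i (mm w) + M / 2) + M / 2 * dotv (Z w') (Z w')).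
  apply: Ex_le => //; first by apply: intgD; [exact: intg_cst|exact: intgZ].
  move=> w'; rewrite /phi mulmxDr addrCA.
  have -> : mm w + Am w *m av w = catv (pre i mustar) by exact: sqrtB_shiftv.
  have := fL (Am w *m Z w' + catv (pre i mustar)) (catv (pre i mustar)).
  rewrite addrK -/fstar => /(le_trans (ler_norm _)) q1.
  have q2 : enorm (Am w *m Z w') <= Num.sqrt lam * enorm (Z w').
    by apply: enorm_sqrtB_le => //; rewrite ltW.
  have q3 := ler_wpM2l Li0 q2; rewrite mulrA -/M in q3.
  have q4 : M * enorm (Z w') <= M * ((1 + dotv (Z w') (Z w')) / 2).
    rewrite ler_wpM2l// -enorm_sqr.
    by have := sqr_ge0 (enorm (Z w') - 1); lra.
  lra.
rewrite (ExD (intg_cst P _) (intgZ _ i3)) Ex_cst (ExZ _ i3) in S.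
rewrite E -/M.
have n1 : (1 : R) <= n%:R by rewrite ler1n muln_gt0.
have k1 := ler_wpM2l (divr_ge0 M0 (ler0n R 2)) m2.
have k2 := ler_wpM2l M0 n1.
lra.
Qed.

Let av_bound w : dotv (av w) (av w) <= prec_ub t *
  \sum_(l < i.+1) dotv (mustar (widen_ord (ltn_ord i) l) - mu t w (widen_ord (ltn_ord i) l))
    (mustar (widen_ord (ltn_ord i) l) - mu t w (widen_ord (ltn_ord i) l)).
Proof.
rewrite /av /shiftv dotv_catv mulr_sumr; apply: ler_sum => l _.
rewrite /pre; set k := widen_ord _ l.
have [s p] := spd w k; rewrite -isqrtmx_qform//.
by have [_ _ _] := rSig_inv w k t1; apply.
Qed.

Let mPast k : mmx (fun w : coord_space coordX (past t) => mu t w k).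
Proof. exact: (mmx_run t1).1. Qed.

Let mPastS k : mmx (fun w : coord_space coordX (past t) => Sig t w k).
Proof. exact: (mmx_run t1).2. Qed.

Let spd' (w : coord_space coordX (past t)) k :
  (Sig t w k)^T = Sig t w k /\ posdef (Sig t w k).
Proof. exact: spd. Qed.

Let ub' (w : coord_space coordX (past t)) k x :
  qform (Sig t w k) x <= lam * dotv x x.
Proof. exact: ub. Qed.

Let mav : mmx (av : coord_space coordX (past t) -> 'cV[R]_n).
Proof.
apply: mmx_catv => l; rewrite /pre; apply: mmxM.
  exact: (mmx_isqrtSig mPastS spd' lam0 ub').
by apply: mmxB; [exact: mmx_cst|exact: mPast].
Qed.

Let mZ : mmx (Z : coord_space coordX (present t) -> 'cV[R]_n).
Proof.
move=> a b; under eq_fun do rewrite mxE.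
apply: coord_space_measurable.
by case/mxvec_indexP: a => l m; rewrite zidxE /present /=.
Qed.

Let pT := (coord_space coordX (past t) * coord_space coordX (present t))%type.

Let mh : measurable_fun setT (fun p : pT => h p.1 p.2).
Proof.
have mav2 : mmx (fun p : pT => av p.1) := mmx_comp measurable_fst mav.
have mZ2 : mmx (fun p : pT => Z p.2) := mmx_comp measurable_snd mZ.
have mmm : mmx (fun p : pT => mm p.1).
  apply: (mmx_comp measurable_fst (Y := (mm : coord_space coordX (past t) -> _))).
  by apply: mmx_catv => l; exact: mPast.
have mA : mmx (fun p : pT => Am p.1 *m Z p.2).
  have E (p : pT) : Am p.1 *m Z p.2 =
      catv (fun l => sqrtmx (Sig t p.1 (widen_ord (ltn_ord i) l)) *m blockv (Z p.2) l).
    by rewrite -[in LHS](blockvK (Z p.2)) /Am /sqrtB bdiag_catv.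
  under eq_fun do rewrite E.
  apply: mmx_catv => l; apply: mmxM.
    have := mmx_sqrtSig mPastS spd' lam0 ub' (widen_ord (ltn_ord i) l).
    exact: (mmx_comp measurable_fst).
  by move=> a b; under eq_fun do rewrite mxE; exact: mZ2.
apply: measurable_funM.
  by apply: measurable_funN; exact: measurable_dotv.
apply: measurable_funB.
  by apply: (measurable_lipschitz (@fL i)); exact: mmxD.
exact: (measurable_lipschitz (@fL i)).
Qed.

Lemma inner_lower :
  intg P (fun w => (- dotv (shiftv (mu t w) (Sig t w) mustar i) (zcat (zv t w) i j)) *
     incr f (mu t w) (Sig t w) (zv t w) i j) /\
  Ex P (fun w => f i (catv (pre i (mu t w)))) - f i (catv (pre i mustar))
    - L i * Num.sqrt lam * n%:R <=
  Ex P (fun w => (- dotv (shiftv (mu t w) (Sig t w) mustar i) (zcat (zv t w) i j)) *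
     incr f (mu t w) (Sig t w) (zv t w) i j).
Proof.
have inj := @zidx_inj t i j.
have E w : (- dotv (shiftv (mu t w) (Sig t w) mustar i) (zcat (zv t w) i j)) *
     incr f (mu t w) (Sig t w) (zv t w) i j = h w w.
  by rewrite /h /phi /incr catv_casbo_x zcatE.
under eq_fun do rewrite E.
pose u w := dotv (av w) (av w).
pose v w := M ^+ 2 * dotv (Z w) (Z w) ^+ 2.
have mu' : measurable_fun setT (u : coord_space coordX (past t) -> R).
  exact: measurable_dotv.
have mv : measurable_fun setT (v : coord_space coordX (present t) -> R).
  apply: measurable_funM; first exact: measurable_cst.
  by apply: measurable_funX; exact: measurable_dotv.
have iu : intg P u.
  apply: (@intg_dom _ _ _ P _ (fun w => prec_ub t * \sum_(l < i.+1)
     (2 * dotv (mustar (widen_ord (ltn_ord i) l)) (mustar (widen_ord (ltn_ord i) l)) +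
      2 * dotv (mu t w (widen_ord (ltn_ord i) l)) (mu t w (widen_ord (ltn_ord i) l))))).
  - exact: (coord_space_sub mX mu').
  - apply: intgZ; apply: intg_sum => l _; apply: intgD; first exact: intg_cst.
    by apply: intgZ; exact: rmu_intg.
  move=> w; rewrite ger0_norm ?dotvv_ge0//; apply: le_trans (av_bound w) _.
  rewrite !mulr_sumr; apply: ler_sum => l _; set k := widen_ord _ l.
  have [s p _ up] := rSig_inv w k t1.
  have P0 : 0 <= prec_ub t by exact: prec_ub_ge0.
  rewrite ler_wpM2l//.
  have := dotvv_ge0 (mustar k + mu t w k); rewrite !dotv_lin (dotvC (mu t w k)).
  by clear s; lra.
have iv : intg P v by apply: intgZ; exact: (gvec_moment4 indX nX inj).1.
have iff := intg_f i t1.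
have ipsi : intg P (fun w => f i (mm w) - (fstar + L i * Num.sqrt lam * n%:R)).
  by apply: intgB => //; exact: intg_cst.
have hb w w' : `|h w w'| <= u w + v w'.
  rewrite /h normrM normrN /u /v -!enorm_sqr.
  have h1 := dotv_le_enorm (av w) (Z w'); have h2 := phi_le w (Z w').
  apply: le_trans (ler_pM (normr_ge0 _) (normr_ge0 _) h1 h2) _.
  have := sqr_ge0 (enorm (av w) - M * enorm (Z w') ^+ 2).
  have := sqr_ge0 (enorm (av w)); have := sqr_ge0 (M * enorm (Z w') ^+ 2).
  lra.
have [] := @Ex_decouple_ge _ _ _ P _ coordX indX mX (past t) (present t) h
  (fun w => f i (mm w) - (fstar + L i * Num.sqrt lam * n%:R)) u v
  (past_present t) mh mu' mv hb iu iv ipsi.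
  by move=> w; rewrite opprD addrA; exact: jensen_shift.
move=> ih; rewrite (ExB iff (intg_cst P _)) Ex_cst opprD addrA => hle.
by split.
Qed.

End InnerProduct.

Let beta_t_gt0 t : (1 <= t)%N -> 0 < beta_t beta t.
Proof. by move=> t1; rewrite /beta_t mulr_gt0// ltr0n. Qed.

Definition inner t w : R := \sum_k dotv (gsum f (mu t w) (Sig t w) (zv t w) k)
  (mu t w k - mustar k).

Lemma inner_sum_le w T : (1 <= T)%N -> \sum_(1 <= t < T.+1) inner t w <=
  (\sum_k qform (invmx (Sig1 k)) (mu1 k - mustar k)) / (2 * beta) +
  (\sum_k dotv (mustar k) (mustar k)) * (alpha * nu / beta * Num.sqrt (T.+2%:R)) +
  \sum_(1 <= t < T.+1) (1 + (young_t t)^-1) / 2 *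
    (beta_t beta t * (lam_t alpha nu t * noise4 t w)).
Proof.
move=> T1.
pose V t := (beta_t beta t)^-1 * \sum_k qform (invmx (Sig t w k)) (mu t w k - mustar k).
pose U t := (beta_t beta t)^-1 *
  \sum_k qform (invmx (Sig t w k)) (mu t.+1 w k - mustar k).
pose Dq t := \sum_k dotv (mu t w k - mustar k) (mu t w k - mustar k).
pose Nq t := \sum_k dotv (mu t w k) (mu t w k).
pose Gn t := \sum_k qform (Sig t w k) (gsum f (mu t w) (Sig t w) (zv t w) k).
pose Bs := \sum_k dotv (mustar k) (mustar k).
have Bs0 : 0 <= Bs by apply: sumr_ge0 => k _; exact: dotvv_ge0.
have U0 t : 0 <= U t.
  case: t => [|t]; first by rewrite /U /beta_t mul0r invr0 mul0r.
  apply: mulr_ge0; first by rewrite invr_ge0 ltW// beta_t_gt0.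
  apply: sumr_ge0 => k _.
  have [s p] := @rSig_spd t.+1 w k isT.
  by apply: posdef_psd; exact: posdef_inv.
have Nq0 t : 0 <= Nq t by apply: sumr_ge0 => k _; exact: dotvv_ge0.
have Dq0 t : 0 <= Dq t by apply: sumr_ge0 => k _; exact: dotvv_ge0.
have DN t : Dq t <= 2 * Nq t + 2 * Bs.
  rewrite !mulr_sumr -big_split/=; apply: ler_sum => k _.
  have := dotvv_ge0 (mu t w k + mustar k); rewrite !dotv_lin (dotvC (mustar k)).
  lra.
have h1 t : (1 <= t)%N -> U t <= V t - 2 * inner t w
     - gamma_t alpha beta nu t * (Nq t + Dq t - Bs)
     + beta_t beta t * ((1 + young_t t) * (gamma_t alpha beta nu t ^+ 2 *
         (lam_t alpha nu t * Nq t)) + (1 + (young_t t)^-1) * Gn t).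
  move=> t1; rewrite /U mulr_sumr.
  set b := beta_t beta t; set g := gamma_t alpha beta nu t; set r := young_t t.
  pose v k := gsum f (mu t w) (Sig t w) (zv t w) k.
  have hk k : b^-1 * qform (invmx (Sig t w k)) (mu t.+1 w k - mustar k) <=
      b^-1 * qform (invmx (Sig t w k)) (mu t w k - mustar k)
      - 2 * dotv (v k) (mu t w k - mustar k)
      - g * (dotv (mu t w k) (mu t w k) +
             dotv (mu t w k - mustar k) (mu t w k - mustar k) -
             dotv (mustar k) (mustar k))
      + b * ((1 + r) * (g ^+ 2 * (lam_t alpha nu t * dotv (mu t w k) (mu t w k))) +
             (1 + r^-1) * qform (Sig t w k) (v k)).
    have [s p] := rSig_spd w k t1; rewrite rmuS//; apply: mean_update => //.
    - exact: beta_t_gt0.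
    - exact: young_t_gt0.
    - by rewrite ltW// gamma_t_gt0.
    - by move=> x; exact: rSig_ub.
  apply: le_trans (ler_sum _ (fun k _ => hk k)) _.
  rewrite !(big_split, sumrN)/= -!mulr_sumr !(big_split, sumrN)/= -!mulr_sumr.
  by rewrite /V /inner /Nq /Dq /Bs /Gn.
have h2 t : (1 <= t)%N -> V t.+1 <= U t + gamma_t alpha beta nu t * Dq t.+1.
  move=> t1; rewrite /V /U /Dq !mulr_sumr -big_split/=; apply: ler_sum => k _.
  exact: precision_growth.
have := descent_sum alpha0 beta0 nu0 Bs0 U0 Nq0 Dq0 DN h1 h2 T1.
have -> : V 1%N / 2 =
    (\sum_k qform (invmx (Sig1 k)) (mu1 k - mustar k)) / (2 * beta).
  rewrite -[V 1%N]/((1%:R * beta)^-1 *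
    \sum_k qform (invmx (Sig1 k)) (mu1 k - mustar k)) mul1r.
  by field; rewrite gt_eqF.
move=> /le_trans; apply; rewrite lerD2l; apply: ler_sum_nat => t /andP[t1 _].
have y0 := @young_t_gt0 R t.
have b0 := beta_t_gt0 t1.
apply: ler_wpM2l; first by rewrite divr_ge0// addr_ge0// invr_ge0 ltW.
apply: ler_wpM2l; first exact: ltW.
have spd k := rSig_spd w k t1; have ub k x := rSig_ub w k x t1.
exact: (gsum_qform_le fL (mu t w) (zv t w) spd N0 ub (ltW (lam_t_gt0 alpha0 nu0 t))).
Qed.

Lemma inner_Ex_ge t : (1 <= t)%N -> intg P (inner t) /\
  \sum_(i < K) (Ex P (fun w => f i (catv (pre i (mu t w)))) - f i (catv (pre i mustar))
    - L i * Num.sqrt (lam_t alpha nu t) * (i.+1 * d)%:R) <= Ex P (inner t).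
Proof.
move=> t1.
pose F i j w := (- dotv (shiftv (mu t w) (Sig t w) mustar i) (zcat (zv t w) i j)) *
     incr f (mu t w) (Sig t w) (zv t w) i j.
have E : inner t = (fun w => \sum_(i < K) N%:R^-1 * \sum_(j < N) F i j w).
  apply/funext => w; apply: gsum_inner => k; exact: rSig_spd.
have iF i j : intg P (F i j) by exact: (inner_lower i j t1).1.
have iS i : intg P (fun w => \sum_(j < N) F i j w) by exact: intg_sum.
have iN i := intgZ N%:R^-1 (iS i).
rewrite E; split; first exact: intg_sum.
rewrite Ex_sum//; apply: ler_sum => i _; rewrite (ExZ _ (iS i)) Ex_sum//.
rewrite ler_pdivlMl ?ltr0n//.
apply: le_trans (ler_sum _ (fun j _ => (inner_lower i j t1).2)).
by rewrite sumr_const card_ord -[leRHS]mulr_natl.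
Qed.

Lemma expected_regret_le T : (1 <= T)%N ->
  \sum_(1 <= t < T.+1) \sum_(i < K)
    (Ex P (fun w => f i (catv (pre i (mu t w)))) - f i (catv (pre i mustar))) <=
  (\sum_k qform (invmx (Sig1 k)) (mu1 k - mustar k)) / (2 * beta) +
  (\sum_k dotv (mustar k) (mustar k)) * (alpha * nu / beta * Num.sqrt (T.+2%:R)) +
  beta / (alpha * nu) * (3 * Num.sqrt (T%:R)) *
    (\sum_(i < K) K%:R * L i ^+ 2 * ((i.+1 * d)%:R + 1) ^+ 2) +
  Num.sqrt 3 / Num.sqrt (alpha * nu) * (4 * Num.sqrt (Num.sqrt (T%:R))) *
    (\sum_(i < K) (i.+1 * d)%:R * L i).
Proof.
move=> T1; set Q := \sum_(i < K) K%:R * _ * _; set LN := \sum_(i < K) (i.+1 * d)%:R * _.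
have Q0 : 0 <= Q.
  by apply: sumr_ge0 => i _; rewrite mulr_ge0 ?sqr_ge0// mulr_ge0 ?sqr_ge0.
have LN0 : 0 <= LN.
  by apply: sumr_ge0 => i _; rewrite mulr_ge0// lipschitz_cst_ge0.
pose A := (\sum_k qform (invmx (Sig1 k)) (mu1 k - mustar k)) / (2 * beta) +
  (\sum_k dotv (mustar k) (mustar k)) * (alpha * nu / beta * Num.sqrt (T.+2%:R)).
pose c t : R := (1 + (young_t t)^-1) / 2 * (beta_t beta t * lam_t alpha nu t).
have c0 t : 0 <= c t.
  rewrite /c mulr_ge0//.
    by rewrite divr_ge0// addr_ge0// invr_ge0 ltW// young_t_gt0.
  by rewrite mulr_ge0 ?(ltW (lam_t_gt0 _ _ _))// /beta_t mulr_ge0// ltW.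
have i4 t := (noise4_moment t).1; have m4 t := (noise4_moment t).2.
have up : \sum_(1 <= t < T.+1) Ex P (inner t) <= A + (\sum_(1 <= t < T.+1) c t) * Q.
  have I1 t : (1 <= t < T.+1)%N -> intg P (inner t).
    by move=> /andP[t1 _]; exact: (inner_Ex_ge t1).1.
  have I2 : intg P (fun w => \sum_(1 <= t < T.+1) inner t w).
    under eq_fun do rewrite big_nat.
    by apply: intg_sum => t; exact: I1.
  have -> : \sum_(1 <= t < T.+1) Ex P (inner t) =
      Ex P (fun w => \sum_(1 <= t < T.+1) inner t w).
    under [in RHS]eq_fun do rewrite big_nat.
    by rewrite Ex_sum// big_nat.
  have I3 : intg P (fun w => \sum_(1 <= t < T.+1) c t * noise4 t w).
    by apply: intg_sum => t _; exact: intgZ.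
  apply: le_trans (_ : Ex P (fun w => A + \sum_(1 <= t < T.+1) c t * noise4 t w) <= _).
    apply: Ex_le => //; first by apply: intgD => //; exact: intg_cst.
    move=> w; apply: le_trans (inner_sum_le w T1) _; rewrite -/A lerD2l.
    by apply: ler_sum => t _; rewrite /c !mulrA.
  rewrite (ExD (intg_cst P A) I3) Ex_cst lerD2l Ex_sum => [|t _]; last exact: intgZ.
  rewrite mulr_suml; apply: ler_sum => t _; rewrite ExZ//.
  exact: ler_wpM2l.
have lo : \sum_(1 <= t < T.+1) \sum_(i < K)
    (Ex P (fun w => f i (catv (pre i (mu t w)))) - f i (catv (pre i mustar))) -
    (\sum_(1 <= t < T.+1) Num.sqrt (lam_t alpha nu t)) * LN <=
    \sum_(1 <= t < T.+1) Ex P (inner t).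
  rewrite mulr_suml -sumrB; apply: ler_sum_nat => t /andP[t1 _].
  apply: le_trans (inner_Ex_ge t1).2.
  rewrite mulr_sumr -sumrB; apply: ler_sum => i _.
  by rewrite lerD2l lerN2 le_eqVlt; apply/orP; left; apply/eqP; ring.
have n1 := ler_wpM2r Q0 (sum_noise alpha0 beta0 nu0 T1).
have n2 := ler_wpM2r LN0 (sum_bias alpha0 nu0 T).
rewrite -/A; have {}n1 : (\sum_(1 <= t < T.+1) c t) * Q <=
  beta / (alpha * nu) * (3 * Num.sqrt T%:R) * Q by exact: n1.
lra.
Qed.

End RandomRunBounds.

(** * The convergence rate *)

Section Rate.
Context {R : realType}.

Lemma rate_bound (d K T : nat) (L : 'I_K -> R) (alpha beta nu Rb B Lm q0 : R) :
  (0 < d)%N -> (0 < K)%N -> (1 <= T)%N -> 0 < alpha -> 0 < beta -> 0 < nu ->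
  0 <= q0 <= Rb -> 0 <= B -> (forall i, 0 <= L i <= Lm) -> 0 <= Lm ->
  q0 / (2 * beta * T%:R)
  + 2 * Num.sqrt (T.+1%:R) *
    (3 * beta * (\sum_(i < K) K%:R * L i ^+ 2 * ((i.+1 * d)%:R + 1) ^+ 2)
              / (2 * alpha * nu)) / T%:R
  + 4 * Num.sqrt (Num.sqrt (T.+1%:R)) *
    ((\sum_(i < K) Num.sqrt 3 * (i.+1 * d)%:R * L i) / Num.sqrt (alpha * nu)) / T%:R
  + Num.sqrt (T.+2%:R) * (alpha * nu * B / beta) / T%:R <=
  (Rb / (2 * beta) + 24 * beta * Lm ^+ 2 / (alpha * nu)
   + 8 * Num.sqrt 3 * Lm / Num.sqrt (alpha * nu) + 2 * (alpha * nu * B / beta)) *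
  ((d ^ 2 * K ^ 4)%:R / Num.sqrt T%:R).
Proof.
move=> d0 K0 T1 a0 b0 n0 /andP[q00 q0R] B0 hL Lm0.
have an0 : 0 < alpha * nu by rewrite mulr_gt0.
set D : R := (d ^ 2 * K ^ 4)%:R.
have D1 : 1 <= D by rewrite ler1n muln_gt0 !expn_gt0 d0 K0.
have s0 : 0 < Num.sqrt (T%:R : R) by rewrite sqrtr_gt0 ltr0n.
have s1 : 1 <= Num.sqrt (T%:R : R) by rewrite -[X in X <= _]sqrtr1 ler_wsqrtr// ler1n.
have sE : Num.sqrt (T%:R : R) ^+ 2 = T%:R by rewrite sqr_sqrtr.
have two m : (m <= 4 * T)%N -> Num.sqrt (m%:R : R) <= 2 * Num.sqrt T%:R.
  move=> mT; rewrite -(@ler_pXn2r _ 2%N) ?nnegrE ?sqrtr_ge0 ?mulr_ge0 ?sqrtr_ge0//.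
  by rewrite exprMn sE sqr_sqrtr// -natrX -natrM ler_nat.
have h1 : Num.sqrt (T.+1%:R : R) <= 2 * Num.sqrt T%:R.
  by apply: two; rewrite mulSn -addn1 leq_add2l (leq_trans T1)// leq_pmull.
have h2 : Num.sqrt (T.+2%:R : R) <= 2 * Num.sqrt T%:R.
  apply: two; rewrite -addn2 mulSn leq_add2l.
  by rewrite (leq_trans (_ : 2 <= 3 * 1)%N)// leq_mul2l.
have h3 : Num.sqrt (Num.sqrt (T.+1%:R : R)) <= 2 * Num.sqrt T%:R.
  apply: le_trans h1; set r := Num.sqrt (T.+1%:R : R).
  have r1 : 1 <= r by rewrite -[X in X <= _]sqrtr1 ler_wsqrtr// ler1n.
  rewrite -[leRHS](@ger0_norm _ r) ?(le_trans ler01)// -sqrtr_sqr ler_wsqrtr//.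
  by rewrite expr2 ler_peMl// (le_trans ler01).
have nb (i : 'I_K) : ((i.+1 * d)%:R : R) <= (K * d)%:R.
  by rewrite ler_nat leq_mul2r ltn_ord orbT.
have kd1 : 1 <= (K * d)%:R :> R by rewrite ler1n muln_gt0 K0.
have S1 : \sum_(i < K) K%:R * L i ^+ 2 * ((i.+1 * d)%:R + 1) ^+ 2 <= 4 * Lm ^+ 2 * D.
  apply: le_trans (_ : \sum_(i < K) K%:R * Lm ^+ 2 * (2 * (K * d)%:R) ^+ 2 <= _).
    apply: ler_sum => i _; have /andP[L0 LM] := hL i.
    apply: ler_pM; rewrite ?mulr_ge0 ?sqr_ge0//.
      by rewrite ler_wpM2l// ler_sqr ?nnegrE.
    rewrite ler_sqr ?nnegrE ?addr_ge0 ?mulr_ge0//.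
    have := nb i; lra.
  rewrite sumr_const card_ord -[leLHS]mulr_natl /D (natrM _ (d ^ 2)) !natrX natrM.
  by rewrite le_eqVlt; apply/orP; left; apply/eqP; ring.
have S2 : \sum_(i < K) Num.sqrt 3 * (i.+1 * d)%:R * L i <= Num.sqrt 3 * Lm * D.
  apply: le_trans (_ : \sum_(i < K) Num.sqrt 3 * (K * d)%:R * Lm <= _).
    apply: ler_sum => i _; have /andP[L0 LM] := hL i.
    by apply: ler_pM; rewrite ?mulr_ge0 ?sqrtr_ge0// ler_wpM2l ?sqrtr_ge0.
  rewrite sumr_const card_ord -[leLHS]mulr_natl.
  rewrite [leLHS](_ : _ = Num.sqrt 3 * Lm * (K%:R * (K * d)%:R)); last by ring.
  apply: ler_wpM2l; first by rewrite mulr_ge0 ?sqrtr_ge0.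
  rewrite -natrM ler_nat mulnA mulnC; apply: leq_mul.
    by rewrite -{1}[d]expn1 leq_pexp2l.
  by rewrite mulnn leq_pexp2l.
set sT := Num.sqrt T%:R in s0 s1 sE h1 h2 h3 *.
set t1 := Num.sqrt T.+1%:R in h1 h3 *; set t2 := Num.sqrt T.+2%:R in h2 *.
set t3 := Num.sqrt t1 in h3 *.
set A := \sum_(i < K) _ in S1 *; set C := \sum_(i < K) _ in S2 *.
set an := Num.sqrt (alpha * nu).
have an1 : 0 < an by rewrite sqrtr_gt0.
have A0 : 0 <= A.
  by apply: sumr_ge0 => i _; rewrite mulr_ge0 ?sqr_ge0// mulr_ge0 ?sqr_ge0.
have C0 : 0 <= C.
  apply: sumr_ge0 => i _; have /andP[L0 _] := hL i.
  by rewrite mulr_ge0// mulr_ge0 ?sqrtr_ge0.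
have X1 : sT^-1 <= D / sT by rewrite ler_peMl// invr_ge0 ltW.
rewrite -sE.
have div x : x / sT ^+ 2 = x / sT / sT by rewrite expr2 invfM mulrA.
have u1 : q0 / (2 * beta * sT ^+ 2) <= Rb / (2 * beta) * (D / sT).
  rewrite [X in q0 * X]invfM [leLHS]mulrA; apply: ler_pM.
  - by rewrite divr_ge0// mulr_ge0// ltW.
  - by rewrite invr_ge0 sqr_ge0.
  - by rewrite ler_wpM2r// invr_ge0 mulr_ge0// ltW.
  - apply: le_trans X1; rewrite lef_pV2 ?posrE ?exprn_gt0//.
    by rewrite expr2 ler_peMl// ltW.
have half x y c : 0 <= c -> x <= 2 * sT -> 0 <= y -> c * x * y / sT ^+ 2 <= 2 * c * y / sT.
  move=> c0 hx y0; rewrite div ler_pM2r ?invr_gt0// ler_pdivrMr//.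
  have := ler_wpM2r y0 (ler_wpM2l c0 hx); lra.
have u2 : 2 * t1 * (3 * beta * A / (2 * alpha * nu)) / sT ^+ 2 <=
    24 * beta * Lm ^+ 2 / (alpha * nu) * (D / sT).
  apply: le_trans (half _ _ _ _ h1 _) _ => //.
    have := ltW b0; have := ltW a0; have := ltW n0 => ? ? ?.
    by rewrite divr_ge0 ?mulr_ge0.
  rewrite [leRHS]mulrA ler_pM2r ?invr_gt0//.
  have -> : 2 * 2 * (3 * beta * A / (2 * alpha * nu)) = 6 * beta / (alpha * nu) * A.
    by field; rewrite !gt_eqF.
  have -> : 24 * beta * Lm ^+ 2 / (alpha * nu) * D =
      6 * beta / (alpha * nu) * (4 * Lm ^+ 2 * D) by field; rewrite !gt_eqF.
  by apply: ler_wpM2l S1; rewrite divr_ge0 ?mulr_ge0 ?ltW.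
have u3 : 4 * t3 * (C / an) / sT ^+ 2 <= 8 * Num.sqrt 3 * Lm / an * (D / sT).
  apply: le_trans (half _ _ _ _ h3 _) _ => //; first by rewrite divr_ge0// ltW.
  rewrite [leRHS]mulrA ler_pM2r ?invr_gt0//.
  have -> : 8 * Num.sqrt 3 * Lm / an * D = 8 / an * (Num.sqrt 3 * Lm * D) by ring.
  have -> : 2 * 4 * (C / an) = 8 / an * C by ring.
  by apply: ler_wpM2l S2; rewrite divr_ge0// ltW.
have c30 : 0 <= alpha * nu * B / beta by rewrite divr_ge0 ?mulr_ge0// ?ltW.
have u4 : t2 * (alpha * nu * B / beta) / sT ^+ 2 <=
    2 * (alpha * nu * B / beta) * (D / sT).
  have := half t2 _ 1 ler01 h2 c30; rewrite mul1r mulr1 => /le_trans; apply.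
  by rewrite ler_wpM2l// mulr_ge0.
lra.
Qed.

End Rate.

Theorem theorem2 (R : realType) :
  exists Cst : R -> R -> R -> R -> R -> R -> R,
  forall (disp : measure_display) (Om : measurableType disp) (P : probability Om R)
    (d K N : nat) (f : forall k : 'I_K, 'cV[R]_(k.+1 * d) -> R) (L : 'I_K -> R)
    (mustar mu1 : 'I_K -> 'cV[R]_d) (Sig1 : 'I_K -> 'M[R]_d)
    (Rb B nul nub alpha beta nu : R)
    (zc : nat -> 'I_K -> 'I_N -> 'I_d -> Om -> R) (c1 c2 : nat -> 'I_K -> Om -> R),
    (0 < d)%N -> (0 < K)%N -> (0 < N)%N ->
    (* (A1) convexity *)
    (forall (k : 'I_K) (x y : 'cV[R]_(k.+1 * d)) (lam : R), 0 <= lam <= 1 ->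
        f k (lam *: x + (1 - lam) *: y) <= lam * f k x + (1 - lam) * f k y) ->
    (* (A2) Lipschitz w.r.t. the Euclidean norm *)
    (forall (k : 'I_K) (x y : 'cV[R]_(k.+1 * d)), `|f k x - f k y| <= L k * enorm (x - y)) ->
    (* (A3) *)
    (forall x : 'I_K -> 'cV[R]_d,
        \sum_(k < K) f k (catv (pre k mustar)) <= \sum_(k < K) f k (catv (pre k x))) ->
    \sum_(k < K) qform (invmx (Sig1 k)) (mu1 k - mustar k) <= Rb ->
    0 < nul -> nul <= nub ->
    loewner (nul *: 1%:M) (bdiag Sig1) -> loewner (bdiag Sig1) (nub *: 1%:M) ->
    \sum_(k < K) enorm (mustar k) ^+ 2 <= B ->
    (* initial covariances: symmetric positive definite *)
    (forall k, (Sig1 k)^T = Sig1 k /\ posdef (Sig1 k)) ->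
    (* parameters *)
    0 < alpha -> 0 < beta -> 0 < nu ->
    (forall k, (opnorm (Sig1 k))^-1 >= 5 / 3 * alpha * nu) ->
    (* samples: i.i.d. standard normal coordinates *)
    mutually_independent P
      (fun i : nat * 'I_K * 'I_N * 'I_d => zc i.1.1.1 i.1.1.2 i.1.2 i.2) ->
    (forall t k j l, std_normal P (zc t k j l)) ->
    (* constants c1, c2 chosen at iteration t from the information available
       (samples of iterations <= t), positive, satisfying (C1) and (C2) *)
    (forall t k, measurable_wrt
       (fun i : {i : nat * 'I_K * 'I_N * 'I_d | (i.1.1.1 <= t)%N} =>
          zc (val i).1.1.1 (val i).1.1.2 (val i).1.2 (val i).2) (c1 t k)) ->
    (forall t k, measurable_wrt
       (fun i : {i : nat * 'I_K * 'I_N * 'I_d | (i.1.1.1 <= t)%N} =>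
          zc (val i).1.1.1 (val i).1.1.2 (val i).1.2 (val i).2) (c2 t k)) ->
    (forall t k w, 0 < c1 t k w /\ 0 < c2 t k w) ->
    (forall t k w, (1 <= t)%N ->
       constr_C1 alpha beta nu t
         (rSig f alpha beta nu mu1 Sig1 zc c1 c2 t w k)
         (rH f alpha beta nu mu1 Sig1 zc c1 c2 t w k) /\
       constr_C2 nu (rG f alpha beta nu mu1 Sig1 zc c1 c2 t w k)) ->
    forall T : nat, (1 <= T)%N ->
    let C1 := 3 * beta * (\sum_(i < K) K%:R * L i ^+ 2 * ((i.+1 * d)%:R + 1) ^+ 2)
              / (2 * alpha * nu) in
    let C2 := (\sum_(i < K) Num.sqrt 3 * (i.+1 * d)%:R * L i) / Num.sqrt (alpha * nu) in
    let C3 := alpha * nu * B / beta in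
    let rhs := (\sum_(k < K) qform (invmx (Sig1 k)) (mu1 k - mustar k)) / (2 * beta * T%:R)
             + 2 * Num.sqrt (T.+1%:R) * C1 / T%:R
             + 4 * Num.sqrt (Num.sqrt (T.+1%:R)) * C2 / T%:R
             + Num.sqrt (T.+2%:R) * C3 / T%:R in
    ((T%:R^-1)%:E *
       (\sum_(1 <= t < T.+1) \sum_(k < K)
          'E_P[fun w => f k (catv (pre k (rmu f alpha beta nu mu1 Sig1 zc c1 c2 t w)))])
     - (\sum_(k < K) f k (catv (pre k mustar)))%:E <= rhs%:E)%E
    /\ rhs <= Cst alpha beta nu Rb B (\big[Num.max/0]_(i < K) L i)
              * ((d ^ 2 * K ^ 4)%:R / Num.sqrt T%:R).
Proof.
exists (fun alpha beta nu Rb B Lm => Rb / (2 * beta) + 24 * beta * Lm ^+ 2 / (alpha * nu)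
   + 8 * Num.sqrt 3 * Lm / Num.sqrt (alpha * nu) + 2 * (alpha * nu * B / beta)).
move=> disp Om P d K N f L mustar mu1 Sig1 Rb B nul nub alpha beta nu zc c1 c2.
move=> d0 K0 N0 fC fL _ hRb _ _ _ _ hB hSig1 alpha0 beta0 nu0 hop indX nz mc1 mc2 _ hC.
move=> T T1 C1 C2 C3 rhs.
have L0 i : 0 <= L i := lipschitz_cst_ge0 d0 fL i.
have B0 : 0 <= B.
  by apply: le_trans hB; apply: sumr_ge0 => k _; rewrite sqr_ge0.
set q0 := \sum_(k < K) qform (invmx (Sig1 k)) (mu1 k - mustar k) in hRb rhs *.
have q00 : 0 <= q0.
  apply: sumr_ge0 => k _; have [s p] := hSig1 k.
  by apply: posdef_psd; exact: posdef_inv.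
split; last first.
  apply: rate_bound => //; rewrite ?q00//.
  - by move=> i; rewrite L0/=; exact: le_bigmax.
  - exact: bigmax_ge_id.
have E := expected_regret_le mustar d0 N0 fC fL hSig1 alpha0 beta0 nu0 hop indX nz mc1 mc2 hC T1.
have iff t i : (1 <= t)%N -> _ := fun t1 =>
  intg_f d0 N0 fL hSig1 alpha0 beta0 nu0 hop indX nz mc1 mc2 hC i t1.
pose e t k := Ex P (fun w => f k (catv (pre k (rmu f alpha beta nu mu1 Sig1 zc c1 c2 t w)))).
have -> : (\sum_(1 <= t < T.+1) \sum_(k < K)
   'E_P[fun w => f k (catv (pre k (rmu f alpha beta nu mu1 Sig1 zc c1 c2 t w)))] =
   (\sum_(1 <= t < T.+1) \sum_(k < K) e t k)%:E)%E.
  rewrite -sumEFin; apply: eq_big_nat => t /andP[t1 _].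
  rewrite -sumEFin; apply: eq_bigr => k _; rewrite unlock.
  by apply: ExE; exact: iff.
rewrite -EFinM -EFinB lee_fin.
set Fs := \sum_(k < K) f k (catv (pre k mustar)).
have T0 : 0 < T%:R :> R by rewrite ltr0n.
have {}E : \sum_(1 <= t < T.+1) \sum_(k < K) e t k <= T%:R * rhs + T%:R * Fs.
  have -> : T%:R * Fs = \sum_(1 <= t < T.+1) Fs.
    by rewrite sumr_const_nat subn1 /= -[RHS]mulr_natl.
  rewrite -lerBlDr -sumrB; under eq_bigr do rewrite -sumrB.
  apply: le_trans E _.
  set Q := \sum_(i < K) K%:R * _ * _; set LN := \sum_(i < K) (i.+1 * d)%:R * _.
  have Q0 : 0 <= Q.
    by apply: sumr_ge0 => i _; rewrite mulr_ge0 ?sqr_ge0// mulr_ge0 ?sqr_ge0.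
  have LN0 : 0 <= LN by apply: sumr_ge0 => i _; rewrite mulr_ge0.
  have -> : T%:R * rhs = q0 / (2 * beta) + C3 * Num.sqrt T.+2%:R +
      2 * C1 * Num.sqrt T.+1%:R + 4 * C2 * Num.sqrt (Num.sqrt T.+1%:R).
    by rewrite /rhs; field; rewrite !gt_eqF.
  have Bs : \sum_k dotv (mustar k) (mustar k) <= B.
    by apply: le_trans hB; apply: ler_sum => k _; rewrite enorm_sqr.
  have k1 : (\sum_k dotv (mustar k) (mustar k)) *
      (alpha * nu / beta * Num.sqrt T.+2%:R) <= C3 * Num.sqrt T.+2%:R.
    have -> : C3 * Num.sqrt T.+2%:R = B * (alpha * nu / beta * Num.sqrt T.+2%:R).
      by rewrite /C3; field; rewrite gt_eqF.
    by apply: ler_wpM2r Bs; rewrite mulr_ge0 ?sqrtr_ge0// divr_ge0 ?mulr_ge0 ?ltW.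
  have sT : Num.sqrt T%:R <= Num.sqrt T.+1%:R :> R by rewrite ler_wsqrtr// ler_nat.
  have k2 : beta / (alpha * nu) * (3 * Num.sqrt T%:R) * Q <=
      2 * C1 * Num.sqrt T.+1%:R.
    have -> : 2 * C1 * Num.sqrt T.+1%:R =
        beta / (alpha * nu) * (3 * Num.sqrt T.+1%:R) * Q.
      by rewrite /C1 -/Q; field; rewrite !gt_eqF.
    apply: ler_wpM2r => //; apply: ler_wpM2l; last by apply: ler_wpM2l.
    by rewrite divr_ge0 ?mulr_ge0 ?ltW.
  have k3 : Num.sqrt 3 / Num.sqrt (alpha * nu) * (4 * Num.sqrt (Num.sqrt T%:R)) * LN <=
      4 * C2 * Num.sqrt (Num.sqrt T.+1%:R).
    have -> : 4 * C2 * Num.sqrt (Num.sqrt T.+1%:R) = Num.sqrt 3 /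
        Num.sqrt (alpha * nu) * (4 * Num.sqrt (Num.sqrt T.+1%:R)) * LN.
      have -> : C2 = Num.sqrt 3 * LN / Num.sqrt (alpha * nu).
        rewrite /C2 /LN mulr_sumr; congr (_ / _).
        by apply: eq_bigr => i _; rewrite mulrA.
      by ring.
    apply: ler_wpM2r => //; apply: ler_wpM2l.
      by rewrite divr_ge0 ?sqrtr_ge0.
    by apply: ler_wpM2l => //; exact: ler_wsqrtr.
  rewrite -/q0; lra.
rewrite lerBlDr -(ler_pM2l T0) mulVKf ?gt_eqF// mulrDr.
exact: E.
Qed.
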